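(* Let $X_1, X_2, \ldots$ be independent, identically distributed real random variables with $\mathbb{E}[X_i]=0$, variance $\mathbb{E}[X_i^2]=\sigma^2$ with $0<\sigma<\infty$, and $\mathbb{E}[|X_i|^{2+\delta}]<\infty$ for some $\delta>0$. Then, almost surely, $$\max_{\pi\in\mathcal{P}_N}\ \sum_{I\in\pi}\Big|\sum_{i\in I}X_i\Big|^2\ \sim\ 2\sigma^2 N\ln\ln N \qquad (N\to\infty),$$ i.e. almost surely the ratio of the left-hand side to $2\sigma^2 N\ln\ln N$ converges to $1$ as $N\to\infty$.
   Context: $[N]=\{1,\dots,N\}$. $\mathcal{P}_N$ denotes the set of all partitions of $[N]$ into subintervals (sets of consecutive integers); each $\pi\in\mathcal{P}_N$ is a collection of disjoint intervals whose union is $[N]$. $\ln$ is the natural logarithm. *)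

(* Defs.v *)
From HB Require Import structures.
From mathcomp Require Import all_boot all_order all_algebra finmap.
From mathcomp Require Import all_classical all_reals all_analysis.

Set Implicit Arguments.
Unset Strict Implicit.
Unset Printing Implicit Defensive.

Import Order.TTheory GRing.Theory Num.Theory.
Import numFieldNormedType.Exports.

Local Open Scope classical_set_scope.
Local Open Scope ring_scope.

(* Indices are shifted down by one throughout: 'I_N = {0, ..., N-1} stands for
   [N] = {1, ..., N}, and a sequence (X_1, X_2, ...) is X 0, X 1, ... *)

Definition is_interval_set (N : nat) (I : {set 'I_N}) : bool :=
  [exists a : 'I_N, exists b : 'I_N, I == [set i : 'I_N | (a <= i <= b)%N]%SET].

Definition interval_partition (N : nat) (pi : {set {set 'I_N}}) : bool :=
  finset.partition pi [set: 'I_N]%SET && [forall I in pi, is_interval_set I].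

(* The default value 0 is harmless: the values are nonnegative and an interval
   partition exists for every N (for N = 0, the empty one). *)
Definition max_interval_energy (R : realType) (x : nat -> R) (N : nat) : R :=
  \big[Num.max/0]_(pi : {set {set 'I_N}} | interval_partition pi)
    \sum_(I in pi) `|\sum_(i in I) x i| ^+ 2.

Definition mutually_independent (R : realType) (d : measure_display)
    (T : measurableType d) (P : probability T R) (X : nat -> {RV P >-> R}) :=
  forall (J : {fset nat}) (B : nat -> set R),
    (forall i, i \in J -> measurable (B i)) ->
    P (\bigcap_(i in [set` J]) (X i @^-1` B i)) =
    (\prod_(i <- J) P (X i @^-1` B i))%E.

(* Laws are compared on Borel sets only: `distribution` is also applicable to
   non-measurable sets, where its values are meaningless. *)
Definition identically_distributed (R : realType) (d : measure_display)
    (T : measurableType d) (P : probability T R) (X : nat -> {RV P >-> R}) :=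
  forall (i j : nat) (B : set R), measurable B ->
    distribution P (X i) B = distribution P (X j) B.

(* Main.v *)
(* Upper bound: let the scale classes be the ranges [len k, len k.+1) of interval
   lengths, with consecutive ratios close to 1, so that k is of order ln of the length
   and ln k is about ln (ln length). For a class k and a grid point j, a
   Bernstein-Doob estimate for the truncated variables bounds the expected squared
   excess of the sums of class k near j over the level 2 sigma^2 len k ln k by a
   multiple of mesh k * k^-(1 + eps). Divided by mesh k this is summable in k, so the
   maximal ergodic inequality makes the total excess along [0, N) of order N almost
   surely, which is negligible against N ln (ln N).

   Lower bound: call a position s bad at level m if none of the blocks
   [s + A^k, s + A^(k+1)) with m <= k < 2m has energy close to 2 sigma^2 |block| ln m.
   The blocks are independent and an exponential tilting shows that each one is that
   large with probability at least m^-(1 - kappa) / 4, so bad positions have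
   probability at most exp (- m^kappa / 4). By Borel-Cantelli almost all positions
   below N are good, where m is of order ln N, and walking greedily from one large
   block to the next yields a partition of nearly maximal energy. *)

Require Import Defs.
From HB Require Import structures.
From mathcomp Require Import all_boot all_order all_algebra finmap.
From mathcomp Require Import all_classical all_reals all_analysis.
From mathcomp Require Import measurable_realfun.
From mathcomp Require Import ring lra zify.

Set Implicit Arguments.
Unset Strict Implicit.
Unset Printing Implicit Defensive.

Import Order.TTheory GRing.Theory Num.Theory.
Import numFieldNormedType.Exports.

Local Open Scope classical_set_scope.
Local Open Scope ring_scope.

(** * Interval partitions *)

(** There are exponentially many partitions, and some intervals always exceed the iterated-logarithm
    level, so neither a union bound nor an almost sure bound on single intervals controls the
    maximum. Instead the energy of every interval is dominated by the mass that one nonnegative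
    function puts on it. Every partition energy is then at most the total mass, and only averages of
    that function matter.

    The moment of order 2 + delta is spent on truncating sums of n terms at b = n^(1/(2+delta)).
    With tilts theta of order sqrt(ln k / n), theta b tends to 0 because n is exponential in k, so
    moment generating functions are nearly Gaussian, while the discarded part has second moment of
    order n^(1 - delta/(2+delta)).

    All accuracy parameters depend on one integer p: eps = eta = 1/p and H = p^2 above; kappa =
    1/(8p), A = 2p and eta = 1/(4p) below. Hence countably many null sets suffice before p grows.
    The probabilistic estimates are made on the space of sequences, where the shift preserves the
    law. *)

Section interval_energy.
Context {R : realType}.
Implicit Types (x G : nat -> R) (a b N : nat).

Lemma sum_ord_interval x N a b : (b < N)%N ->
  \sum_(i in [set i : 'I_N | (a <= i <= b)%N]%SET) x i = \sum_(a <= i < b.+1) x i.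
Proof.
move=> bN.
transitivity (\sum_(i < N | (a <= i)%N && (i < b.+1)%N) x i).
  by apply: eq_bigl => i; rewrite inE ltnS.
rewrite -(big_mkord (fun i => (a <= i)%N && (i < b.+1)%N) x).
rewrite [RHS](@big_nat_widen _ _ _ a b.+1 N)// (@big_nat_widenl _ _ _ a 0)//=.
by apply: eq_bigl => i; rewrite andbC.
Qed.

(** The masses of [G] on the blocks of a partition add up to its total mass, so a bound for single
    intervals bounds all partitions at once. *)
Lemma max_interval_energy_le x G N :
  (forall i, 0 <= G i) ->
  (forall a b, (a < b <= N)%N ->
    `|\sum_(a <= i < b) x i| ^+ 2 <= \sum_(a <= i < b) G i) ->
  max_interval_energy x N <= \sum_(i < N) G i.
Proof.
move=> G0 xG; apply: bigmax_le => [|pi]; first exact: sumr_ge0.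
move=> /andP[ppi /forall_inP ipi].
rewrite [leRHS](_ : _ = \sum_(i in [set: 'I_N]%SET) G i); last first.
  by apply: eq_bigl => i; rewrite inE.
rewrite (finset.set_partition_big _ ppi); apply: ler_sum => I /ipi.
move=> /existsP[a /existsP[b /eqP Iab]].
rewrite Iab !sum_ord_interval//.
(* [is_interval_set] also allows [a > b], which encodes the empty set; both sums then vanish. *)
have [ab|ba] := leqP a b; first by apply: xG; rewrite ltnS ab ltn_ord.
by rewrite !big_geq// normr0 expr0n.
Qed.

Let energy x N (pi : {set {set 'I_N}}) := \sum_(I in pi) `|\sum_(i in I) x i| ^+ 2.

(** The competitor on ['I_b] is the image of [pi] under the inclusion, with the single block [J]
    from [a] to [b.-1] added. Most of the proof checks that it is an interval partition. *)
Lemma energy_append x a b (pi : {set {set 'I_a}}) : (a < b)%N ->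
  interval_partition pi ->
  energy x pi + `|\sum_(a <= i < b) x i| ^+ 2 <= max_interval_energy x b.
Proof.
move=> ab /andP[/and3P[/eqP cpi tpi pi0] /forall_inP ipi].
have ab' := ltnW ab.
pose w : 'I_a -> 'I_b := widen_ord ab'.
have winj : injective w by move=> i j /(congr1 val) /= /val_inj.
pose J := [set i : 'I_b | (a <= i <= b.-1)%N]%SET.
pose em (I : {set 'I_a}) : {set 'I_b} := (w @: I)%SET.
have eminj : injective em by exact: imset_inj.
pose pi' := (J |: em @: pi)%SET.
have JE I : em I != J.
  apply/eqP => /finset.setP /(_ (Ordinal (leq_ltn_trans (leqnn b.-1) (ltac:(lia) : b.-1 < b)%N))).
  rewrite !inE /= leqnn andbT (_ : (a <= b.-1)%N); last by lia.
  by move=> /imsetP[i _ /(congr1 val)/= bi]; have := ltn_ord i; lia.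
have Jnot : J \notin (em @: pi)%SET.
  by apply/negP => /imsetP[I _ /eqP]; rewrite eq_sym; apply/negP.
have Epi' : energy x pi' = energy x pi + `|\sum_(a <= i < b) x i| ^+ 2.
  rewrite /energy /pi' big_setU1//= addrC; congr (_ + _).
    rewrite big_imset/=; last by move=> ? ? _ _; exact: eminj.
    by apply: eq_bigr => I _; rewrite big_imset//= => ? ? _ _; exact: winj.
  by rewrite sum_ord_interval ?prednK//; lia.
rewrite -Epi' /max_interval_energy.
apply: (@le_bigmax_cond _ _ _ 0 pi' (@interval_partition b) (energy x (N:=b))).
apply/andP; split; last first.
  apply/forall_inP => I; rewrite !inE => /orP[/eqP ->|/imsetP[I' I'pi ->]].
    apply/existsP; exists (Ordinal ab); apply/existsP.
    by exists (Ordinal (ltac:(lia) : b.-1 < b)%N).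
  have /existsP[c /existsP[d /eqP ->]] := ipi _ I'pi.
  apply/existsP; exists (w c); apply/existsP; exists (w d).
  apply/eqP/finset.setP => i; rewrite !inE/=; apply/imsetP/idP.
    by move=> [j]; rewrite inE => hj ->.
  move=> /andP[ci id]; have ia : (i < a)%N by exact: leq_ltn_trans id (ltn_ord d).
  by exists (Ordinal ia); [rewrite inE/= ci id|exact: val_inj].
apply/and3P; split.
- apply/eqP/finset.setP => i; rewrite inE; apply/finset.bigcupP.
  have [ia|ai] := ltnP i a.
    have : Ordinal ia \in finset.cover pi by rewrite cpi inE.
    move=> /finset.bigcupP[I Ipi iI]; exists (em I).
      by rewrite inE; apply/orP; right; exact: imset_f.
    by apply/imsetP; exists (Ordinal ia) => //; exact: val_inj.
  exists J; first by rewrite !inE eqxx.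
  by rewrite inE ai/=; have := ltn_ord i; lia.
- apply/finset.trivIsetP => A B; rewrite !inE.
  have dJ I : fintype.disjoint (mem J) (mem (em I)).
    apply/pred0P => i /=; apply/negbTE; rewrite inE; apply/negP => /andP[/andP[ai _]].
    by move=> /imsetP[j _ /(congr1 val)/= e]; have := ltn_ord j; lia.
  move=> /orP[/eqP ->|/imsetP[I Ipi ->]] /orP[/eqP ->|/imsetP[I' I'pi ->]] //.
  + by rewrite eqxx.
  + by move=> _; rewrite fintype.disjoint_sym.
  + move=> neq; rewrite imset_disjoint//.
    apply: (finset.trivIsetP tpi) => //; apply: contraNneq neq => ->//.
- rewrite !inE negb_or; apply/andP; split.
    apply/eqP => /finset.setP/(_ (Ordinal (ltac:(lia) : b.-1 < b)%N)).
    by rewrite !inE/= leqnn andbT; lia.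
  apply/imsetP => -[I Ipi /esym/eqP]; rewrite imset_eq0 => /eqP I0.
  by move: pi0; rewrite -I0 Ipi.
Qed.

Lemma interval_partition_exists a : exists pi : {set {set 'I_a}}, interval_partition pi.
Proof.
case: a => [|a].
  exists finset.set0; apply/andP; split.
    apply/and3P; split.
    - by apply/eqP/finset.setP => -[].
    - by apply/finset.trivIsetP => A B; rewrite inE.
    - by rewrite inE.
  by apply/forall_inP => I; rewrite inE.
exists [set [set: 'I_a.+1]]%SET; apply/andP; split.
  apply/and3P; split.
  - by rewrite /finset.cover big_set1.
  - by apply/finset.trivIsetP => A B; rewrite !inE => /eqP -> /eqP ->; rewrite eqxx.
  - by rewrite inE; apply/eqP => /finset.setP/(_ ord0); rewrite !inE.
apply/forall_inP => I; rewrite inE => /eqP ->.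
apply/existsP; exists ord0; apply/existsP; exists ord_max.
by apply/eqP/finset.setP => i; rewrite !inE /= -ltnS ltn_ord.
Qed.

Lemma max_interval_energy_append x a b : (a < b)%N ->
  max_interval_energy x a + `|\sum_(a <= i < b) x i| ^+ 2 <= max_interval_energy x b.
Proof.
move=> ab; rewrite -lerBrDr; apply: bigmax_le => [|pi ppi].
  (* The maximum starts from the default 0, so the inequality is also needed with 0 in place of an
     energy; any partition of the first [a] points provides it. *)
  have [pi ppi] := interval_partition_exists a.
  rewrite subr_ge0; apply: le_trans (energy_append x ab ppi).
  by rewrite lerDr; apply: sumr_ge0 => I _; exact: exprn_ge0.
by rewrite lerBrDr; exact: energy_append.
Qed.

Lemma max_interval_energy_ge0 x a : 0 <= max_interval_energy x a.
Proof. exact: bigmax_ge_id. Qed.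

Lemma max_interval_energy_homo x a b : (a <= b)%N ->
  max_interval_energy x a <= max_interval_energy x b.
Proof.
rewrite leq_eqVlt => /orP[/eqP ->//|ab].
by apply: le_trans (max_interval_energy_append x ab); rewrite lerDl exprn_ge0.
Qed.

End interval_energy.

(** * The shift on the space of real sequences *)

(** Boxes over finitely many coordinates: a pi-system, so that two probability measures agreeing on
    it are equal. *)
Definition cylinders (R : realType) : set (set (nat -> R)) :=
  [set A | exists (n : nat) (B : nat -> set R), (forall i, measurable (B i)) /\
     A = [set w | forall i, (i < n)%N -> B i (w i)]].

Definition seqspace (R : realType) := g_sigma_algebraType (@cylinders R).

HB.instance Definition _ (R : realType) := Measurable.on (seqspace R).

Section seqspace.
Context {R : realType}.
Local Notation Om := (seqspace R).

Lemma cylindersI : setI_closed (@cylinders R).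
Proof.
move=> _ _ [n [B [mB ->]]] [m [C [mC ->]]].
pose D i := (if (i < n)%N then B i else setT) `&` (if (i < m)%N then C i else setT).
exists (maxn n m), D; split.
  by move=> i; apply: measurableI; case: ifP.
apply/seteqP; split=> w /=.
  by move=> [hB hC] i _; split; case: ifPn => // ?; [exact: hB|exact: hC].
move=> h; split=> i hi.
  by have := (h i (leq_trans hi (leq_maxl _ _))).1; rewrite hi.
by have := (h i (leq_trans hi (leq_maxr _ _))).2; rewrite hi.
Qed.

Lemma measurable_cylinder (n : nat) (B : nat -> set R) :
  (forall i, measurable (B i)) ->
  measurable ([set w | forall i, (i < n)%N -> B i (w i)] : set Om).
Proof. by move=> mB; apply: sub_sigma_algebra; exists n, B. Qed.

Lemma measurable_coord i : measurable_fun setT ((fun w => w i) : Om -> R).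
Proof.
move=> _ B mB; rewrite setTI.
pose C j := if j == i then B else setT.
rewrite (_ : _ @^-1` _ = [set w | forall j, (j < i.+1)%N -> C j (w j)]).
  by apply: measurable_cylinder => j; rewrite /C; case: ifP.
apply/seteqP; split=> w /=.
  by move=> h j _; rewrite /C; case: eqP => // ->.
by move=> /(_ i (leqnn _)); rewrite /C eqxx.
Qed.

Lemma measurable_to_seqspace d (T : measurableType d) (f : T -> Om) :
  (forall i, measurable_fun setT (fun t => f t i)) -> measurable_fun setT f.
Proof.
move=> mf; have h := @measurability _ _ T Om setT f (@cylinders R) erefl; apply: h.
move=> _ [_ [n [B [mB ->]]] <-]; rewrite setTI.
rewrite (_ : _ @^-1` _ =
    \bigcap_i (if (i < n)%N then (fun t => f t i) @^-1` (B i) else setT)).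
  apply: bigcapT_measurable => i; case: ifP => // _.
  by rewrite -[X in measurable X]setTI; exact: mf.
apply/seteqP; split=> t /= h i; first by move=> _ /=; case: ifPn => // /h.
by move=> hi; have := h i I; rewrite hi.
Qed.

End seqspace.

(** * Independence and stationarity on the sequence space *)

Section iid_law.
Context {R : realType}.
Local Notation Om := (seqspace R).

Definition shift (n : nat) (w : Om) : Om := fun i => w (n + i)%N.

(** The first [n] terms of one sequence followed by the whole of another, so that [shift n] recovers
    the second one. *)
Definition glue (n : nat) (uv : Om * Om) : Om :=
  fun i => if (i < n)%N then uv.1 i else uv.2 (i - n)%N.

Lemma measurable_shift n : measurable_fun setT (shift n).
Proof. by apply: measurable_to_seqspace => i; exact: measurable_coord. Qed.

Lemma measurable_glue n : measurable_fun setT (glue n).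
Proof.
apply: measurable_to_seqspace => i; rewrite /glue; case: (i < n)%N.
  exact: (measurableT_comp (measurable_coord i) measurable_fst).
exact: (measurableT_comp (measurable_coord (i - n)) measurable_snd).
Qed.

(* [nu] is the infinite product of copies of [mu]; only its values on cylinders are
   prescribed, and they determine it. *)
Definition iid_law (nu : set Om -> \bar R) := exists2 mu : probability R R, True &
  forall (n : nat) (B : nat -> set R), (forall i, measurable (B i)) ->
    nu [set w | forall i, (i < n)%N -> B i (w i)] = (\prod_(i < n) mu (B i))%E.

(** Replaces measurability with respect to the sigma-algebra of the first [n] coordinates, without
    introducing a filtration. *)
Definition first_coords (n : nat) (S : Type) (F : Om -> S) :=
  forall u v : Om, (forall i, (i < n)%N -> u i = v i) -> F u = F v.

Variable nu : probability Om R.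
Hypothesis iid : iid_law nu.

Let gm n : {mfun (Om * Om)%type >-> Om} :=
  HB.pack (glue n) (isMeasurableFun.Build _ _ _ _ _ (measurable_glue n)).

(** Independence of past and future together with stationarity, as one identity of laws. By the
    pi-lambda theorem it is enough to compare the two measures on cylinders, where both are products
    of values of [mu]. *)
Lemma glue_law n (A : set Om) : measurable A ->
  distribution (nu \x nu)%E (gm n) A = nu A.
Proof.
have [mu _ hnu] := iid.
apply: (@measure_unique _ R Om (@cylinders R) (fun=> setT) erefl cylindersI _ _ (distribution (nu \x nu)%E (gm n)) nu).
- by move=> _; exists 0%N, (fun=> setT); split=> //; apply/seteqP; split.
- by rewrite bigcup_const.
- move=> _ [m [B [mB ->]]].
  (* Padding with [setT] turns a cylinder of length [m] into one of length [n + m], which splits at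
     [n] whatever the order of [m] and [n]. *)
  pose C i := if (i < m)%N then B i else setT.
  have mC i : measurable (C i) by rewrite /C; case: ifP.
  rewrite (_ : [set w | _] = [set w : Om | forall i, (i < n + m)%N -> C i (w i)]); last first.
    apply/seteqP; split=> w /= h i hi.
      by rewrite /C; case: ifPn => // /h.
    by have := h i (ltn_addl _ hi); rewrite /C hi.
  transitivity (\prod_(i < n + m) mu (C i))%E; last by symmetry; exact: hnu.
  rewrite big_split_ord /= /distribution /pushforward/=.
  rewrite (_ : _ @^-1` _ =
    [set w : Om | forall i, (i < n)%N -> C i (w i)] `*`
    [set w : Om | forall i, (i < m)%N -> C (n + i)%N (w i)]).
    rewrite product_measure1E.
    - by congr (_ * _)%E; [exact: (hnu n C)|exact: (hnu m (fun i => C (n + i)%N))].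
    - exact: measurable_cylinder.
    - exact: (@measurable_cylinder _ m (fun i => C (n + i)%N)).
  apply/seteqP; split=> -[u v] /=; rewrite /glue/=.
    move=> h; split=> i hi.
      by have := h i (ltn_addr _ hi); rewrite hi.
    have := h (n + i)%N; rewrite ltn_add2l addKn => /(_ hi).
    by have -> : (n + i < n)%N = false by lia.
  move=> [h1 h2] i hi; case: ltnP => hin; first exact: h1.
  by have := h2 (i - n)%N; rewrite subnKC//; apply; rewrite ltn_subLR.
- by move=> k; apply: (@le_lt_trans _ _ 1%E); [exact: probability_le1|exact: ltry].
Qed.

(** Change of variables along [glue n], then Tonelli: after gluing, [F] sees only the first sequence
    and [G] only the second. *)
Lemma integral_glue n (F G : Om -> \bar R) :
  measurable_fun [set: Om] F -> measurable_fun [set: Om] G ->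
  (forall w, 0 <= F w)%E -> (forall w, 0 <= G w)%E -> first_coords n F ->
  (\int[nu]_w (F w * G (shift n w)) = \int[nu]_w F w * \int[nu]_w G w)%E.
Proof.
move=> mF mG F0 G0 Fn.
have mH : measurable_fun setT (fun w => F w * G (shift n w))%E.
  by apply: emeasurable_funM => //; apply: measurableT_comp => //; exact: measurable_shift.
rewrite -(@eq_measure_integral _ _ _ _ _ (distribution (nu \x nu)%E (gm n))); last first.
  by move=> A mA _; exact: glue_law.
rewrite ge0_integral_distribution//; last by move=> y; exact: mule_ge0.
rewrite fubini_tonelli1; last 2 first.
- by apply: measurableT_comp => //; exact: measurable_glue.
- by move=> z; exact: mule_ge0.
under eq_integral => u _.
  rewrite /fubini_F/=.
  under eq_integral => v _.
    rewrite (Fn (glue n (u, v)) u); last by move=> i hi; rewrite /glue hi.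
    rewrite (_ : shift n _ = v); last first.
      by apply/funext => i; rewrite /shift /glue/= ltnNge leq_addr/= addKn.
    over.
  rewrite ge0_integralZl//.
  over.
by rewrite ge0_integralZr//; exact: integral_ge0.
Qed.

Lemma integral_shift n (G : Om -> \bar R) :
  measurable_fun [set: Om] G -> (forall w, 0 <= G w)%E ->
  (\int[nu]_w G (shift n w) = \int[nu]_w G w)%E.
Proof.
move=> mG G0.
have := @integral_glue n (cst 1%E) G (measurable_cst _) mG (fun=> lee01) G0 (fun _ _ _ => erefl).
rewrite [X in (_ = X * _)%E](_ : _ = 1%E) ?mul1e; last first.
  by rewrite integral_cst//= [X in (1 * X)%E](_ : _ = 1%E) ?mule1//; exact: probability_setT.
by move=> <-; apply: eq_integral => w _; rewrite mul1e.
Qed.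

End iid_law.

(** * Second-order bounds for the exponential *)

Section exponential_bounds.
Context {R : realType}.
Implicit Types x y z D : R.

Lemma expR_ge1 z : 0 <= z -> 1 <= expR z.
Proof. by move=> z0; rewrite -expR0 ler_expR. Qed.

Lemma ge0_derive_le (f df : R -> R) :
  (forall x, is_derive x 1 f (df x)) -> (forall x, 0 <= x -> 0 <= df x) ->
  forall z, 0 <= z -> f 0 <= f z.
Proof.
move=> fd df0 z z0.
have [|c] := @MVT_segment R f df 0 z z0 (fun x _ => fd x).
  by apply: derivable_within_continuous => x _; case: (fd x).
rewrite in_itv/= => /andP[c0 _] fz.
by rewrite -subr_ge0 fz subr0 mulr_ge0// df0.
Qed.

Let quad_le_expR z : 0 <= z -> 1 + z + z ^+ 2 / 2 <= expR z.
Proof.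
move=> z0.
pose f x := expR x - x - 2^-1 * x ^+ 2.
suff: f 0 <= f z by rewrite /f expR0; lra.
apply: (@ge0_derive_le f (fun x => expR x - 1 - x)) => // [x|x _].
  rewrite (_ : f = (expR - id - 2^-1 \*: (id ^+ 2))); last by [].
  apply: is_derive_eq.
  by rewrite ?fctE /GRing.scale/=; field.
by have := expR_ge1Dx x; lra.
Qed.

Let expR_le_quad z : 0 <= z -> expR z <= 1 + z + z ^+ 2 / 2 * expR z.
Proof.
move=> z0.
pose f x := x + 2^-1 * (x ^+ 2 * expR x) - expR x.
suff: f 0 <= f z by rewrite /f expR0; lra.
apply: (@ge0_derive_le f (fun x => 1 + (x * expR x + x ^+ 2 / 2 * expR x) - expR x)) => // [x|x x0].
  rewrite (_ : f = (id + 2^-1 \*: (id ^+ 2 * expR) - expR)); last by [].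
  apply: is_derive_eq.
  by rewrite ?fctE /GRing.scale/=; field.
have h1 : expR x * (1 - x) <= 1.
  rewrite -ler_pdivlMl ?expR_gt0// mulr1 -expRN; exact: expR_ge1Dx.
have : 0 <= x ^+ 2 / 2 * expR x by rewrite mulr_ge0 ?expR_ge0// divr_ge0// exprn_ge0.
lra.
Qed.

(** Bounds at the negative point [- z] are multiplied by [expR z]: the derivatives then reduce to
    [x * (expR x - 1)] here and [x ^+ 2 / 2 * expR x] in the next lemma, whose signs are evident. *)
Let quad_le_expRN z : 0 <= z -> expR z * (1 - z) + z ^+ 2 / 2 <= 1.
Proof.
move=> z0.
pose f x := x * expR x - expR x - 2^-1 * x ^+ 2.
suff: f 0 <= f z by rewrite /f expR0; lra.
apply: (@ge0_derive_le f (fun x => x * (expR x - 1))) => // [x|x x0].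
  rewrite (_ : f = (id * expR - expR - 2^-1 \*: (id ^+ 2))); last by [].
  apply: is_derive_eq.
  by rewrite ?fctE /GRing.scale/=; field.
by rewrite mulr_ge0// subr_ge0 expR_ge1.
Qed.

Let expRN_le_quad z : 0 <= z -> 1 <= expR z * (1 - z + z ^+ 2 / 2).
Proof.
move=> z0.
pose f x := expR x - x * expR x + 2^-1 * (x ^+ 2 * expR x).
suff: f 0 <= f z by rewrite /f expR0; lra.
apply: (@ge0_derive_le f (fun x => x ^+ 2 / 2 * expR x)) => // [x|x x0].
  rewrite (_ : f = (expR - (id * expR) + 2^-1 \*: (id ^+ 2 * expR))); last by [].
  apply: is_derive_eq.
  by rewrite ?fctE /GRing.scale/=; field.
by rewrite mulr_ge0 ?expR_ge0// divr_ge0// exprn_ge0.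
Qed.

(** Keeping the exact linear term lets it vanish for centred variables, and the factor [expR D] is
    close to 1 when the exponent is uniformly small. [taylor2_le_expR] is the matching lower
    bound. *)
Lemma expR_le_taylor2 y D : `|y| <= D -> expR y <= 1 + y + y ^+ 2 / 2 * expR D.
Proof.
move=> yD; have D0 : 0 <= D by exact: le_trans yD.
have [y0|/ltW y0] := leP 0 y.
  apply: le_trans (expR_le_quad y0) _.
  rewrite lerD2l; apply: ler_wpM2l; first by rewrite divr_ge0// exprn_ge0.
  by rewrite ler_expR; exact: le_trans (ler_norm _) yD.
have z0 : 0 <= - y by lra.
have := expRN_le_quad z0; rewrite expRN mulrC ler_pdivlMr ?expR_gt0// mul1r opprK sqrrN.
by move=> /le_trans; apply; rewrite lerD2l ler_peMr ?expR_ge1// divr_ge0// exprn_even_ge0.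
Qed.

Lemma taylor2_le_expR y D : `|y| <= D -> 1 + y + y ^+ 2 / 2 * expR (- D) <= expR y.
Proof.
move=> yD; have D0 : 0 <= D by exact: le_trans yD.
have y2 : 0 <= y ^+ 2 / 2 by rewrite divr_ge0 ?sqr_ge0.
have [y0|/ltW y0] := leP 0 y.
  apply: le_trans (quad_le_expR y0).
  by rewrite lerD2l ler_piMr// expR_le1 oppr_le0.
have z0 : 0 <= - y by lra.
have h := quad_le_expRN z0.
rewrite expRN sqrrN opprK in h.
have e0 := expR_gt0 y.
have h2 : 1 + y + y ^+ 2 / 2 * expR y <= expR y.
  have -> : 1 + y + y ^+ 2 / 2 * expR y = expR y * ((expR y)^-1 * (1 + y) + y ^+ 2 / 2).
    by field; rewrite gt_eqF.
  by rewrite -[leRHS]mulr1 ler_pM2l.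
apply: le_trans h2; rewrite lerD2l; apply: ler_wpM2l => //.
by rewrite ler_expR lerNl; apply: le_trans yD; rewrite ler0_norm.
Qed.

End exponential_bounds.

(** * Expectations of nonnegative functions *)

Section nonneg_expectation.
Context d (T : measurableType d) (R : realType) (P : probability T R).
Implicit Types F G : T -> R.

Lemma exD F G : measurable_fun [set: T] F -> measurable_fun [set: T] G ->
  (forall w, 0 <= F w) -> (forall w, 0 <= G w) ->
  (\int[P]_w (F w + G w)%:E = \int[P]_w (F w)%:E + \int[P]_w (G w)%:E)%E.
Proof.
move=> mF mG F0 G0; rewrite -ge0_integralD//.
- by move=> w _; rewrite lee_fin.
- exact/measurable_EFinP.
- by move=> w _; rewrite lee_fin.
- exact/measurable_EFinP.
Qed.

Lemma exZ F (c : R) : measurable_fun [set: T] F -> (forall w, 0 <= F w) -> 0 <= c ->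
  (\int[P]_w (c * F w)%:E = c%:E * \int[P]_w (F w)%:E)%E.
Proof.
move=> mF F0 c0; rewrite -ge0_integralZl//.
- exact/measurable_EFinP.
- by move=> w _; rewrite lee_fin.
Qed.

Lemma ex_le F G : measurable_fun [set: T] F -> measurable_fun [set: T] G ->
  (forall w, 0 <= F w) -> (forall w, F w <= G w) ->
  (\int[P]_w (F w)%:E <= \int[P]_w (G w)%:E)%E.
Proof.
move=> mF mG F0 FG; apply: ge0_le_integral => //.
- by move=> w _; rewrite lee_fin.
- exact/measurable_EFinP.
- exact/measurable_EFinP.
- by move=> w _; rewrite lee_fin.
Qed.

Lemma ex_ge0 F : (forall w, 0 <= F w) -> (0 <= \int[P]_w (F w)%:E)%E.
Proof. by move=> F0; apply: integral_ge0 => w _; rewrite lee_fin. Qed.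

Lemma ex_cst (c : R) : (\int[P]_w c%:E = c%:E)%E.
Proof.
rewrite -[LHS]/(\int[P]_w (cst c%:E w))%E integral_cst//.
by rewrite [X in (_ * X)%E](_ : _ = 1%E) ?mule1//; exact: probability_setT.
Qed.

Lemma ex_sum (I : Type) (s : seq I) (F : I -> T -> R) :
  (forall i, measurable_fun [set: T] (F i)) -> (forall i w, 0 <= F i w) ->
  (\int[P]_w (\sum_(i <- s) F i w)%:E = \sum_(i <- s) \int[P]_w (F i w)%:E)%E.
Proof.
move=> mF F0; under eq_integral do rewrite -sumEFin.
rewrite ge0_integral_sum//.
- by move=> i; exact/measurable_EFinP.
- by move=> i w _; rewrite lee_fin.
Qed.

Lemma ex_fin F (M : R) : measurable_fun [set: T] F ->
  (forall w, 0 <= F w) -> (forall w, F w <= M) ->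
  (\int[P]_w (F w)%:E)%E \is a fin_num.
Proof.
move=> mF F0 FM; rewrite ge0_fin_numE ?ex_ge0//.
apply: le_lt_trans (ltry M).
rewrite -(ex_cst M); apply: ex_le => //.
Qed.

Lemma prob_exE (A : set T) : measurable A -> P A = (\int[P]_w (\1_A w)%:E)%E.
Proof. by move=> mA; rewrite integral_indic// setIT. Qed.

Lemma measurable_set_le F G : measurable_fun [set: T] F -> measurable_fun [set: T] G ->
  measurable [set w | F w <= G w].
Proof.
by move=> mF mG; rewrite -[X in measurable X]setTI; exact: measurable_fun_le.
Qed.

Lemma measurable_set_lt F G : measurable_fun [set: T] F -> measurable_fun [set: T] G ->
  measurable [set w | F w < G w].
Proof.
move=> mF mG; rewrite (_ : [set w | _] = ~` [set w | G w <= F w]).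
  by apply: measurableC; exact: measurable_set_le.
by apply/seteqP; split=> w /=; rewrite ltNge => /negP.
Qed.

Lemma markov_ge0 F (a : R) : measurable_fun [set: T] F -> (forall w, 0 <= F w) -> 0 < a ->
  (a%:E * P [set w | (a <= F w)%R] <= \int[P]_w (F w)%:E)%E.
Proof.
move=> mF F0 a0.
have mA : measurable [set w | a <= F w].
  exact: measurable_set_le (measurable_cst a) mF.
rewrite prob_exE// -exZ; [|exact: measurable_indic|by []|exact: ltW].
apply: ex_le => //.
- by apply: measurable_funM => //; exact: measurable_indic.
- by move=> w; rewrite mulr_ge0// ltW.
- move=> w; rewrite indicE; case: (boolP (w \in _)) => [|_]; last by rewrite mulr0.
  by rewrite inE/= mulr1.
Qed.

End nonneg_expectation.

Ltac measf := repeat (first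
  [ assumption
  | match goal with H : forall _ : _, measurable_fun _ _ |- _ => solve [exact: H] end
  | exact: measurable_cst
  | exact: measurable_id
  | exact: measurable_coord
  | exact: measurable_expR
  | apply: measurable_funX
  | apply: measurable_funB
  | apply: measurable_funD
  | apply: measurable_funM
  | apply: measurable_maxr
  | apply: measurable_sum; move=> ?
  | apply: measurable_prod; move=> ? _
  | apply: (measurableT_comp (@measurable_expR _))
  | apply: (measurableT_comp (@normr_measurable _ setT))
  | (apply: (@measurableT_comp _ _ _ _ _ _ _ _ (fun w : seqspace _ => w _)); [by [] | exact: measurable_coord ])
  ]).

(** * Products over independent coordinates and Doob's inequality *)

Section iid_products.
Context {R : realType}.
Local Notation Om := (seqspace R).
Variable nu : probability Om R.
Hypothesis iid : iid_law nu.

Lemma ex_glue n (F G : Om -> R) :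
  measurable_fun [set: Om] F -> measurable_fun [set: Om] G ->
  (forall w, 0 <= F w) -> (forall w, 0 <= G w) -> first_coords n F ->
  (\int[nu]_w (F w * G (shift n w))%:E =
   \int[nu]_w (F w)%:E * \int[nu]_w (G w)%:E)%E.
Proof.
move=> mF mG F0 G0 Fn.
rewrite -(@integral_glue R nu iid n (EFin \o F) (EFin \o G)).
- by [].
- exact/measurable_EFinP.
- exact/measurable_EFinP.
- by move=> w; rewrite lee_fin.
- by move=> w; rewrite lee_fin.
- by move=> u v uv /=; rewrite (Fn u v).
Qed.

Lemma ex_shift n (G : Om -> R) :
  measurable_fun [set: Om] G -> (forall w, 0 <= G w) ->
  (\int[nu]_w (G (shift n w))%:E = \int[nu]_w (G w)%:E)%E.
Proof.
move=> mG G0; apply: (@integral_shift R nu iid n (EFin \o G)).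
  exact/measurable_EFinP.
by move=> w; rewrite lee_fin.
Qed.

Lemma measurable_at (phi : R -> R) i : measurable_fun [set: R] phi ->
  measurable_fun [set: Om] (fun w => phi (w i)).
Proof. by move=> mphi; apply: measurableT_comp => //; exact: measurable_coord. Qed.

Lemma ex_mul_coord n (F : Om -> R) (phi : R -> R) :
  measurable_fun [set: Om] F -> measurable_fun [set: R] phi ->
  (forall w, 0 <= F w) -> (forall u, 0 <= phi u) -> first_coords n F ->
  (\int[nu]_w (F w * phi (w n))%:E =
   \int[nu]_w (F w)%:E * \int[nu]_w (phi (w 0%N))%:E)%E.
Proof.
move=> mF mphi F0 phi0 Fn.
rewrite -(@ex_glue n F (fun w => phi (w 0%N)))//; last exact: measurable_at.
by apply: eq_integral => w _; rewrite /shift addn0.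
Qed.

Definition coord_prod (phi : R -> R) n (w : Om) := \prod_(i < n) phi (w i).

Lemma first_coord_prod phi n : first_coords n (coord_prod phi n).
Proof. by move=> u v uv; apply: eq_bigr => i _; rewrite uv. Qed.

Lemma measurable_coord_prod (phi : R -> R) n : measurable_fun [set: R] phi ->
  measurable_fun [set: Om] (coord_prod phi n).
Proof. by move=> mphi; apply: measurable_prod => i _; exact: measurable_at. Qed.

Lemma coord_prod_ge0 phi n w : (forall u, 0 <= phi u) -> 0 <= coord_prod phi n w.
Proof. by move=> phi0; apply: prodr_ge0. Qed.

Lemma coord_prodS phi n w : coord_prod phi n.+1 w = coord_prod phi n w * phi (w n).
Proof. by rewrite /coord_prod big_ord_recr. Qed.

Lemma ex_coord_prod (phi : R -> R) n (c : R) : measurable_fun [set: R] phi ->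
  (forall u, 0 <= phi u) -> (\int[nu]_w (phi (w 0%N))%:E = c%:E)%E ->
  (\int[nu]_w (coord_prod phi n w)%:E = (c ^+ n)%:E)%E.
Proof.
move=> mphi phi0 hc; elim: n => [|n IHn].
  under eq_integral do rewrite /coord_prod big_ord0.
  by rewrite ex_cst expr0.
under eq_integral do rewrite coord_prodS.
rewrite ex_mul_coord//; last 3 first.
- exact: measurable_coord_prod.
- by move=> w; exact: coord_prod_ge0.
- exact: first_coord_prod.
by rewrite IHn hc -EFinM exprSr.
Qed.

(** Defined by recursion so that the identity M_(n+1) = max(M_n, Z_(n+1)), on which Doob's
    inequality rests, holds by computation. *)
Fixpoint run_max (a : nat -> R) n : R :=
  if n is m.+1 then Num.max (run_max a m) (a m.+1) else a 0%N.

Lemma run_max_ge (a : nat -> R) n i : (i <= n)%N -> a i <= run_max a n.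
Proof.
elim: n => [|n IHn]; first by rewrite leqn0 => /eqP ->.
rewrite leq_eqVlt => /orP[/eqP ->|] /=; rewrite le_max ?lexx ?orbT//.
by rewrite ltnS => /IHn ->.
Qed.

Lemma run_max_le (a : nat -> R) n M : (forall i, (i <= n)%N -> a i <= M) -> run_max a n <= M.
Proof.
elim: n => [|n IHn] h /=; first exact: h.
by rewrite ge_max h// andbT IHn// => i /leqW /h.
Qed.

Lemma run_max_ind (P : R -> Prop) (a : nat -> R) n :
  (forall i, (i <= n)%N -> P (a i)) -> P (run_max a n).
Proof.
elim: n => [|n IHn] h /=; first exact: h.
by rewrite /Num.max; case: ifP => _; [exact: h|apply: IHn => i /leqW /h].
Qed.

Lemma measurable_run_max d (T : measurableType d) (a : nat -> T -> R) n :
  (forall i, measurable_fun [set: T] (a i)) ->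
  measurable_fun [set: T] (fun w => run_max (a ^~ w) n).
Proof. by move=> ma; elim: n => [|n IHn] /=; [exact: ma|exact: measurable_maxr]. Qed.

Lemma eq_run_max (a b : nat -> R) n :
  (forall i, (i <= n)%N -> a i = b i) -> run_max a n = run_max b n.
Proof.
by elim: n => [|n IHn] h /=; rewrite h// IHn// => i /leqW /h.
Qed.

(* Doob's L2 maximal inequality, through the step
   Z* Z - Z*^2 / 2, which is a submartingale when E phi >= 1. *)
Lemma doob_coord_prod (phi : R -> R) n (B c : R) : measurable_fun [set: R] phi ->
  (forall u, 0 <= phi u) -> (forall u, phi u <= B) ->
  (1 <= \int[nu]_w (phi (w 0%N))%:E)%E ->
  (\int[nu]_w (phi (w 0%N) ^+ 2)%:E = c%:E)%E ->
  (\int[nu]_w (run_max (fun j => coord_prod phi j w) n ^+ 2)%:E <= (4 * c ^+ n)%:E)%E.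
Proof.
move=> mphi phi0 phiB phi1 phi2.
pose Z := coord_prod phi; pose M n w := run_max (fun j => Z j w) n.
have mZ i : measurable_fun [set: Om] (Z i) by exact: measurable_coord_prod.
have mM i : measurable_fun [set: Om] (M i).
  exact: (@measurable_run_max _ _ (fun j w => Z j w)).
have Z0 i w : 0 <= Z i w by exact: coord_prod_ge0.
have M0 i w : 0 <= M i w.
  by apply: le_trans (run_max_ge _ (leq0n i)); exact: coord_prod_ge0.
(* A bound at least 1 makes its powers increase, so that one power also dominates all earlier
   products. Boundedness is needed for finite integrals, which can then be subtracted. *)
pose B' := Num.max 1 B.
have B'1 : 1 <= B' by rewrite /B' le_max lexx.
have ZB i w : Z i w <= B' ^+ i.
  rewrite /Z /coord_prod -[X in _ ^+ X]card_ord -prodr_const.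
  apply: ler_prod => j _; rewrite phi0/=; apply: le_trans (phiB _) _.
  by rewrite /B' le_max lexx orbT.
have MB i w : M i w <= B' ^+ i.
  apply: run_max_le => j ji; apply: le_trans (ZB _ _) _.
  by rewrite ler_weXn2l.
have B0 i : 0 <= B' ^+ i by apply: exprn_ge0; exact: le_trans B'1.
have MF i : first_coords i (M i).
  move=> u v uv; apply: eq_run_max => j ji; apply: first_coord_prod => k kj.
  by apply: uv; exact: leq_trans kj ji.
have finMM i : (\int[nu]_w (M i w ^+ 2)%:E)%E \is a fin_num.
  apply: (@ex_fin _ _ _ _ _ ((B' ^+ i) ^+ 2)) => [|w|w]; first by measf.
    exact: exprn_ge0.
  by rewrite lerXn2r// nnegrE.
have finMZ i : (\int[nu]_w (M i w * Z i w)%:E)%E \is a fin_num.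
  apply: (@ex_fin _ _ _ _ _ ((B' ^+ i) ^+ 2)) => [|w|w]; first by measf.
    exact: mulr_ge0.
  by rewrite expr2 ler_pM.
have key i : (\int[nu]_w (M i w ^+ 2)%:E <= 2%:E * \int[nu]_w (M i w * Z i w)%:E)%E.
  elim: i => [|i IHi].
    rewrite -exZ//; first last.
    - by move=> w; exact: mulr_ge0.
    - by measf.
    apply: ex_le => [||w|w]; [by measf|by measf|exact: exprn_ge0|].
    by rewrite /M /= /Z /coord_prod big_ord0; lra.
  have step : (\int[nu]_w (M i.+1 w ^+ 2)%:E + 2%:E * \int[nu]_w (M i w * Z i w)%:E <=
      2%:E * \int[nu]_w (M i.+1 w * Z i.+1 w)%:E + \int[nu]_w (M i w ^+ 2)%:E)%E.
    (* Replacing Z_i by Z_(i+1) next to M_i only increases the mean, since the new factor is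
       independent of the past and has mean at least 1. What remains is pointwise: an equality when
       the maximum does not move, and (Z_(i+1) - M_i)^2 >= 0 when it does. *)
    apply: (@le_trans _ _ (\int[nu]_w (M i.+1 w ^+ 2)%:E +
        2%:E * \int[nu]_w (M i w * Z i.+1 w)%:E)%E).
      rewrite leeD2l// lee_pmul2l//.
      under [leRHS]eq_integral do rewrite /Z coord_prodS mulrA.
      rewrite (@ex_mul_coord i (fun w => M i w * Z i w))//; last 3 first.
      - by measf.
      - by move=> w; exact: mulr_ge0.
      - by move=> u v uv; rewrite (MF i u v)// /Z (@first_coord_prod _ _ u v).
      by rewrite lee_pemulr//; apply: ex_ge0 => w; exact: mulr_ge0.
    rewrite -!exZ//; try (by measf); try (by move=> w; exact: mulr_ge0).
    rewrite -!exD//; try (by measf);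
      try (by move=> w; rewrite ?mulr_ge0// ?exprn_ge0// mulr_ge0).
    apply: ex_le => [||w|w]; [by measf|by measf|by rewrite addr_ge0 ?exprn_ge0 ?mulr_ge0|].
    have -> : M i.+1 w = Num.max (M i w) (Z i.+1 w) by [].
    have [h|h] := leP (M i w) (Z i.+1 w); last lra.
    have : 0 <= (Z i.+1 w - M i w) ^+ 2 by exact: sqr_ge0.
    lra.
  move: step IHi; rewrite -(fineK (finMM i)) -(fineK (finMM i.+1)).
  rewrite -(fineK (finMZ i)) -(fineK (finMZ i.+1)) -!EFinM -!EFinD !lee_fin.
  lra.
have := key n; rewrite -(fineK (finMM n)) -(fineK (finMZ n)) -EFinM !lee_fin => key1.
(* Young's inequality instead of Cauchy-Schwarz: with E M^2 <= 2 E MZ it gives 2 E M^2 <= E M^2 + 4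
   E Z^2. *)
have : (4%:E * \int[nu]_w (M n w * Z n w)%:E <=
    \int[nu]_w (M n w ^+ 2)%:E + 4%:E * \int[nu]_w (Z n w ^+ 2)%:E)%E.
  rewrite -!exZ//; try (by measf); try (by move=> w; rewrite ?exprn_ge0 ?mulr_ge0).
  rewrite -exD//; try (by measf);
    try (by move=> w; rewrite ?mulr_ge0// ?exprn_ge0// mulr_ge0).
  apply: ex_le => [||w|w]; [by measf|by measf|by rewrite !mulr_ge0|].
  have : 0 <= (M n w - 2 * Z n w) ^+ 2 by exact: sqr_ge0.
  lra.
have -> : (\int[nu]_w (Z n w ^+ 2)%:E = (c ^+ n)%:E)%E.
  rewrite -(@ex_coord_prod (fun u => phi u ^+ 2))//; last 2 first.
  - by measf.
  - by move=> u; exact: exprn_ge0.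
  by apply: eq_integral => w _; rewrite /Z /coord_prod prodrXl.
rewrite -(fineK (finMM n)) -(fineK (finMZ n)) -!EFinM -EFinD !lee_fin.
lra.
Qed.

End iid_products.

(** * Maximal ergodic inequality *)

Section maximal_ergodic.
Context {R : realType}.
Local Notation Om := (seqspace R).
Variable nu : probability Om R.
Hypothesis iid : iid_law nu.

Definition erg_sum (f : Om -> R) (a : R) n (w : Om) := \sum_(i < n) (f (shift i w) - a).

Lemma measurable_erg_sum f a n : measurable_fun [set: Om] f ->
  measurable_fun [set: Om] (erg_sum f a n).
Proof.
move=> mf; apply: measurable_sum => i; apply: measurable_funB => //.
by apply: measurableT_comp => //; exact: measurable_shift.
Qed.

(* Garsia's argument: M = max_(n <= N) sum_(i < n) (f o shift^i - a) satisfies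
   a 1_(M > 0) + M <= f + M o shift, and M o shift has the same mean as M. *)
Lemma maximal_ergodic (f : Om -> R) (a C : R) N :
  measurable_fun [set: Om] f -> (forall w, 0 <= f w) -> 0 < a ->
  (\int[nu]_w (f w)%:E <= C%:E)%E ->
  (a%:E * nu [set w | (0 < run_max (fun n => erg_sum f a n w) N)%R] <= C%:E)%E.
Proof.
move=> mf f0 a0 fC.
pose M w := run_max (fun n => erg_sum f a n w) N.
have mM : measurable_fun [set: Om] M.
  by apply: (@measurable_run_max _ _ _ (fun n w => erg_sum f a n w)) => n; exact: measurable_erg_sum.
have M0 w : 0 <= M w.
  by apply: le_trans (run_max_ge _ (leq0n N)); rewrite /erg_sum big_ord0.
have msh n : measurable_fun [set: Om] (f \o shift n).
  by apply: measurableT_comp => //; exact: measurable_shift.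
have finf : (\int[nu]_w (f w)%:E)%E \is a fin_num.
  by rewrite ge0_fin_numE ?ex_ge0//; apply: le_lt_trans fC (ltry _).
have finM : (\int[nu]_w (M w)%:E)%E \is a fin_num.
  rewrite ge0_fin_numE ?ex_ge0//.
  apply: (@le_lt_trans _ _ (\int[nu]_w (\sum_(i < N) f (shift i w))%:E)%E).
    apply: ex_le => //; first by apply: measurable_sum => i; exact: msh.
    move=> w; apply: run_max_le => n nN; rewrite /erg_sum.
    rewrite (big_ord_widen N (fun i => f (shift i w) - a) nN).
    rewrite [leRHS](bigID (fun i : 'I_N => (i < n)%N))/= ler_wpDr ?sumr_ge0//.
    by apply: ler_sum => i _; rewrite lerBlDr lerDl ltW.
  rewrite ex_sum//; last by move=> i; exact: msh.
  by apply: lte_sum_pinfty => i _; rewrite (ex_shift iid)//; apply: le_lt_trans fC (ltry _).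
set A := [set w | _].
have mA : measurable A by exact: (@measurable_set_lt _ Om R (cst 0) M).
have m1A : measurable_fun [set: Om] (\1_A : Om -> R) by exact: measurable_indic.
have key w : a * \1_A w + M w <= f w + M (shift 1 w).
  have hS n : (n <= N)%N -> (0 < n)%N -> erg_sum f a n w <= f w - a + M (shift 1 w).
    case: n => // n nN _; rewrite /erg_sum big_ord_recl/=.
    rewrite (_ : shift 0 w = w) ?lerD2l; last by [].
    apply: le_trans (run_max_ge (fun n => erg_sum f a n (shift 1 w)) (ltnW nN)).
    by rewrite /erg_sum le_eqVlt; apply/orP; left; apply/eqP; apply: eq_bigr.
  (* On [A] the maximum is positive, hence attained at some [n > 0], where one term can be split
     off; outside [A] it is 0. *)
  rewrite indicE; case: (boolP (w \in A)); rewrite ?inE ?notin_setE /A /= => wA.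
    suff : M w <= f w - a + M (shift 1 w) by lra.
    have [n nN Mn] : exists2 n, (n <= N)%N & M w = erg_sum f a n w.
      apply: (@run_max_ind _ (fun x => exists2 n, (n <= N)%N & x = erg_sum f a n w)).
      by move=> i iN; exists i.
    rewrite Mn; apply: hS => //; rewrite lt0n; apply/eqP => n0.
    by move: wA; rewrite -/(M w) Mn n0 /erg_sum big_ord0 ltxx.
  have -> : M w = 0 by apply/le_anti; rewrite M0 andbT leNgt; apply/negP.
  by rewrite mulr0 addr0 addr_ge0.
have mMs : measurable_fun [set: Om] (M \o shift 1).
  by apply: measurableT_comp => //; exact: measurable_shift.
have : (a%:E * \int[nu]_w (\1_A w)%:E + \int[nu]_w (M w)%:E <=
        \int[nu]_w (f w)%:E + \int[nu]_w (M w)%:E)%E.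
  rewrite -[X in (_ <= _ + X)%E](@ex_shift _ _ iid 1)// -exZ//; last exact: ltW.
  rewrite -!exD//.
  - apply: ex_le => //; try (by measf).
      by move=> w; rewrite addr_ge0// mulr_ge0// ltW.
  - by measf.
  - by move=> w; rewrite mulr_ge0// ltW.
rewrite leeD2rE// => h; rewrite prob_exE//; exact: le_trans h fC.
Qed.

Lemma erg_sum_shift f a n w : \sum_(i < n) f (shift i w) = erg_sum f a n w + a * n%:R.
Proof. by rewrite /erg_sum sumrB sumr_const card_ord mulr_natr subrK. Qed.

(** The family increases in [m] with uniformly bounded means. The range [n <= m] avoids the limit
    function, which could be infinite at some points. The exceptional set is contained, for every
    [k], in an event of probability at most [C / k.+1%:R]. *)
Lemma ae_averages_bounded (f : nat -> Om -> R) (C : R) :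
  (forall m, measurable_fun [set: Om] (f m)) -> (forall m w, 0 <= f m w) ->
  (forall m w, f m w <= f m.+1 w) ->
  (forall m, \int[nu]_w (f m w)%:E <= C%:E)%E ->
  {ae nu, forall w, exists a : R, forall m n, (n <= m)%N ->
     \sum_(i < n) f m (shift i w) <= a * n%:R}.
Proof.
move=> mf f0 fS fC.
pose A k m := [set w | 0 < run_max (fun n => erg_sum (f m) k.+1%:R n w) m].
have mA k m : measurable (A k m).
  apply: (@measurable_set_lt _ Om R (cst 0) (fun w => run_max _ m)) => //.
  apply: (@measurable_run_max _ _ _ (fun n w => erg_sum (f m) k.+1%:R n w)) => n.
  exact: measurable_erg_sum.
(* Increasing [m] enlarges both the functions and the range of the maximum, so the bound of the
   maximal inequality passes to the union. *)
have ndA k : nondecreasing_seq (A k).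
  apply/nondecreasing_seqP => m; rewrite subsetEset => w; rewrite /A /= => h.
  apply: lt_le_trans h _; apply: run_max_le => n nm.
  apply: le_trans (run_max_ge (fun n => erg_sum (f m.+1) k.+1%:R n w) (leqW nm)).
  by apply: ler_sum => i _; rewrite lerD2r.
have PA k m : (nu (A k m) <= (C / k.+1%:R)%:E)%E.
  have k0 : 0 < k.+1%:R :> R by rewrite ltr0n.
  have := maximal_ergodic m (mf m) (f0 m) k0 (fC m).
  by rewrite -lee_pdivlMl// mulrC EFinM.
have mUA k : measurable (\bigcup_m A k m) by exact: bigcup_measurable.
have PUA k : (nu (\bigcup_m A k m) <= (C / k.+1%:R)%:E)%E.
  have h := nondecreasing_cvg_mu (mu := nu) (mA k) (mUA k) (ndA k).
  rewrite -(cvg_lim _ h)//; apply: lime_le; first by apply/cvg_ex; eexists; exact: h.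
  by near=> m; exact: PA.
exists (\bigcap_k \bigcup_m A k m); split.
- exact: bigcapT_measurable.
- apply/eqP; rewrite eq_le measure_ge0 andbT.
  have C0 : 0 <= C.
    by rewrite -lee_fin; apply: le_trans (fC 0%N); exact: ex_ge0.
  have fin : nu (\bigcap_k \bigcup_m A k m) \is a fin_num.
    by rewrite fin_num_measure//; exact: bigcapT_measurable.
  have hk k : (nu (\bigcap_k \bigcup_m A k m) <= (C / k.+1%:R)%:E)%E.
    apply: le_trans (PUA k); apply: le_measure; rewrite ?inE//.
      exact: bigcapT_measurable.
    by move=> w; apply.
  rewrite -(fineK fin) lee_fin leNgt; apply/negP => p0.
  have [k hkk] : exists k : nat, C / fine (nu (\bigcap_k \bigcup_m A k m)) < k.+1%:R.
    exists (Num.truncn (C / fine (nu (\bigcap_k \bigcup_m A k m)))).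
    exact: truncnS_gt.
  have := hk k; rewrite -(fineK fin) lee_fin leNgt => /negP; apply.
  by rewrite ltr_pdivrMr ?ltr0n// mulrC -ltr_pdivrMr.
move=> w /= hw k _.
apply: contrapT => hk; apply: hw; exists k.+1%:R => m n nm.
rewrite (erg_sum_shift _ k.+1%:R) gerDr leNgt; apply/negP => h.
apply: hk; exists m => //; rewrite /A/=; apply: lt_le_trans h _.
exact: (run_max_ge (fun n => erg_sum (f m) k.+1%:R n w)).
Unshelve. all: by end_near.
Qed.

End maximal_ergodic.

(** * Truncation *)

Section truncation.
Context d (T : measurableType d) (R : realType) (P : probability T R).
Variables (Y : T -> R) (sigma delta K : R).
Hypothesis mY : measurable_fun [set: T] Y.
Hypothesis delta0 : 0 < delta.
Hypothesis Y1 : (\int[P]_w (Y w)%:E = 0)%E.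
Hypothesis Y2 : (\int[P]_w (Y w ^+ 2)%:E = (sigma ^+ 2)%:E)%E.
Hypothesis Yp : (\int[P]_w (`|Y w| `^ (2 + delta))%:E <= K%:E)%E.

Definition truncate (b u : R) : R := if `|u| <= b then u else 0.

Lemma measurable_truncate b : measurable_fun [set: R] (truncate b).
Proof. by apply: measurable_fun_ifT => //; exact: measurable_fun_ler. Qed.

Lemma bounded_integrable (F : T -> R) (M : R) : measurable_fun [set: T] F ->
  (forall w, `|F w| <= M) -> P.-integrable [set: T] (EFin \o F).
Proof.
move=> mF FM; apply: measurable_bounded_integrable => //.
  by apply: (@le_lt_trans _ _ 1%E); [exact: probability_le1|exact: ltry].
exists M; split; first exact: num_real.
by move=> x Mx w _ /=; apply: le_trans (FM w) (ltW Mx).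
Qed.

Lemma integrable_EFin_le (F G : T -> R) : measurable_fun [set: T] F ->
  measurable_fun [set: T] G ->
  (forall w, `|F w| <= G w) -> (\int[P]_w (G w)%:E < +oo)%E ->
  P.-integrable [set: T] (EFin \o F).
Proof.
move=> mF mG FG Goo; apply/integrableP; split; first exact/measurable_EFinP.
apply: le_lt_trans Goo; apply: (@ex_le _ _ _ _ (fun w => `|F w|) G) => //.
by apply: measurableT_comp.
Qed.

Lemma Rintegral_ge0E (F : T -> R) : P.-integrable [set: T] (EFin \o F) ->
  (\int[P]_w (F w)%:E = (\int[P]_w F w)%:E)%E.
Proof. by move=> iF; rewrite /Rintegral fineK//; exact: (integrable_fin_num measurableT iF). Qed.

Let K0 : 0 <= K.
Proof.
rewrite -lee_fin; apply: le_trans Yp; apply: ex_ge0 => w; exact: powR_ge0.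
Qed.

Variable b : R.
Hypothesis b1 : 1 <= b.
Let b0 : 0 < b. Proof. exact: lt_le_trans b1. Qed.
Let beta := b `^ (- delta).
Let beta0 : 0 <= beta. Proof. exact: powR_ge0. Qed.

Let beta1 : beta <= 1.
Proof. by rewrite -[leRHS](powRr0 b) ler_powR// oppr_le0 ltW. Qed.

Let t w := truncate b (Y w).
Let s w := Y w - t w.
Let m := \int[P]_w t w.

Let mt : measurable_fun [set: T] t.
Proof. by apply: measurableT_comp => //; exact: measurable_truncate. Qed.
Let ms : measurable_fun [set: T] s. Proof. exact: measurable_funB. Qed.
Let tb w : `|t w| <= b.
Proof. by rewrite /t /truncate; case: ifP => // _; rewrite normr0 ltW. Qed.
Let it : P.-integrable [set: T] (EFin \o t).
Proof. exact: bounded_integrable tb. Qed.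

(** The source of every estimate on the discarded part: above the truncation level, [delta] surplus
    powers of [|Y w|] buy the factor [beta]. *)
Let tail w : b < `|Y w| -> `|Y w| ^+ 2 <= `|Y w| `^ (2 + delta) * beta.
Proof.
move=> bY; have Y0 : 0 < `|Y w| by exact: lt_trans bY.
rewrite powRD; last by rewrite (gt_eqF Y0) implybT.
rewrite -powR_mulrn; last exact: ltW.
rewrite -mulrA ler_peMr ?powR_ge0// /beta powRN.
rewrite ler_pdivlMr ?powR_gt0// mul1r ge0_ler_powR ?nnegrE ?(ltW b0) ?(ltW Y0) ?(ltW bY)//.
exact: ltW.
Qed.

Let s2 w : s w ^+ 2 <= beta * `|Y w| `^ (2 + delta).
Proof.
rewrite /s /t /truncate; case: (leP `|Y w| b) => [_|bY].
  by rewrite subrr expr0n/= mulr_ge0// powR_ge0.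
by rewrite subr0 -[Y w ^+ 2]real_normK ?num_real// mulrC tail.
Qed.

Let s1 w : `|s w| <= beta / b * `|Y w| `^ (2 + delta).
Proof.
rewrite /s /t /truncate; case: (leP `|Y w| b) => [_|bY].
  by rewrite subrr normr0 mulr_ge0 ?powR_ge0// divr_ge0// ltW.
rewrite subr0 mulrAC ler_pdivlMr//.
apply: le_trans (_ : `|Y w| ^+ 2 <= _); first by rewrite expr2 ler_wpM2l// ltW.
by rewrite mulrC tail.
Qed.

Let mpow : measurable_fun [set: T] (fun w => `|Y w| `^ (2 + delta)).
Proof.
apply: (measurableT_comp (@measurable_powR R (2 + delta))).
by apply: measurableT_comp.
Qed.

Let Es1 : (\int[P]_w (`|s w|)%:E <= (K * beta / b)%:E)%E.
Proof.
have c0 : 0 <= beta / b by rewrite divr_ge0// ltW.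
apply: (@le_trans _ _ (\int[P]_w (beta / b * `|Y w| `^ (2 + delta))%:E)%E).
  apply: ex_le => //; first exact: measurableT_comp.
  by apply: measurable_funM => //; exact: measurable_cst.
rewrite exZ//.
rewrite (_ : K * beta / b = beta / b * K); last by rewrite -mulrA mulrC.
by rewrite [leRHS]EFinM lee_wpmul2l// lee_fin.
Qed.

Let Es2 : (\int[P]_w (s w ^+ 2)%:E <= (K * beta)%:E)%E.
Proof.
apply: (@le_trans _ _ (\int[P]_w (beta * `|Y w| `^ (2 + delta))%:E)%E).
  apply: ex_le => //; first by measf.
  - by apply: measurable_funM => //; exact: measurable_cst.
  - by move=> w; exact: sqr_ge0.
rewrite exZ//.
by rewrite [K * _]mulrC [leRHS]EFinM lee_wpmul2l// lee_fin.
Qed.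

Let is' : P.-integrable [set: T] (EFin \o s).
Proof. by apply: (integrable_EFin_le ms (measurableT_comp (@normr_measurable R setT) ms)) => //; apply: le_lt_trans Es1 (ltry _). Qed.

(** As [Y] is centred, the mean of its truncation is minus that of the tail, and so it is small. *)
Let mE : m = - \int[P]_w s w.
Proof.
have : \int[P]_w Y w = \int[P]_w t w + \int[P]_w s w.
  rewrite -RintegralD//; apply: eq_Rintegral => w _; rewrite /s; lra.
by rewrite {1}/Rintegral Y1 /= -/m; lra.
Qed.

Let mb : `|m| <= K * beta / b.
Proof.
rewrite mE normrN; apply: le_trans (le_normr_Rintegral _ is') _ => //.
by rewrite -lee_fin -Rintegral_ge0E//; exact: (integrable_abse is').
Qed.

Let mb1 : `|m| <= b.
Proof.
apply: le_trans (le_normr_Rintegral _ it) _ => //.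
rewrite -lee_fin -Rintegral_ge0E; last exact: (integrable_abse it).
rewrite -(ex_cst P b); apply: ex_le => //; exact: measurableT_comp.
Qed.

(* Centering is stated through the nonnegative integrand |c| 2b - c x, because only
   expectations of nonnegative functions are manipulated later on. *)
Lemma truncation : let x u := truncate b u - m in
  [/\ (forall u, `|x u| <= 2 * b),
      (forall c : R, (\int[P]_w (`|c| * (2 * b) - c * x (Y w))%:E = (`|c| * (2 * b))%:E)%E),
      (\int[P]_w (x (Y w) ^+ 2)%:E <= (sigma ^+ 2)%:E)%E,
      ((sigma ^+ 2 - (K + K ^+ 2) * beta)%:E <= \int[P]_w (x (Y w) ^+ 2)%:E)%E
    & (\int[P]_w (`|Y w - x (Y w)|)%:E <= (2 * K * beta / b)%:E)%E /\
            (\int[P]_w ((Y w - x (Y w)) ^+ 2)%:E <= (2 * (K + K ^+ 2) * beta)%:E)%E].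
Proof.
have tb2 w : t w ^+ 2 <= b ^+ 2.
  by rewrite -[t w ^+ 2]real_normK ?num_real// lerXn2r// nnegrE// ltW.
have it2 : P.-integrable [set: T] (EFin \o (fun w => t w ^+ 2)).
  apply: (@bounded_integrable _ (b ^+ 2)); first by measf.
  by move=> w; rewrite ger0_norm ?sqr_ge0.
have ic (c : R) : P.-integrable [set: T] (EFin \o cst c).
  by apply: (@bounded_integrable _ `|c|).
have Ec (c : R) : \int[P]_w c = c by rewrite /Rintegral ex_cst.
have m2 : m ^+ 2 <= K ^+ 2 * beta.
  rewrite -[m ^+ 2]real_normK ?num_real//.
  apply: le_trans (_ : (K * beta / b) ^+ 2 <= _).
    by rewrite lerXn2r// nnegrE ?(le_trans _ mb).
  rewrite !exprMn -mulrA ler_wpM2l ?sqr_ge0// expr2 -mulrA ler_piMr//.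
  rewrite mulr_ile1// ?exprn_ge0 ?invr_ge0 ?(ltW b0)//.
  by rewrite exprn_ile1 ?invr_ge0 ?(ltW b0)// invf_le1.
have x2E : (\int[P]_w ((t w - m) ^+ 2)%:E = (\int[P]_w (t w ^+ 2) - m ^+ 2)%:E)%E.
  rewrite Rintegral_ge0E; last first.
    apply: (@bounded_integrable _ ((2 * b) ^+ 2)); first by measf.
    move=> w; rewrite ger0_norm ?sqr_ge0// -[X in X <= _]real_normK ?num_real//.
    rewrite lerXn2r// ?nnegrE ?mulr_ge0 ?(ltW b0)//.
    by rewrite (le_trans (ler_normB _ _))// mulr2n mulrDl mul1r lerD.
  congr EFin.
  have -> : \int[P]_w (t w - m) ^+ 2 = \int[P]_w (t w ^+ 2 + (- 2 * m) * t w + m ^+ 2).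
    by apply: eq_Rintegral => w _; lra.
  have iTm := integrableZl measurableT (- 2 * m) it.
  rewrite RintegralD//; last 2 first.
  - exact: (integrableD measurableT it2 iTm).
  - exact: (ic (m ^+ 2)).
  rewrite RintegralD//; try exact: iTm.
  by rewrite RintegralZl// Ec -/m; lra.
(* One of the two parts is always 0, so there is no cross term. *)
have Yt w : Y w ^+ 2 = t w ^+ 2 + s w ^+ 2.
  by rewrite /s /t /truncate; case: ifP => _; rewrite ?subrr ?subr0 expr0n/= ?addr0 ?add0r.
have EYt : (sigma ^+ 2)%:E = (\int[P]_w (t w ^+ 2)%:E + \int[P]_w (s w ^+ 2)%:E)%E.
  rewrite -exD//; try (by measf); try (by move=> w; exact: sqr_ge0).
  by rewrite -Y2; apply: eq_integral => w _; rewrite Yt.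
move=> x.
have mx : measurable_fun [set: T] (fun w => x (Y w)).
  by apply: measurable_funB; [exact: mt|exact: measurable_cst].
split.
- move=> u; rewrite /x (le_trans (ler_normB _ _))// mulr2n mulrDl mul1r lerD//.
  by rewrite /truncate; case: ifP => // _; rewrite normr0 ltW.
- move=> c.
  rewrite Rintegral_ge0E; last first.
    apply: (@bounded_integrable _ (`|c| * (2 * b) + `|c| * (2 * b))); first by measf.
    move=> w; rewrite (le_trans (ler_normB _ _))// lerD// normrM ?normr_id.
      by rewrite ler_wpM2l// ger0_norm// mulr_ge0// ltW.
    rewrite ler_wpM2l// /x (le_trans (ler_normB _ _))// mulr2n mulrDl mul1r lerD//.
    exact: tb.
  congr EFin.
  have -> : \int[P]_w (`|c| * (2 * b) - c * x (Y w)) =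
      \int[P]_w ((`|c| * (2 * b) + c * m) + (- c) * t w).
    by apply: eq_Rintegral => w _; rewrite /x -/(t w); lra.
  rewrite RintegralD//; try exact: (integrableZl measurableT (- c) it);
    try exact: (ic (`|c| * (2 * b) + c * m)).
  by rewrite RintegralZl// Ec -/m; lra.
- rewrite x2E EYt Rintegral_ge0E// EFinB.
  apply: (@le_trans _ _ (\int[P]_w (t w ^+ 2))%:E).
    by rewrite -EFinB lee_fin gerBl sqr_ge0.
  by rewrite leeDl// ex_ge0// => w; exact: sqr_ge0.
- rewrite x2E; move: EYt; rewrite Rintegral_ge0E// => EYt.
  have fs : (\int[P]_w (s w ^+ 2)%:E)%E \is a fin_num.
    by rewrite ge0_fin_numE ?ex_ge0//; [apply: le_lt_trans Es2 (ltry _)|move=> w; exact: sqr_ge0].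
  move: EYt Es2; rewrite -(fineK fs) -EFinD !lee_fin => -[->] h.
  rewrite mulrDl; lra.
split.
- have -> : (\int[P]_w `|Y w - x (Y w)|%:E = \int[P]_w (`|s w + m|)%:E)%E.
    by apply: eq_integral => w _; congr (`|_|%:E); rewrite /x /s -/(t w); lra.
  apply: (@le_trans _ _ (\int[P]_w (`|s w| + `|m|)%:E)%E).
    apply: ex_le => //; try by measf.
    by move=> w; exact: ler_normD.
  rewrite exD//; try by measf.
  rewrite ex_cst (_ : 2 * K * beta / b = K * beta / b + K * beta / b); last lra.
  by rewrite [leRHS]EFinD leeD// lee_fin.
- have -> : (\int[P]_w ((Y w - x (Y w)) ^+ 2)%:E = \int[P]_w ((s w + m) ^+ 2)%:E)%E.
    by apply: eq_integral => w _; congr ((_ ^+ 2)%:E); rewrite /x /s -/(t w); lra.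
  apply: (@le_trans _ _ (\int[P]_w (2 * s w ^+ 2 + 2 * m ^+ 2)%:E)%E).
    apply: ex_le => //; try by measf.
      by move=> w; exact: sqr_ge0.
    by move=> w; have := sqr_ge0 (s w - m); lra.
  rewrite exD//; try (by measf); try (by move=> w; rewrite mulr_ge0 ?sqr_ge0).
  rewrite exZ//; try (by measf); try (by move=> w; exact: sqr_ge0).
  rewrite ex_cst (_ : 2 * (K + K ^+ 2) * beta = 2 * (K * beta) + 2 * (K ^+ 2 * beta)); last lra.
  rewrite [leRHS]EFinD leeD//; last by rewrite lee_fin ler_pM2l.
  by rewrite [leRHS]EFinM lee_pmul2l.
Qed.

End truncation.

(** * Moment generating functions of truncated variables *)

Section truncated_sums.
Context {R : realType}.
Local Notation Om := (seqspace R).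
Variable nu : probability Om R.
Hypothesis iid : iid_law nu.
Variables sigma delta K : R.
Hypothesis delta0 : 0 < delta.
Hypothesis X1 : (\int[nu]_w (w 0%N)%:E = 0)%E.
Hypothesis X2 : (\int[nu]_w (w 0%N ^+ 2)%:E = (sigma ^+ 2)%:E)%E.
Hypothesis Xp : (\int[nu]_w (`|w 0%N| `^ (2 + delta))%:E <= K%:E)%E.

Definition cut (b u : R) : R := truncate b u - \int[nu]_w truncate b ((w : Om) 0%N).

Lemma measurable_cut b : measurable_fun [set: R] (cut b).
Proof. by apply: measurable_funB => //; exact: measurable_truncate. Qed.

Let mx b i : measurable_fun [set: Om] (fun w => cut b (w i)).
Proof. exact: measurable_at (measurable_cut b). Qed.

Let trunc b (b1 : 1 <= b) :=
  truncation (measurable_coord 0%N) delta0 X1 X2 Xp b1.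

Section mgf.
Variables (theta b : R).
Hypothesis b1 : 1 <= b.
Let D := `|theta| * (2 * b).
Let x := cut b.
Let mphi : measurable_fun [set: R] (fun u => expR (theta * x u)).
Proof.
apply: measurableT_comp => //; apply: measurable_funM => //; exact: measurable_cut.
Qed.
Let D0 : 0 <= D.
Proof. by rewrite mulr_ge0// mulr_ge0// (le_trans _ b1). Qed.
Let xD u : `|theta * x u| <= D.
Proof. by have [xb _ _ _ _] := trunc b1; rewrite normrM ler_wpM2l//; exact: xb. Qed.
Let xD' u : 0 <= D - theta * x u.
Proof. by rewrite subr_ge0; exact: le_trans (ler_norm _) (xD u). Qed.
Let ED : (\int[nu]_w (D - theta * x (w 0%N))%:E = D%:E)%E.
Proof. by have [_ Ex _ _ _] := trunc b1; exact: (Ex theta). Qed.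

Let finphi : (\int[nu]_w (expR (theta * x (w 0%N)))%:E)%E \is a fin_num.
Proof.
apply: (@ex_fin _ _ _ _ _ (expR D)) => [|w|w]; [exact: measurable_at mphi|exact: expR_ge0|].
by rewrite ler_expR; exact: le_trans (ler_norm _) (xD _).
Qed.

(** The second-order bound is integrated after adding [D - theta * x], which is nonnegative with
    mean [D]; the linear term thus disappears without signed integrals. The two lower bounds below
    proceed alike. *)
Lemma mgf_cut_le : (\int[nu]_w (expR (theta * cut b (w 0%N)))%:E <=
  (expR (theta ^+ 2 * sigma ^+ 2 / 2 * expR D))%:E)%E.
Proof.
have [_ _ Ex2 _ _] := trunc b1.
have : (\int[nu]_w (expR (theta * x (w 0%N)))%:E + \int[nu]_w (D - theta * x (w 0%N))%:E <=
  (1 + D)%:E + (theta ^+ 2 / 2 * expR D)%:E * \int[nu]_w (x (w 0%N) ^+ 2)%:E)%E.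
  have t0 : 0 <= theta ^+ 2 / 2 * expR D by rewrite mulr_ge0 ?expR_ge0// divr_ge0 ?sqr_ge0.
  rewrite -exZ//; try by (have := mx b 0%N; rewrite -/x => ?; measf).
    2: by move=> w; exact: sqr_ge0.
  rewrite -[X in (_ <= X + _)%E](ex_cst nu).
  have ? := mx b 0%N; have ? := measurable_at 0%N mphi.
  rewrite -!exD//; try (by measf).
  all: try by move=> w; rewrite ?expR_ge0 ?addr_ge0// mulr_ge0// sqr_ge0.
  apply: ex_le => //; try (by measf).
    by move=> w; rewrite addr_ge0 ?expR_ge0.
  move=> w; have := expR_le_taylor2 (xD (w 0%N)); rewrite exprMn; lra.
rewrite ED -(fineK finphi) -EFinD => h.
have {}h := le_trans h (leeD2l _ (lee_wpmul2l _ Ex2)).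
have := h; rewrite -EFinM -EFinD !lee_fin => {}h.
have h' : fine (\int[nu]_w (expR (theta * x (w 0%N)))%:E)%E <=
   1 + theta ^+ 2 * sigma ^+ 2 / 2 * expR D.
  have := h _; rewrite mulr_ge0 ?expR_ge0 ?divr_ge0 ?sqr_ge0// => /(_ isT); lra.
by apply: le_trans h' _; exact: expR_ge1Dx.
Qed.

Lemma mgf_cut_ge : ((1 + theta ^+ 2 / 2 * expR (- D) *
    (sigma ^+ 2 - (K + K ^+ 2) * b `^ (- delta)))%:E <=
  \int[nu]_w (expR (theta * cut b (w 0%N)))%:E)%E.
Proof.
have [_ _ _ Ex2 _] := trunc b1.
have t0 : 0 <= theta ^+ 2 / 2 * expR (- D) by rewrite mulr_ge0 ?expR_ge0// divr_ge0 ?sqr_ge0.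
have : ((1 + D)%:E + (theta ^+ 2 / 2 * expR (- D))%:E * \int[nu]_w (x (w 0%N) ^+ 2)%:E <=
  \int[nu]_w (expR (theta * x (w 0%N)))%:E + \int[nu]_w (D - theta * x (w 0%N))%:E)%E.
  rewrite -exZ//; try by (have := mx b 0%N; rewrite -/x => ?; measf).
    2: by move=> w; exact: sqr_ge0.
  rewrite -[X in (X + _ <= _)%E](ex_cst nu).
  have ? := mx b 0%N; have ? := measurable_at 0%N mphi.
  rewrite -!exD//; try (by measf).
  all: try by move=> w; rewrite ?expR_ge0 ?addr_ge0// mulr_ge0// sqr_ge0.
  apply: ex_le => //; try (by measf).
    by move=> w; rewrite !addr_ge0// mulr_ge0// sqr_ge0.
  move=> w; have := taylor2_le_expR (xD (w 0%N)); rewrite exprMn; lra.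
rewrite ED -(fineK finphi) -EFinD => h.
have {}h := le_trans (leeD2l _ (lee_wpmul2l _ Ex2)) h.
have := h; rewrite -EFinM -EFinD !lee_fin; lra.
Qed.

(** Jensen's inequality for a centred variable; it provides the submartingale hypothesis of
    [doob_coord_prod]. *)
Lemma mgf_cut_ge1 : (1 <= \int[nu]_w (expR (theta * cut b (w 0%N)))%:E)%E.
Proof.
have : (\int[nu]_w (1 + D)%:E <=
  \int[nu]_w (expR (theta * x (w 0%N)))%:E + \int[nu]_w (D - theta * x (w 0%N))%:E)%E.
  have ? := mx b 0%N; have ? := measurable_at 0%N mphi.
  rewrite -!exD//; try (by measf).
  all: try by move=> w; rewrite ?expR_ge0.
  apply: ex_le => //; try (by measf).
    by move=> w; rewrite addr_ge0.
  by move=> w; have := expR_ge1Dx (theta * x (w 0%N)); lra.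
rewrite ED -(fineK finphi) -EFinD ex_cst !lee_fin; lra.
Qed.

End mgf.
End truncated_sums.

(** * Maxima of truncated sums and truncation remainders *)

Section excess_estimates.
Context {R : realType}.
Local Notation Om := (seqspace R).
Variable nu : probability Om R.
Hypothesis iid : iid_law nu.
Variables sigma delta K : R.
Hypothesis delta0 : 0 < delta.
Hypothesis X1 : (\int[nu]_w (w 0%N)%:E = 0)%E.
Hypothesis X2 : (\int[nu]_w (w 0%N ^+ 2)%:E = (sigma ^+ 2)%:E)%E.
Hypothesis Xp : (\int[nu]_w (`|w 0%N| `^ (2 + delta))%:E <= K%:E)%E.

Local Notation cut := (cut nu).
Let trunc b (b1 : 1 <= b) :=
  truncation (measurable_coord 0%N) delta0 X1 X2 Xp b1.

Definition cut_sum b n (w : Om) := \sum_(i < n) cut b (w i).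
Definition cut_max b n (w : Om) := run_max (fun j => `|cut_sum b j w|) n.

Lemma measurable_cut_sum b n : measurable_fun [set: Om] (cut_sum b n).
Proof. by apply: measurable_sum => i; exact: measurable_at (measurable_cut nu b). Qed.

Lemma measurable_cut_max b n : measurable_fun [set: Om] (cut_max b n).
Proof.
apply: (@measurable_run_max _ _ _ (fun j w => `|cut_sum b j w|)) => j.
by apply: measurableT_comp => //; exact: measurable_cut_sum.
Qed.

Lemma coord_prod_expR (c b : R) n w :
  coord_prod (fun u => expR (c * cut b u)) n w = expR (c * cut_sum b n w).
Proof. by rewrite /coord_prod -expR_sum -mulr_sumr. Qed.

(** The tilt is halved so that the square in Doob's inequality restores the generating function at
    [theta]. *)
Let doob_expR (theta b : R) n : 1 <= b ->
  (\int[nu]_w (run_max (fun j => coord_prod (fun u => expR (theta / 2 * cut b u)) j w) n ^+ 2)%:E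
   <= (4 * expR (n%:R * (theta ^+ 2 * sigma ^+ 2 / 2 * expR (`|theta| * (2 * b)))))%:E)%E.
Proof.
move=> b1; have [xb _ _ _ _] := trunc b1.
have me (c : R) : measurable_fun [set: R] (fun u => expR (c * cut b u)).
  by apply: measurableT_comp => //; apply: measurable_funM => //; exact: measurable_cut.
have eb (c : R) u : expR (c * cut b u) <= expR (`|c| * (2 * b)).
  rewrite ler_expR; apply: le_trans (ler_norm _) _.
  by rewrite normrM ler_wpM2l//; exact: xb.
pose c := fine (\int[nu]_w (expR (theta * cut b (w 0%N)))%:E)%E.
have cE : (\int[nu]_w (expR (theta * cut b (w 0%N)))%:E = c%:E)%E.
  rewrite fineK//; apply: (@ex_fin _ _ _ _ _ (expR (`|theta| * (2 * b)))) => [|w|w].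
  - exact: measurable_at (me theta).
  - exact: expR_ge0.
  - exact: eb.
have c2 : (\int[nu]_w (expR (theta / 2 * cut b (w 0%N)) ^+ 2)%:E = c%:E)%E.
  by rewrite -cE; apply: eq_integral => w _; rewrite -expRM_natl; congr (expR _)%:E; lra.
have := doob_coord_prod iid n (me (theta / 2)) (fun u => expR_ge0 _) (eb (theta / 2))
  (mgf_cut_ge1 delta0 X1 X2 Xp (theta / 2) b1) c2.
move=> /le_trans; apply; rewrite lee_fin ler_pM2l// expRM_natl lerXn2r ?nnegrE ?expR_ge0//.
  by rewrite -lee_fin -cE ex_ge0// => w; exact: expR_ge0.
by rewrite -lee_fin -cE; exact: (mgf_cut_le delta0 X1 X2 Xp theta b1).
Qed.

(** A positive part satisfies p^2 <= (2 / theta^2) e^(theta p). The absolute value is covered by the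
    tilts [theta] and [- theta], and Doob's inequality costs 4 for each: 2 (4 + 4) = 16. *)
Lemma ex_cut_max_excess (theta tau b : R) n : 0 < theta -> 1 <= b ->
  (\int[nu]_w (Num.max (cut_max b n w - tau) 0 ^+ 2)%:E <=
   (16 / theta ^+ 2 *
     expR (n%:R * (theta ^+ 2 * sigma ^+ 2 / 2 * expR (theta * (2 * b))) - theta * tau))%:E)%E.
Proof.
move=> t0 b1.
pose M (s : R) w := run_max (fun j => coord_prod (fun u => expR (s / 2 * cut b u)) j w) n.
have mM s : measurable_fun [set: Om] (M s).
  apply: (@measurable_run_max _ _ _ (fun j w => coord_prod (fun u => expR (s / 2 * cut b u)) j w)) => j.
  apply: measurable_coord_prod; apply: measurableT_comp => //.
  by apply: measurable_funM => //; exact: measurable_cut.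
have M0 s w : 0 <= M s w.
  apply: le_trans (run_max_ge _ (leq0n n)); apply: coord_prod_ge0 => u; exact: expR_ge0.
pose c := 2 / theta ^+ 2 * expR (- (theta * tau)).
have c0 : 0 <= c by rewrite mulr_ge0 ?expR_ge0// divr_ge0 ?sqr_ge0.
have mc := measurable_cut_max b n.
apply: (@le_trans _ _ (c%:E * (\int[nu]_w (M theta w ^+ 2)%:E +
                                \int[nu]_w (M (- theta) w ^+ 2)%:E))%E).
  rewrite -exD -?exZ; try (by measf); try (by move=> w; rewrite ?addr_ge0 ?sqr_ge0); try by [].
  apply: ex_le; try (by measf); first by move=> w; exact: sqr_ge0.
  move=> w; set p := cut_max b n w - tau.
  have h1 : Num.max p 0 ^+ 2 <= 2 / theta ^+ 2 * expR (theta * p).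
    have [p0|p0] := leP p 0.
      by rewrite expr0n/= mulr_ge0 ?expR_ge0// divr_ge0 ?sqr_ge0.
    have tp : 0 <= theta * p by rewrite mulr_ge0// ltW.
    have : (theta * p) ^+ 2 / 2 <= expR (theta * p).
      have := expR_ge1Dxn 1 tp; rewrite (_ : 2`!%:R = 2 :> R)//; lra.
    move=> h2; rewrite mulrAC ler_pdivlMr ?exprn_gt0//.
    by move: h2; rewrite exprMn; lra.
  apply: le_trans h1 _; rewrite /p mulrBr expRD mulrA mulrAC -/c.
  rewrite ler_wpM2l//.
  have [j jn ->] : exists2 j, (j <= n)%N & cut_max b n w = `|cut_sum b j w|.
    apply: (@run_max_ind _ (fun x => exists2 j, (j <= n)%N & x = `|cut_sum b j w|)).
    by move=> i iN; exists i.
  have hM (s : R) : expR (s * cut_sum b j w) <= M s w ^+ 2.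
    rewrite (_ : s * _ = 2%:R * (s / 2 * cut_sum b j w)); last lra.
    rewrite expRM_natl lerXn2r ?nnegrE ?expR_ge0//.
    rewrite -coord_prod_expR.
    exact: (run_max_ge (fun j => coord_prod (fun u => expR (s / 2 * cut b u)) j w) jn).
  have [s0|s0] := leP 0 (cut_sum b j w).
    rewrite ger0_norm//; apply: le_trans (hM _) _; by rewrite lerDl sqr_ge0.
  rewrite ltr0_norm// mulrN -mulNr; apply: le_trans (hM _) _; by rewrite lerDr sqr_ge0.
have h1 := doob_expR theta n b1; have h2 := doob_expR (- theta) n b1.
rewrite sqrrN normrN gtr0_norm// in h2; rewrite gtr0_norm// in h1.
apply: (@le_trans _ _ (c%:E * (4 * expR (n%:R * (theta ^+ 2 * sigma ^+ 2 / 2 * expR (theta * (2 * b)))) +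
   4 * expR (n%:R * (theta ^+ 2 * sigma ^+ 2 / 2 * expR (theta * (2 * b)))))%:E)%E).
  apply: lee_wpmul2l; first by rewrite lee_fin.
  by rewrite [leRHS]EFinD; exact: leeD h1 h2.
rewrite -EFinM lee_fin /c expRD; lra.
Qed.

Lemma ex_sum_sq (rho : R -> R) (A B : R) n : measurable_fun [set: R] rho ->
  (forall u, 0 <= rho u) ->
  (\int[nu]_w (rho (w 0%N))%:E <= B%:E)%E -> (\int[nu]_w (rho (w 0%N) ^+ 2)%:E <= A%:E)%E ->
  (\int[nu]_w ((\sum_(i < n) rho (w i)) ^+ 2)%:E <= (n%:R * A + n%:R ^+ 2 * B ^+ 2)%:E)%E.
Proof.
move=> mr r0 rB rA.
have mri i : measurable_fun [set: Om] (fun w : Om => rho (w i)) by exact: measurable_at.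
pose S n (w : Om) := \sum_(i < n) rho (w i).
have mS i : measurable_fun [set: Om] (S i) by measf.
have S0 i w : 0 <= S i w by apply: sumr_ge0.
have SF i : first_coords i (S i).
  by move=> u v uv; apply: eq_bigr => j _; rewrite uv.
have ri0 (phi : R -> R) i : measurable_fun [set: R] phi -> (forall u, 0 <= phi u) ->
    (\int[nu]_w (phi ((w : Om) i))%:E = \int[nu]_w (phi ((w : Om) 0%N))%:E)%E.
  move=> mphi phi0; rewrite -(ex_shift iid i (G := fun w : Om => phi (w 0%N)))//; last exact: measurable_at.
  by apply: eq_integral => w _; rewrite /shift addn0.
have B0 : 0 <= B by rewrite -lee_fin; apply: le_trans rB; exact: ex_ge0.
have ES i : (\int[nu]_w (S i w)%:E <= (i%:R * B)%:E)%E.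
  elim: i => [|i IHi].
    by rewrite mul0r; under eq_integral do rewrite /S big_ord0; rewrite ex_cst.
  under eq_integral do rewrite /S big_ord_recr/=.
  rewrite (exD nu (mS i) (mri i))// -natr1 mulrDl mul1r [leRHS]EFinD leeD//.
  by rewrite ri0.
elim: n => [|n IHn].
  under eq_integral do rewrite big_ord0 expr0n/=.
  by rewrite ex_cst lee_fin; lra.
have eS (w : Om) : (\sum_(i < n.+1) rho (w i)) ^+ 2 = (S n w ^+ 2 + 2 * (S n w * rho (w n))) + rho (w n) ^+ 2.
  by rewrite big_ord_recr/= -/(S n w); lra.
under eq_integral do rewrite eS.
rewrite exD; [|by measf|by measf|by move=> w; rewrite addr_ge0 ?sqr_ge0 ?mulr_ge0|by move=> w; exact: sqr_ge0].
rewrite exD; [|by measf|by measf|by move=> w; exact: sqr_ge0|by move=> w; rewrite !mulr_ge0].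
rewrite exZ; [|by measf|by move=> w; rewrite mulr_ge0|by []].
rewrite (ex_mul_coord iid (mS n) mr (S0 n) r0 (SF n)).
have -> : (\int[nu]_w (rho ((w : Om) n) ^+ 2)%:E = \int[nu]_w (rho ((w : Om) 0%N) ^+ 2)%:E)%E.
  by apply: (ri0 (fun u => rho u ^+ 2)) => [|u]; [measf|exact: sqr_ge0].
apply: (@le_trans _ _ ((n%:R * A + n%:R ^+ 2 * B ^+ 2)%:E + 2%:E * ((n%:R * B)%:E * B%:E) + A%:E)%E).
  apply: leeD => //; apply: leeD => //; rewrite lee_pmul2l//.
  by apply: lee_pmul => //; exact: ex_ge0.
rewrite -!EFinM -!EFinD lee_fin -natr1.
have := sqr_ge0 B; lra.
Qed.

Definition cut_rem b n (w : Om) := \sum_(i < n) `|w i - cut b (w i)|.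

Lemma measurable_cut_rem b n : measurable_fun [set: Om] (cut_rem b n).
Proof.
apply: measurable_sum => i; apply: (@measurable_at _ (fun u => `|u - cut b u|)).
by apply: measurableT_comp => //; apply: measurable_funB => //; exact: measurable_cut.
Qed.

(** The solution b of b^(2 + delta) = n. Then b^2 = n^(1 - gam) with gam = delta / (2 + delta), and
    b^(- delta) = n^(- gam). *)
Definition cut_level (n : nat) : R := n%:R `^ (2 + delta)^-1.

Lemma cut_level_ge1 n : (0 < n)%N -> 1 <= cut_level n.
Proof.
move=> n0; have -> : 1 = 1 `^ (2 + delta)^-1 :> R by rewrite powR1.
by rewrite ge0_ler_powR ?nnegrE ?invr_ge0 ?addr_ge0 ?(ltW delta0) ?ler1n.
Qed.

Lemma cut_level_decay n : (0 < n)%N ->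
  cut_level n `^ (- delta) = n%:R `^ (- (delta / (2 + delta))).
Proof. by move=> n0; rewrite /cut_level -powRrM; congr (_ `^ _); lra. Qed.

(** [ex_sum_sq] leaves a term m^2 (2 K beta / b)^2 from the squared mean. Since m <= n = b^2 / beta,
    it is at most 4 K^2 m beta, and 2 (K + K^2) + 4 K^2 is the constant. *)
Lemma ex_cut_rem_sq n m : (0 < n)%N -> (m <= n)%N ->
  (\int[nu]_w (cut_rem (cut_level n) m w ^+ 2)%:E <=
   (m%:R * ((2 * K + 6 * K ^+ 2) * n%:R `^ (- (delta / (2 + delta)))))%:E)%E.
Proof.
move=> n0 mn; have b1 := cut_level_ge1 n0.
have [_ _ _ _ [r1 r2]] := trunc b1.
have mrho : measurable_fun [set: R] (fun u => `|u - cut (cut_level n) u|).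
  by apply: measurableT_comp => //; apply: measurable_funB => //; exact: measurable_cut.
have r2' : (\int[nu]_w (`|w 0%N - cut (cut_level n) (w 0%N)| ^+ 2)%:E <=
    (2 * (K + K ^+ 2) * cut_level n `^ (- delta))%:E)%E.
  by under eq_integral do rewrite real_normK ?num_real//.
have := ex_sum_sq m mrho (fun u => normr_ge0 _) r1 r2'.
move=> /le_trans; apply; rewrite lee_fin -cut_level_decay//.
set b := cut_level n; set beta := b `^ (- delta).
have b0 : 0 < b by exact: lt_le_trans b1.
have nE : n%:R = b ^+ 2 * b `^ delta.
  rewrite -powR_mulrn ?(ltW b0)// -powRD ?(gt_eqF b0) ?implybT//.
  by rewrite /b /cut_level -powRrM mulVf ?powRr1// gt_eqF// addr_gt0.
have bb : b `^ delta * beta = 1.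
  by rewrite /beta powRN divff// gt_eqF// powR_gt0.
have beta0 : 0 <= beta by exact: powR_ge0.
have K0 : 0 <= K by rewrite -lee_fin; apply: le_trans Xp; apply: ex_ge0 => w; exact: powR_ge0.
have h : m%:R ^+ 2 * (2 * K * beta / b) ^+ 2 <= m%:R * (4 * K ^+ 2 * beta).
  rewrite expr2 -mulrA ler_wpM2l//.
  apply: (@le_trans _ _ (n%:R * (2 * K * beta / b) ^+ 2)).
    by rewrite ler_wpM2r ?sqr_ge0// ler_nat.
  rewrite nE le_eqVlt; apply/orP; left; apply/eqP.
  transitivity (4 * K ^+ 2 * beta * (b `^ delta * beta)); last by rewrite bb mulr1.
  by field; rewrite gt_eqF.
by rewrite (_ : m%:R * ((2 * K + 6 * K ^+ 2) * beta) =
  m%:R * (2 * (K + K ^+ 2) * beta) + m%:R * (4 * K ^+ 2 * beta)) ?lerD2l//; lra.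
Qed.

End excess_estimates.

(** * Scale classes and the upper bound *)

Section asymptotics.
Context {R : realType}.

Lemma sq_expRN_small (c eta : R) : 0 < c -> 0 < eta ->
  exists2 k0 : nat, (0 < k0)%N & forall k : nat, (k0 <= k)%N ->
    k%:R ^+ 2 * expR (- (c * k%:R)) <= eta.
Proof.
move=> c0 e0; pose k0 := (Num.truncn (6 / (c ^+ 3 * eta))).+1.
exists k0 => // k kk0.
have k1 : (0 < k)%N by exact: leq_trans kk0.
have kR : 0 < k%:R :> R by rewrite ltr0n.
have h : 6 / (c ^+ 3 * eta) <= k%:R.
  by apply: le_trans (ltW (truncnS_gt _)) _; rewrite ler_nat.
have ck : 0 <= c * k%:R by rewrite mulr_ge0 ?ltW.
have := expR_ge1Dxn 2 ck; rewrite (_ : 3`!%:R = 6 :> R)// => h2.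
rewrite expRN ler_pdivrMr ?expR_gt0//.
apply: le_trans (_ : eta * ((c * k%:R) ^+ 3 / 6) <= _); last first.
  by rewrite ler_pM2l//; lra.
move: h; rewrite ler_pdivrMr ?mulr_gt0 ?exprn_gt0// => h.
rewrite -subr_ge0.
have -> : eta * ((c * k%:R) ^+ 3 / 6) - k%:R ^+ 2 = k%:R ^+ 2 * ((k%:R * (c ^+ 3 * eta) - 6) / 6) by lra.
by rewrite mulr_ge0 ?sqr_ge0// divr_ge0// subr_ge0.
Qed.

(** A discrete integral test: e k^(-(1+e)) <= (k-1)^(-e) - k^(-e) telescopes. With x = k and y = k -
    1 this is (x/y)^e >= 1 + e ln(x/y) together with ln(x/y) >= 1/x. *)
Lemma sum_powR_le (e : R) (K : nat) : 0 < e ->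
  \sum_(2 <= k < K) (k%:R `^ (- (1 + e)) : R) <= e^-1.
Proof.
move=> e0.
suff h n : e * \sum_(2 <= k < n.+2) (k%:R `^ (- (1 + e)) : R) <= 1 - n.+1%:R `^ (- e).
  case: K => [|[|n]]; try by rewrite big_geq// invr_ge0 ltW.
  have := h n; rewrite -ler_pdivlMl// => /le_trans; apply.
  by rewrite ler_piMr ?invr_ge0 ?(ltW e0)// gerBl powR_ge0.
elim: n => [|n IHn].
  by rewrite big_geq// mulr0 powR1 subrr.
rewrite big_nat_recr//= mulrDr.
suff : e * n.+2%:R `^ (- (1 + e)) <= n.+1%:R `^ (- e) - n.+2%:R `^ (- e) by lra.
set x : R := n.+2%:R; set y : R := n.+1%:R.
have x0 : 0 < x by rewrite ltr0n.
have y0 : 0 < y by rewrite ltr0n.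
have xy : x = y + 1 by rewrite /x /y -natr1.
rewrite opprD powRD ?(gt_eqF x0) ?implybT// powR_inv1 ?(ltW x0)//.
rewrite mulrA lerBrDr -[X in _ + X <= _]mul1r -mulrDl.
have -> : y `^ (- e) = (x / y) `^ e * x `^ (- e).
  rewrite powRM ?invr_ge0 ?(ltW x0) ?(ltW y0)// mulrAC -powRD ?(gt_eqF x0) ?implybT// subrr powRr0 mul1r.
  by rewrite -powR_inv1 ?(ltW y0)// -powRrM mulN1r.
rewrite ler_wpM2r ?powR_ge0//.
have xy0 : 0 < x / y by rewrite divr_gt0.
rewrite /powR gt_eqF//.
apply: le_trans (expR_ge1Dx _); rewrite addrC lerD2l ler_pM2l//.
have -> : x / y = (y / x)^-1 by rewrite invf_div.
rewrite lnV ?posrE ?divr_gt0//.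
have -> : y / x = 1 + (- x^-1) by rewrite (_ : y = x - 1) ?mulrBl ?divff ?gt_eqF ?mul1r//; lra.
rewrite lerNr; apply: le_ln1Dx.
by rewrite ltrN2 invf_lt1// /x ltr1n.
Qed.

End asymptotics.

Section classes.
Variable H : nat.
Hypothesis H0 : (0 < H)%N.

(* Lengths of the intervals are split into the classes [len k, len k.+1), whose
   ratio is at most 1 + 1/H. *)
Fixpoint len k : nat := if k is k'.+1 then (len k' + len k' %/ H)%N else H.
Definition mesh k : nat := (len k %/ H)%N.

Lemma lenS k : len k.+1 = (len k + mesh k)%N. Proof. by []. Qed.

Lemma len_ge k : (H <= len k)%N.
Proof. by elim: k => //= k IHk; exact: leq_trans (leq_addr _ _). Qed.

Lemma mesh_gt0 k : (0 < mesh k)%N.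
Proof. by rewrite divn_gt0// len_ge. Qed.

Lemma mesh_le k : (mesh k * H <= len k)%N. Proof. exact: leq_trunc_div. Qed.

Lemma mesh_le_len k : (mesh k <= len k)%N. Proof. exact: leq_div. Qed.

Lemma len_le_mesh k : (len k <= 2 * H * mesh k)%N.
Proof.
have := ltn_ceil (len k) H0; rewrite -/(mesh k) => /ltnW h.
apply: leq_trans h _; rewrite mulSn; have := mesh_gt0 k; nia.
Qed.

Lemma len_gt k : (k < len k)%N.
Proof.
elim: k => [|k IHk]; first by [].
by rewrite lenS -addn1; apply: leq_add => //; exact: mesh_gt0.
Qed.

Lemma len_homo i j : (i <= j)%N -> (len i <= len j)%N.
Proof.
move=> ij; rewrite -(subnKC ij); elim: (j - i)%N => [|n IHn]; first by rewrite addn0.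
by rewrite addnS lenS; apply: leq_trans (leq_addr _ _).
Qed.

Lemma len_class k0 n : (len k0 <= n)%N ->
  exists2 k, (k0 <= k)%N & (len k <= n < len k.+1)%N.
Proof.
move=> k0n.
have ex : exists k, (n < len k)%N by exists n; exact: len_gt.
case: (ex_minnP ex) => -[|k] nk hmin; first by have := len_homo (leq0n k0); lia.
exists k.
  rewrite leqNgt; apply/negP => kk0.
  by have := len_homo kk0; lia.
by rewrite nk andbT leqNgt; apply/negP => /hmin; rewrite ltnn.
Qed.

(** Despite the rounding in [mesh], lengths grow by a factor of at least 1 + 1/(2H). So the class
    index is at most a constant times the logarithm of the length, the constant costing only O(1) in
    the iterated logarithm. *)
Lemma len_exp {R : realType} k :
  expR (ln (1 + (2 * H)%:R^-1) * k%:R) <= (len k)%:R :> R.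
Proof.
have H2 : 0 < (2 * H)%:R :> R by rewrite ltr0n muln_gt0.
have q0 : 0 < 1 + (2 * H)%:R^-1 :> R by rewrite addr_gt0// invr_gt0.
rewrite expRM_natr lnK ?posrE//.
elim: k => [|k IHk].
  by rewrite expr0 ler1n.
rewrite exprSr lenS natrD.
apply: le_trans (_ : (len k)%:R * (1 + (2 * H)%:R^-1) <= _ :> R).
  by rewrite ler_wpM2r// ltW.
rewrite mulrDr mulr1 lerD2l ler_pdivrMr// -natrM ler_nat mulnC.
exact: len_le_mesh.
Qed.

End classes.

(** * Expected excess of one scale class *)

Section class_excess.
Context {R : realType}.
Local Notation Om := (seqspace R).
Variable nu : probability Om R.
Hypothesis iid : iid_law nu.
Variables sigma delta K : R.
Hypothesis sigma0 : 0 < sigma.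
Hypothesis delta0 : 0 < delta.
Hypothesis X1 : (\int[nu]_w (w 0%N)%:E = 0)%E.
Hypothesis X2 : (\int[nu]_w (w 0%N ^+ 2)%:E = (sigma ^+ 2)%:E)%E.
Hypothesis Xp : (\int[nu]_w (`|w 0%N| `^ (2 + delta))%:E <= K%:E)%E.
Variables (H : nat) (eps : R).
Hypothesis H0 : (0 < H)%N.
Hypothesis eps0 : 0 < eps.
Hypothesis eps1 : eps <= 1.

(** Reach from a base point: at most one mesh to the start of the interval, then less than
    [len k + mesh k] to its end. *)
Definition span k : nat := (len H k + 2 * mesh H k)%N.
Definition span_level k : R := cut_level delta (span k).
Definition thr n k : R := (1 + eps) * sigma * Num.sqrt (2 * n%:R * ln k%:R).

(* For an interval [s, t) of class k and a base point j with
   j <= s <= j + mesh k, it dominates the square of the excess of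
   |sum_(s <= i < t) w i| over thr (span k) k + thr (mesh k) k. *)
Definition excess k (w : Om) : R :=
  3 * (Num.max (cut_max nu (span_level k) (span k) w - thr (span k) k) 0 ^+ 2 +
       Num.max (cut_max nu (span_level k) (mesh H k) w - thr (mesh H k) k) 0 ^+ 2 +
       cut_rem nu (span_level k) (span k) w ^+ 2).

Lemma measurable_excess k : measurable_fun [set: Om] (excess k).
Proof.
have ? n := measurable_cut_max nu (span_level k) n.
have ? n := measurable_cut_rem nu (span_level k) n.
rewrite /excess; measf.
Qed.

Lemma excess_ge0 k w : 0 <= excess k w.
Proof. by rewrite /excess mulr_ge0// !addr_ge0 ?sqr_ge0. Qed.

Lemma span_gt0 k : (0 < span k)%N.
Proof. by rewrite /span; have := mesh_gt0 H0 k; lia. Qed.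

Lemma span_le_mesh k : (span k <= (2 * H + 2) * mesh H k)%N.
Proof. by rewrite /span; have := len_le_mesh H0 k; nia. Qed.

(** The optimal tilt has theta^2 = 2 ln k / (sigma^2 n). The quadratic term is then at most (1 +
    eps) ln k and theta times the threshold equals 2 (1 + eps) ln k, which leaves k^(-(1 + eps)).
    The prefactor 16 / theta^2 is at most 8 sigma^2 n because ln k >= 1. *)
Let cut_max_excess n k : (0 < n)%N -> 0 < ln (k%:R : R) -> 1 <= ln (k%:R : R) ->
  expR (Num.sqrt (2 * ln k%:R / (sigma ^+ 2 * n%:R)) * (2 * span_level k)) <= 1 + eps ->
  (\int[nu]_w (Num.max (cut_max nu (span_level k) n w - thr n k) 0 ^+ 2)%:E <=
   (n%:R * (8 * sigma ^+ 2 * k%:R `^ (- (1 + eps))))%:E)%E.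
Proof.
move=> n0 lk0 lk1 small.
have nR : 0 < n%:R :> R by rewrite ltr0n.
have s20 : 0 < sigma ^+ 2 by rewrite exprn_gt0.
set th := Num.sqrt _ in small *.
have q0 : 0 < 2 * ln k%:R / (sigma ^+ 2 * n%:R) by rewrite divr_gt0// mulr_gt0.
have th0 : 0 < th by rewrite sqrtr_gt0.
have th2 : th ^+ 2 = 2 * ln k%:R / (sigma ^+ 2 * n%:R) by rewrite sqr_sqrtr ?ltW.
have tht : th * thr n k = 2 * (1 + eps) * ln k%:R.
  rewrite /thr mulrCA; rewrite [th](_ : _ = Num.sqrt (2 * n%:R * ln k%:R) / (sigma * n%:R)).
    have -> : (1 + eps) * sigma * (Num.sqrt (2 * n%:R * ln k%:R) / (sigma * n%:R) *
       Num.sqrt (2 * n%:R * ln k%:R)) = (1 + eps) / n%:R * Num.sqrt (2 * n%:R * ln k%:R) ^+ 2.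
      by field; rewrite !gt_eqF.
    rewrite sqr_sqrtr; last by rewrite mulr_ge0 ?mulr_ge0// ltW.
    by field; rewrite gt_eqF.
  rewrite /th (_ : 2 * ln k%:R / (sigma ^+ 2 * n%:R) = (2 * n%:R * ln k%:R) * ((sigma * n%:R)^-1) ^+ 2); last first.
    by field; rewrite !gt_eqF.
  have A0 : 0 <= 2 * n%:R * ln k%:R :> R by rewrite mulr_ge0 ?mulr_ge0// ltW.
  have B0 : 0 <= (sigma * n%:R)^-1 by rewrite invr_ge0 mulr_ge0// ltW.
  by rewrite sqrtrM// sqrtr_sqr ger0_norm.
have b1 : 1 <= span_level k by apply: cut_level_ge1 => //; exact: span_gt0.
have := @ex_cut_max_excess R nu iid sigma delta K delta0 X1 X2 Xp th (thr n k) (span_level k) n th0 b1.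
move=> /le_trans; apply; rewrite lee_fin tht th2.
have -> : 16 / (2 * ln k%:R / (sigma ^+ 2 * n%:R)) = 8 * sigma ^+ 2 * n%:R / ln k%:R.
  by field; rewrite !gt_eqF.
have -> : n%:R * (2 * ln k%:R / (sigma ^+ 2 * n%:R) * sigma ^+ 2 / 2 * expR (th * (2 * span_level k)))
   = ln k%:R * expR (th * (2 * span_level k)).
  by field; rewrite !gt_eqF.
rewrite [leRHS](_ : _ = (8 * sigma ^+ 2 * n%:R) * k%:R `^ (- (1 + eps))); last by lra.
apply: ler_pM.
- by rewrite divr_ge0 ?ltW// mulr_gt0// mulr_gt0.
- exact: expR_ge0.
- by rewrite ler_pdivrMr// ler_peMr// ltW// mulr_gt0// mulr_gt0.
have k0 : 0 < k%:R :> R.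
  rewrite ltr0n lt0n; apply: contraTneq lk0 => ->.
  by rewrite ln0// ltxx.
rewrite /powR gt_eqF// ler_expR.
have : ln k%:R * expR (th * (2 * span_level k)) <= ln k%:R * (1 + eps) by rewrite ler_pM2l.
lra.
Qed.

Lemma ex_excess : exists k0 : nat, (2 <= k0)%N /\ (1 <= ln (k0%:R : R)) /\ exists C : R, 0 <= C /\
  forall k, (k0 <= k)%N ->
    (\int[nu]_w ((mesh H k)%:R^-1 * excess k w)%:E <= (C * k%:R `^ (- (1 + eps)))%:E)%E.
Proof.
pose gam := delta / (2 + delta).
have gam0 : 0 < gam by rewrite divr_gt0// addr_gt0.
have HR : 0 < (2 * H)%:R :> R by rewrite ltr0n muln_gt0.
pose kap : R := ln (1 + (2 * H)%:R^-1).
have kap0 : 0 < kap by rewrite ln_gt0// ltrDl invr_gt0.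
have s20 : 0 < sigma ^+ 2 by rewrite exprn_gt0.
have decay k : (span k)%:R `^ (- gam) <= expR (- (gam * kap * k%:R)).
  have -> : expR (- (gam * kap * k%:R)) = expR (kap * k%:R) `^ (- gam).
    by rewrite -expRM; congr expR; lra.
  rewrite !powRN lef_pV2 ?posrE ?powR_gt0 ?expR_gt0 ?ltr0n ?span_gt0//.
  rewrite ge0_ler_powR ?nnegrE ?expR_ge0 ?(ltW gam0)//.
  by apply: le_trans (len_exp H0 k) _; rewrite ler_nat leq_addr.
have l1e : 0 < ln (1 + eps) by rewrite ln_gt0// ltrDl.
have gk0 : 0 < gam * kap by rewrite mulr_gt0.
have [k1 _ hk1] := @sq_expRN_small R (gam * kap) 1 gk0 ltr01.
(* The squared exponent in [small] is at most 8 (2H + 2) / sigma^2 times ln k times span^(- gam),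
   and it must not exceed ln(1 + eps)^2. *)
pose c2 := ln (1 + eps) ^+ 2 * sigma ^+ 2 / (8 * (2 * H + 2)%:R).
have c20 : 0 < c2 by rewrite divr_gt0 ?mulr_gt0 ?exprn_gt0// ltr0n addn2.
have [k2 _ hk2] := @sq_expRN_small R (gam * kap) c2 gk0 c20.
pose k3 := (Num.truncn (expR 1 : R)).+1.
have K0 : 0 <= K by rewrite -lee_fin; apply: le_trans Xp; apply: ex_ge0 => w; exact: powR_ge0.
exists (maxn 2 (maxn k1 (maxn k2 k3))); split; first by rewrite leq_maxl.
have ln1 k : (k3 <= k)%N -> 1 <= ln (k%:R : R).
  move=> kk; rewrite -[leLHS]expRK ler_ln ?posrE ?expR_gt0//.
    by apply: le_trans (ltW (truncnS_gt _)) _; rewrite ler_nat.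
  by rewrite ltr0n; exact: leq_trans kk.
split; first by apply: ln1; rewrite !leq_max leqnn !orbT.
exists (3 * (2 * H + 2)%:R * (16 * sigma ^+ 2 + (2 * K + 6 * K ^+ 2))); split.
  apply: mulr_ge0; first by rewrite mulr_ge0.
  by have := sqr_ge0 K; lra.
move=> k; rewrite !geq_max => /andP[k_2 /andP[k_1 /andP[k_k2 k_3]]].
have lk1 := ln1 k k_3.
have lk0 : 0 < ln (k%:R : R) by exact: lt_le_trans lk1.
have kR : 0 < k%:R :> R by rewrite ltr0n; exact: leq_trans k_2.
have kR1 : 1 <= k%:R :> R by rewrite ler1n; exact: leq_trans k_2.
pose h := mesh H k.
have h0 : (0 < h)%N by exact: mesh_gt0.
have hR : 0 < h%:R :> R by rewrite ltr0n.
pose L := span k.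
have LR : 0 < L%:R :> R by rewrite ltr0n span_gt0.
have hL : (h <= L)%N by rewrite /L /span -/h mul2n -addnn addnA leq_addl.
have Lh : L%:R <= (2 * H + 2)%:R * h%:R :> R by rewrite -natrM ler_nat span_le_mesh.
have bsq : span_level k ^+ 2 = L%:R * L%:R `^ (- gam).
  rewrite /span_level /cut_level -powR_mulrn ?powR_ge0// -powRrM.
  rewrite -{2}[L%:R](powRr1 (ltW LR)) -powRD; last by rewrite (gt_eqF LR) implybT.
  congr (_ `^ _); rewrite /gam; field; rewrite gt_eqF// addr_gt0//.
have b0 : 0 <= span_level k by exact: powR_ge0.
have small n : (h <= n)%N ->
    expR (Num.sqrt (2 * ln k%:R / (sigma ^+ 2 * n%:R)) * (2 * span_level k)) <= 1 + eps.
  move=> hn; have nR : 0 < n%:R :> R by rewrite ltr0n; exact: leq_trans hn.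
  rewrite -[leRHS]lnK ?posrE ?addr_gt0// ler_expR.
  rewrite -(@ler_pXn2r _ 2) ?nnegrE ?mulr_ge0 ?sqrtr_ge0 ?(ltW l1e)//.
  rewrite exprMn sqr_sqrtr; last by rewrite divr_ge0 ?mulr_ge0 ?ltW.
  rewrite exprMn bsq.
  apply: (@le_trans _ _ (2 * ln k%:R / (sigma ^+ 2 * h%:R) * (2 ^+ 2 * (L%:R * L%:R `^ (- gam))))).
    rewrite ler_wpM2r ?mulr_ge0 ?powR_ge0// ler_pM2l ?mulr_gt0// lef_pV2 ?posrE ?mulr_gt0//.
    by rewrite ler_pM2l// ler_nat.
  apply: (@le_trans _ _ (8 * (2 * H + 2)%:R / sigma ^+ 2 * (k%:R ^+ 2 * expR (- (gam * kap * k%:R))))).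
    have -> : 2 * ln k%:R / (sigma ^+ 2 * h%:R) * (2 ^+ 2 * (L%:R * L%:R `^ (- gam))) =
       8 * (L%:R / h%:R) / sigma ^+ 2 * (ln k%:R * L%:R `^ (- gam)).
      by field; rewrite !gt_eqF.
    apply: ler_pM.
    - by rewrite divr_ge0 ?(ltW s20)// mulr_ge0.
    - by rewrite mulr_ge0 ?powR_ge0// ltW.
    - by rewrite ler_pM2r ?invr_gt0// ler_pM2l// ler_pdivrMr.
    - apply: ler_pM; rewrite ?powR_ge0 ?(ltW lk0) ?decay//.
      by apply: le_trans (ltW (ln_sublinear kR)) _; rewrite expr2 ler_peMr// ltW.
  have := hk2 k k_k2; rewrite /c2 => hh.
  rewrite mulrC -ler_pdivlMr ?divr_gt0 ?mulr_gt0 ?ltr0n ?addn2//.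
  apply: le_trans hh _; rewrite le_eqVlt; apply/orP; left; apply/eqP; field.
  by rewrite (gt_eqF sigma0) gt_eqF// ltr_pwDl.
have p1 := cut_max_excess (span_gt0 k) lk0 lk1 (small _ hL).
have p2 := cut_max_excess h0 lk0 lk1 (small _ (leqnn h)).
have p3 := @ex_cut_rem_sq R nu iid sigma delta K delta0 X1 X2 Xp L L (span_gt0 k) (leqnn _).
have ? n := measurable_cut_max nu (span_level k) n.
have ? n := measurable_cut_rem nu (span_level k) n.
have ? := measurable_excess k.
rewrite exZ ?invr_ge0//; try exact: excess_ge0.
rewrite lee_pdivrMl//.
rewrite /excess exZ//; try (by measf); try (by move=> w; rewrite !addr_ge0 ?sqr_ge0).
rewrite exD; [|by measf|by measf|by move=> w; rewrite addr_ge0 ?sqr_ge0|by move=> w; exact: sqr_ge0].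
rewrite exD; [|by measf|by measf|by move=> w; exact: sqr_ge0|by move=> w; exact: sqr_ge0].
have h3 : (0 <= 3%:E :> \bar R)%E by rewrite lee_fin.
apply: le_trans (lee_wpmul2l h3 (leeD (leeD p1 p2) p3)) _.
rewrite -!EFinD -!EFinM lee_fin -/h -/L.
set kap' := k%:R `^ (- (1 + eps)).
have kp0 : 0 <= kap' by exact: powR_ge0.
(* The truncation error is exponentially small in [k], hence below k^(-2), and [eps <= 1] makes that
   at most k^(-(1 + eps)). *)
have hg : L%:R `^ (- gam) <= kap'.
  apply: le_trans (decay k) _.
  apply: (@le_trans _ _ (k%:R `^ (- 2%:R))).
    rewrite powRN powR_mulrn ?(ltW kR)// -[leRHS]mul1r ler_pdivlMr ?exprn_gt0// mulrC.
    exact: hk1.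
  by rewrite ler_powR// lerN2 mulr2n lerD2l.
set A := 8 * sigma ^+ 2 * kap'.
have A0 : 0 <= A by rewrite !mulr_ge0// ltW.
set C2 := 2 * K + 6 * K ^+ 2.
have C20 : 0 <= C2 by rewrite /C2; have := sqr_ge0 K; lra.
have hh : h%:R <= (2 * H + 2)%:R * h%:R :> R by rewrite ler_peMl// ler1n addn2.
set M := (2 * H + 2)%:R * h%:R in Lh hh.
have e1 : L%:R * A <= M * A by rewrite ler_wpM2r.
have e2 : h%:R * A <= M * A by rewrite ler_wpM2r.
have e3 : L%:R * (C2 * L%:R `^ (- gam)) <= M * (C2 * kap').
  by apply: ler_pM => //; rewrite ?mulr_ge0 ?powR_ge0// ler_wpM2l.
have -> : h%:R * (3 * (2 * H + 2)%:R * (16 * sigma ^+ 2 + C2) * kap') =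
   3 * (M * A + M * A + M * (C2 * kap')) by rewrite /M /A; lra.
rewrite ler_pM2l// lerD// lerD//.
Qed.

End class_excess.

(** * From class excesses to a dominating density *)

Section upper_bound.
Context {R : realType}.
Local Notation Om := (seqspace R).

Lemma sum_shift_interval (F : R -> R) (w : Om) j s t : (j <= s)%N -> (s <= t)%N ->
  \sum_(s <= i < t) F (w i) =
  \sum_(i < t - j) F (shift j w i) - \sum_(i < s - j) F (shift j w i).
Proof.
move=> js st.
have -> : \sum_(s <= i < t) F (w i) = \sum_(s - j <= i < t - j) F (shift j w i).
  rewrite -{1}(subnK js) big_addn; apply: eq_bigr => i _.
  by rewrite /shift addnC.
rewrite -!(big_mkord xpredT (fun i => F (shift j w i))).
rewrite (@big_cat_nat _ _ _ (s - j) 0 (t - j))//=; last exact: leq_sub2r.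
by rewrite addrAC subrr add0r.
Qed.

(** Subtraction on [nat] sends the first [h] indices to 0, whence the additional multiple of
    [F 0]. *)
Lemma sum_subn_le (F : nat -> R) h N : (forall i, 0 <= F i) ->
  \sum_(0 <= i < N) F (i - h)%N <= h%:R * F 0%N + \sum_(0 <= i < N) F i.
Proof.
move=> F0.
suff : \sum_(0 <= i < N) F (i - h)%N <= (minn N h)%:R * F 0%N + \sum_(0 <= i < N - h) F i.
  move=> /le_trans; apply; apply: lerD.
    by rewrite ler_wpM2r// ler_nat geq_minr.
  rewrite [leRHS](@big_cat_nat _ _ _ (N - h))//= ?leq_subr// lerDl.
  by apply: sumr_ge0.
elim: N => [|N IHN]; first by rewrite !big_geq// min0n mul0r addr0.
rewrite big_nat_recr//=; have [Nh|hN] := ltnP N h.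
  rewrite (eqP (ltnW Nh)) (minn_idPl Nh) (_ : (N.+1 - h)%N = 0%N); last exact/eqP.
  move: IHN; rewrite (minn_idPl (ltnW Nh)) (eqP (ltnW Nh)) -natr1 mulrDl mul1r; lra.
rewrite subSn// big_nat_recr//= (minn_idPr (leqW hN)).
by move: IHN; rewrite (minn_idPr hN); lra.
Qed.

Variable nu : probability Om R.
Variables sigma delta : R.

Variables (H : nat) (eps : R).
Hypothesis H0 : (0 < H)%N.
Local Notation excess := (excess nu sigma delta H eps).
Local Notation span := (span H).
Local Notation mesh := (mesh H).
Local Notation len := (len H).
Local Notation thr := (thr sigma eps).

(** Both ends are measured from the base point [j]: the sum is a partial sum of length at most
    [span k] minus one of length at most [mesh k], plus the truncation remainder. Hence the two
    thresholds add, and the three excesses are squared together at the cost of the factor 3 in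
    [excess]. *)
Lemma interval_sum_le (w : Om) s t k j : (s < t)%N ->
  (len k <= t - s < len k.+1)%N -> (j <= s <= j + mesh k)%N ->
  exists2 x, 0 <= x /\ x ^+ 2 <= excess k (shift j w) &
    `|\sum_(s <= i < t) w i| <= thr (span k) k + thr (mesh k) k + x.
Proof.
move=> st /andP[nl nu'] /andP[js sj].
pose v := shift j w; pose b := span_level delta H k.
pose cs n := cut_sum nu b n v.
have tjs : (t - j <= span k)%N by rewrite /span; rewrite lenS in nu'; lia.
have sjm : (s - j <= mesh k)%N by lia.
pose x1 := Num.max (cut_max nu b (span k) v - thr (span k) k) 0.
pose x2 := Num.max (cut_max nu b (mesh k) v - thr (mesh k) k) 0.
pose x3 := cut_rem nu b (span k) v.
have x1_0 : 0 <= x1 by rewrite le_max lexx orbT.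
have x2_0 : 0 <= x2 by rewrite le_max lexx orbT.
have x3_0 : 0 <= x3 by apply: sumr_ge0.
exists (x1 + x2 + x3).
  split; first by rewrite !addr_ge0.
  rewrite /excess -/v -/b -/x1 -/x2 -/x3.
  have := sqr_ge0 (x1 - x2); have := sqr_ge0 (x1 - x3); have := sqr_ge0 (x2 - x3); nra.
have eS : \sum_(s <= i < t) w i = cs (t - j)%N - cs (s - j)%N + \sum_(s <= i < t) (w i - cut nu b (w i)).
  rewrite /cs /cut_sum -(sum_shift_interval (cut nu b) w js (ltnW st)) -big_split/=.
  by apply: eq_bigr => i _; lra.
rewrite eS.
have h1 : `|cs (t - j)%N| <= thr (span k) k + x1.
  apply: le_trans (run_max_ge (fun j => `|cut_sum nu b j v|) tjs) _.
  by rewrite -lerBlDl /x1 le_max lexx.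
have h2 : `|cs (s - j)%N| <= thr (mesh k) k + x2.
  apply: le_trans (run_max_ge (fun j => `|cut_sum nu b j v|) sjm) _.
  by rewrite -lerBlDl /x2 le_max lexx.
have h3 : `|\sum_(s <= i < t) (w i - cut nu b (w i))| <= x3.
  apply: le_trans (ler_norm_sum _ _ _) _.
  rewrite (sum_shift_interval (fun u => `|u - cut nu b u|) w js (ltnW st)).
  apply: (@le_trans _ _ (\sum_(i < t - j) `|v i - cut nu b (v i)|)).
    by rewrite gerBl; apply: sumr_ge0.
  rewrite /x3 /cut_rem (big_ord_widen (span k) (fun i => `|v i - cut nu b (v i)|) tjs).
  by rewrite [leRHS](bigID (fun i : 'I_(span k) => (i < t - j)%N))/= lerDl sumr_ge0.
apply: le_trans (ler_normD _ _) _.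
apply: (@le_trans _ _ (`|cs (t - j)%N| + `|cs (s - j)%N| + x3)); last lra.
by apply: lerD => //; exact: ler_normB.
Qed.

(* The energy of an interval of class k is spread over its about [mesh k] grid points,
   hence the weights; intervals shorter than [len k0] are paid for by the squares. *)
Definition charge k0 m (w : Om) : R :=
  (len k0)%:R * w 0%N ^+ 2 + \sum_(k0 <= k < m) (mesh k)%:R^-1 * excess k w.

Lemma charge_ge0 k0 m w : 0 <= charge k0 m w.
Proof.
apply: addr_ge0; first by rewrite mulr_ge0 ?sqr_ge0.
by apply: sumr_ge0 => k _; rewrite mulr_ge0 ?invr_ge0// excess_ge0.
Qed.

(** The base point is taken at [i - mesh k]: each of the first [mesh k] points [i] of an interval
    then has its base at most one mesh before the left end. The restriction [len k <= N] keeps the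
    boundary terms at 0 below N times a charge. *)
Let energy_density k0 N (c eta : R) (w : Om) i : R :=
  (1 + eta) * c + (1 + eta^-1) * ((len k0)%:R * w i ^+ 2 +
    \sum_(k0 <= k < N | (len k <= N)%N) (mesh k)%:R^-1 * excess k (shift (i - mesh k) w)).

(** For a long interval the bound of [interval_sum_le] is averaged over its first [mesh k] points,
    each contributing weight 1 / mesh k. A short one is handled by Cauchy-Schwarz, its length being
    less than [len k0]. *)
Let interval_density k0 N (c eta : R) (w : Om) s t : 0 < eta -> 0 <= c ->
  (forall k, (k0 <= k)%N -> (len k <= N)%N ->
    (thr (span k) k + thr (mesh k) k) ^+ 2 <= c * (len k)%:R) ->
  (forall k, 0 <= thr (span k) k + thr (mesh k) k) ->
  (s < t <= N)%N ->
  `|\sum_(s <= i < t) w i| ^+ 2 <= \sum_(s <= i < t) energy_density k0 N c eta w i.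
Proof.
move=> eta0 c0 hc thr0 /andP[st tN].
have e1 : 1 <= 1 + eta^-1 by rewrite lerDl invr_ge0 ltW.
have ex0 k v : 0 <= (mesh k)%:R^-1 * excess k v by rewrite mulr_ge0 ?invr_ge0// excess_ge0.
have sex0 i : 0 <= \sum_(k0 <= k < N | (len k <= N)%N) (mesh k)%:R^-1 * excess k (shift (i - mesh k) w).
  by apply: sumr_ge0.
have [k0n|nk0] := leqP (len k0) (t - s).
  have [k kk0 /andP[kn nk]] := len_class H0 k0n.
  have lN : (len k <= N)%N by lia.
  have kN : (k < N)%N by exact: leq_trans (len_gt H0 k) lN.
  pose thk := thr (span k) k + thr (mesh k) k.
  have m0 := mesh_gt0 H0 k; have mlen := mesh_le_len H k.
  have mR : 0 < (mesh k)%:R :> R by rewrite ltr0n.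
  have hi i : (s <= i < s + mesh k)%N ->
      `|\sum_(s <= q < t) w q| ^+ 2 <=
      (1 + eta) * thk ^+ 2 + (1 + eta^-1) * excess k (shift (i - mesh k) w).
    move=> /andP[si im].
    have [||x [x0 x2] hx] := @interval_sum_le w s t k (i - mesh k)%N st; [by rewrite kn|lia|].
    apply: (@le_trans _ _ ((thk + x) ^+ 2)).
      by rewrite lerXn2r// nnegrE ?normr_ge0// (addr_ge0 (thr0 k) x0).
    apply: (@le_trans _ _ ((1 + eta) * thk ^+ 2 + (1 + eta^-1) * x ^+ 2)).
      have : 0 <= eta^-1 * (eta * thk - x) ^+ 2 by rewrite mulr_ge0 ?sqr_ge0// invr_ge0 ltW.
      have -> : eta^-1 * (eta * thk - x) ^+ 2 = eta * thk ^+ 2 - 2 * thk * x + eta^-1 * x ^+ 2.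
        by field; rewrite gt_eqF.
      lra.
    by rewrite lerD2l ler_wpM2l// (le_trans _ e1).
  set S2 := `|_| ^+ 2 in hi *.
  have sms : (s + mesh k <= t)%N by lia.
  have : \sum_(s <= i < s + mesh k) (mesh k)%:R^-1 * S2 <=
     \sum_(s <= i < s + mesh k) (mesh k)%:R^-1 * ((1 + eta) * thk ^+ 2 + (1 + eta^-1) * excess k (shift (i - mesh k) w)).
    by apply: ler_sum_nat => i /hi hh; rewrite ler_wpM2l ?invr_ge0.
  rewrite sumr_const_nat addKn -[(_ * S2) *+ _]mulr_natl mulrA divff ?gt_eqF// mul1r.
  move=> /le_trans; apply.
  under eq_bigr do rewrite mulrDr.
  rewrite big_split/= sumr_const_nat addKn -[(_ * (_ * thk ^+ 2)) *+ _]mulr_natl mulrA divff ?gt_eqF// mul1r.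
  rewrite /energy_density big_split/= sumr_const_nat.
  apply: lerD.
    rewrite -[((1 + eta) * c) *+ _]mulr_natr -mulrA ler_wpM2l ?addr_ge0// ?(ltW eta0)//.
    apply: le_trans (hc k kk0 lN) _.
    by rewrite ler_wpM2l// ler_nat.
  rewrite [leRHS](@big_cat_nat _ _ _ (s + mesh k))//= ?leq_addr//.
  rewrite -[leLHS]addr0 lerD//; last first.
    apply: sumr_ge0 => i _; rewrite mulr_ge0 ?(le_trans _ e1)//.
    by apply: addr_ge0; [rewrite mulr_ge0 ?sqr_ge0|exact: sex0].
  apply: ler_sum => i _; rewrite mulrCA ler_wpM2l ?(le_trans _ e1)//.
  apply: ler_wpDl; first by rewrite mulr_ge0 ?sqr_ge0.
  rewrite (@big_cat_nat _ _ _ k)//=; last exact: ltnW.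
  apply: ler_wpDl; first by apply: sumr_ge0.
  rewrite big_ltn_cond// lN lerDl; exact: sumr_ge0.
apply: (@le_trans _ _ (\sum_(s <= i < t) (len k0)%:R * w i ^+ 2)); last first.
  apply: ler_sum => i _; rewrite /energy_density.
  apply: ler_wpDl; first by rewrite mulr_ge0// addr_ge0// ltW.
  apply: (@le_trans _ _ ((len k0)%:R * w i ^+ 2 + \sum_(k0 <= k < N | (len k <= N)%N) (mesh k)%:R^-1 * excess k (shift (i - mesh k) w))).
    by rewrite lerDl.
  by rewrite ler_peMl// addr_ge0// mulr_ge0// sqr_ge0.
rewrite -mulr_sumr.
apply: (@le_trans _ _ ((t - s)%:R * \sum_(s <= i < t) w i ^+ 2)); last first.
  by rewrite ler_wpM2r ?ler_nat ?(ltnW nk0)// sumr_ge0// => i _; exact: sqr_ge0.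
(* Cauchy-Schwarz by induction on the length; the cross term 2 A y is absorbed through (A - n y)^2
   >= 0. *)
rewrite real_normK ?num_real// -(subnKC (ltnW st)) addKn; elim: (t - s)%N => [|n IHn].
  by rewrite addn0 !big_geq// expr0n mul0r.
rewrite addnS !big_nat_recr ?leq_addr//=.
set A := \sum_(_ <= _ < _) w _ in IHn *; set B := \sum_(_ <= _ < _) w _ ^+ 2 in IHn *.
set y := w _.
have n0 : 0 <= n%:R :> R by [].
have h : 2 * A * y <= B + n%:R * y ^+ 2.
  case: (posnP n) => [n0'|n0'].
    have A0 : A = 0 by rewrite /A n0' addn0 big_geq.
    by rewrite A0 mulr0 mul0r n0' mul0r addr0; apply: sumr_ge0 => i _; exact: sqr_ge0.
  have nR : 0 < n%:R :> R by rewrite ltr0n.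
  have h1 : A ^+ 2 / n%:R <= B by rewrite ler_pdivrMr// mulrC.
  have : 0 <= n%:R^-1 * (A - n%:R * y) ^+ 2 by rewrite mulr_ge0 ?sqr_ge0// invr_ge0.
  have -> : n%:R^-1 * (A - n%:R * y) ^+ 2 = A ^+ 2 / n%:R - 2 * A * y + n%:R * y ^+ 2.
    by field; rewrite gt_eqF.
  lra.
rewrite -natr1; lra.
Qed.

Lemma energy_le_charge k0 N (c eta a : R) (w : Om) : 0 < eta -> 0 <= c -> (0 < N)%N ->
  (forall k, (k0 <= k)%N -> (len k <= N)%N ->
    (thr (span k) k + thr (mesh k) k) ^+ 2 <= c * (len k)%:R) ->
  (forall k, 0 <= thr (span k) k + thr (mesh k) k) ->
  (forall n, (n <= N)%N -> \sum_(i < n) charge k0 N (shift i w) <= a * n%:R) ->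
  max_interval_energy w N <= N%:R * ((1 + eta) * c + (1 + eta^-1) * (2 * a)).
Proof.
move=> eta0 c0 N0 hc thr0 ha.
have e1 : 1 <= 1 + eta^-1 by rewrite lerDl invr_ge0 ltW.
have ex0 k v : 0 <= (mesh k)%:R^-1 * excess k v by rewrite mulr_ge0 ?invr_ge0// excess_ge0.
apply: le_trans (@max_interval_energy_le _ w (energy_density k0 N c eta w) N _ _) _.
- move=> i; apply: addr_ge0; first by rewrite mulr_ge0 ?addr_ge0 ?(ltW eta0).
  apply: mulr_ge0; first exact: le_trans e1.
  by apply: addr_ge0; [rewrite mulr_ge0 ?sqr_ge0|exact: sumr_ge0].
- move=> s t stN; exact: interval_density.
rewrite /energy_density big_split/= sumr_const card_ord mulrDr -[((1 + eta) * c) *+ _]mulr_natl lerD2l.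
rewrite -mulr_sumr mulrCA ler_wpM2l ?(le_trans _ e1)//.
rewrite big_split/= exchange_big/=.
(* The average over a single point bounds the charge at the origin. It pays for the base points cut
   off at 0, which is why [a] appears twice in the conclusion. *)
have h1 : charge k0 N w <= a.
  by have := ha 1%N N0; rewrite big_ord_recl big_ord0 addr0 mulr1; apply: le_trans; rewrite lexx.
have h2 := ha N (leqnn N).
apply: (@le_trans _ _ (N%:R * charge k0 N w + \sum_(i < N) charge k0 N (shift i w))); last first.
  by have := ler_wpM2l (ler0n R N) h1; lra.
rewrite [X in _ <= _ + X](_ : _ = \sum_(i < N) (len k0)%:R * w i ^+ 2 +
    \sum_(k0 <= k < N) \sum_(i < N) (mesh k)%:R^-1 * excess k (shift i w)); last first.
  rewrite exchange_big/= -big_split/=; apply: eq_bigr => i _.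
  by rewrite /charge /shift addn0.
rewrite addrCA lerD2l.
apply: (@le_trans _ _ (\sum_(k0 <= k < N | (len k <= N)%N)
   (N%:R * ((mesh k)%:R^-1 * excess k w) + \sum_(i < N) (mesh k)%:R^-1 * excess k (shift i w)))).
  apply: ler_sum => k lN.
  rewrite -[leLHS](big_mkord xpredT (fun i => (mesh k)%:R^-1 * excess k (shift (i - mesh k) w))).
  apply: le_trans (sum_subn_le (mesh k) N (F := fun i => (mesh k)%:R^-1 * excess k (shift i w)) _) _ => //.
  rewrite big_mkord lerD2r (_ : shift 0 w = w)//.
  by rewrite ler_wpM2r// ler_nat; apply: leq_trans lN; exact: mesh_le_len.
rewrite big_split/= lerD//.
  rewrite -mulr_sumr ler_wpM2l// /charge.
  apply: ler_wpDl; first by rewrite mulr_ge0 ?sqr_ge0.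
  rewrite [leRHS](bigID (fun k => (len k <= N)%N))/= lerDl; exact: sumr_ge0.
rewrite [leRHS](bigID (fun k => (len k <= N)%N))/= lerDl.
by apply: sumr_ge0 => k _; apply: sumr_ge0.
Qed.

End upper_bound.

Section ae_upper.
Context {R : realType}.
Local Notation Om := (seqspace R).
Variable nu : probability Om R.
Hypothesis iid : iid_law nu.
Variables sigma delta K : R.
Hypothesis sigma0 : 0 < sigma.
Hypothesis delta0 : 0 < delta.
Hypothesis X1 : (\int[nu]_w (w 0%N)%:E = 0)%E.
Hypothesis X2 : (\int[nu]_w (w 0%N ^+ 2)%:E = (sigma ^+ 2)%:E)%E.
Hypothesis Xp : (\int[nu]_w (`|w 0%N| `^ (2 + delta))%:E <= K%:E)%E.

(** Two factors 1 + 1/p come from squaring the threshold, the third from Young's inequality with eta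
    = 1/p, and the last square from [thr_sum_sq_le]. *)
Definition upper_factor (p : nat) : R := (1 + p%:R^-1) ^+ 3 * (1 + 2 / p%:R) ^+ 2.

(** With [p ^ 2] as mesh ratio, sqrt(mesh / len) <= 1/p and sqrt(span / len) <= 1 + 1/p, so the
    thresholds add up to the factor 1 + 2/p. *)
Lemma thr_sum_sq_le (p k : nat) (eps : R) : (0 < p)%N -> 0 < eps -> 1 <= ln (k%:R : R) ->
  (thr sigma eps (span (p ^ 2) k) k + thr sigma eps (mesh (p ^ 2) k) k) ^+ 2 <=
  2 * sigma ^+ 2 * (1 + eps) ^+ 2 * (1 + 2 / p%:R) ^+ 2 * ln k%:R * (len (p ^ 2) k)%:R.
Proof.
set H := (p ^ 2)%N; move=> p0 e0 lk1; have H0 : (0 < H)%N by rewrite expn_gt0 p0.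
have pR : 0 < p%:R :> R by rewrite ltr0n.
have lk0 : 0 < ln (k%:R : R) by exact: lt_le_trans lk1.
have mlen : (mesh H k)%:R * p%:R ^+ 2 <= (len H k)%:R :> R.
  by rewrite -natrX -natrM ler_nat; exact: mesh_le.
set l : R := (len H k)%:R in mlen *; set m : R := (mesh H k)%:R in mlen *.
have m0 : 0 <= m by rewrite /m.
have l0 : 0 <= l by rewrite /l.
have sp : (span H k)%:R = l + 2 * m :> R by rewrite /span natrD natrM.
have ml : m <= l / p%:R ^+ 2 by rewrite ler_pdivlMr ?exprn_gt0.
pose q := Num.sqrt (2 * l * ln k%:R).
have q0 : 0 <= q by exact: sqrtr_ge0.
have q2 : q ^+ 2 = 2 * l * ln k%:R by rewrite sqr_sqrtr// mulr_ge0 ?mulr_ge0// ltW.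
have hs (n : nat) (c : R) : 0 <= c -> n%:R <= c ^+ 2 * l -> Num.sqrt (2 * n%:R * ln k%:R) <= c * q.
  move=> c0 nc; rewrite -(@ler_pXn2r _ 2) ?nnegrE ?sqrtr_ge0 ?mulr_ge0//.
  rewrite sqr_sqrtr; last by rewrite mulr_ge0 ?mulr_ge0// ltW.
  rewrite exprMn q2.
  have : n%:R * (2 * ln k%:R) <= c ^+ 2 * l * (2 * ln k%:R) by rewrite ler_wpM2r// mulr_ge0// ltW.
  lra.
have ip0 : 0 <= p%:R^-1 :> R by rewrite invr_ge0.
have h1 : Num.sqrt (2 * (span H k)%:R * ln k%:R) <= (1 + p%:R^-1) * q.
  apply: hs; first by rewrite addr_ge0.
  rewrite sp; have -> : (1 + p%:R^-1) ^+ 2 * l = l + 2 * (l / p%:R) + l / p%:R ^+ 2 :> R.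
    by field; rewrite gt_eqF.
  have : l / p%:R ^+ 2 <= l / p%:R.
    rewrite ler_wpM2l// lef_pV2 ?posrE ?exprn_gt0// expr2 ler_peMl ?(ltW pR) ?ler1n//.
  have : 0 <= l / p%:R ^+ 2 by rewrite divr_ge0.
  lra.
have h2 : Num.sqrt (2 * (mesh H k)%:R * ln k%:R) <= p%:R^-1 * q.
  by apply: hs => //; rewrite exprVn mulrC.
have es0 : 0 <= (1 + eps) * sigma by rewrite mulr_ge0 ?ltW// addr_gt0.
apply: (@le_trans _ _ (((1 + eps) * sigma * ((1 + 2 / p%:R) * q)) ^+ 2)).
  have n1 k' : 0 <= thr sigma eps k' k by rewrite mulr_ge0 ?sqrtr_ge0.
  have n2 : 0 <= (1 + eps) * sigma * ((1 + 2 / p%:R) * q).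
    by rewrite mulr_ge0// mulr_ge0// addr_ge0// mulr_ge0.
  rewrite ler_pXn2r ?nnegrE ?addr_ge0//.
  rewrite /thr -mulrDr ler_wpM2l//.
  have -> : (1 + 2 / p%:R) * q = (1 + p%:R^-1) * q + p%:R^-1 * q by lra.
  exact: lerD.
rewrite !exprMn q2; lra.
Qed.

Lemma ae_upper (p : nat) : (0 < p)%N ->
  {ae nu, forall w, exists (C : R) (N0 : nat), forall N, (N0 <= N)%N ->
    max_interval_energy w N <=
    N%:R * (2 * sigma ^+ 2 * upper_factor p * ln (ln N%:R) + C)}.
Proof.
move=> p0; pose H := (p ^ 2)%N; have H0 : (0 < H)%N by rewrite expn_gt0 p0.
pose eps : R := p%:R^-1.
have pR : 0 < p%:R :> R by rewrite ltr0n.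
have eps0 : 0 < eps by rewrite invr_gt0.
have eps1 : eps <= 1 by rewrite invf_le1// ler1n.
have [k0 [k02 [k0ln [C [C0 hC]]]]] := @ex_excess R nu iid sigma delta K sigma0 delta0 X1 X2 Xp H eps H0 eps0 eps1.
pose f m w := charge nu sigma delta H eps k0 m w.
have mexc k : measurable_fun [set: Om] (excess nu sigma delta H eps k) by exact: measurable_excess.
have ex0 k w : 0 <= (mesh H k)%:R^-1 * excess nu sigma delta H eps k w.
  by rewrite mulr_ge0 ?invr_ge0// excess_ge0.
have mf m : measurable_fun [set: Om] (f m).
  apply: measurable_funD.
    apply: measurable_funM; first exact: measurable_cst.
    by apply: measurable_funX; exact: measurable_coord.
  by apply: measurable_sum => k; apply: measurable_funM.
have f0 m w : 0 <= f m w by exact: charge_ge0.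
have fS m w : f m w <= f m.+1 w.
  rewrite /f /charge lerD2l; have [k0m|mk0] := leqP k0 m.
    by rewrite big_nat_recr//= lerDl.
  by rewrite [leLHS]big_geq ?sumr_ge0// ltnW.
have fC m : (\int[nu]_w (f m w)%:E <= ((len H k0)%:R * sigma ^+ 2 + C * eps^-1)%:E)%E.
  rewrite exD; [|by measf| |by move=> w; rewrite mulr_ge0 ?sqr_ge0|by move=> w; exact: sumr_ge0]; last first.
    by apply: measurable_sum => k; apply: measurable_funM.
  rewrite exZ; [|by measf|by move=> w; exact: sqr_ge0|by []].
  rewrite X2 -EFinM [leRHS]EFinD leeD2l//.
  rewrite ex_sum; [|by move=> k; apply: measurable_funM|by []].
  apply: (@le_trans _ _ (\sum_(k0 <= k < m) (C * k%:R `^ (- (1 + eps)))%:E)%E).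
    rewrite big_nat_cond [leRHS]big_nat_cond; apply: lee_sum => k /andP[/andP[k0k _] _].
    exact: hC.
  rewrite sumEFin lee_fin -mulr_sumr ler_wpM2l//.
  apply: le_trans (sum_powR_le m eps0).
  have [k0m|mk0] := leqP k0 m; last by rewrite big_geq ?(ltnW mk0)// sumr_ge0// => k _; exact: powR_ge0.
  rewrite [leRHS](@big_cat_nat _ _ _ k0)//= lerDr sumr_ge0// => k _; exact: powR_ge0.
have := ae_averages_bounded iid mf f0 fS fC.
apply: filterS => w [a ha].
have HR : 0 < (2 * H)%:R :> R by rewrite ltr0n muln_gt0.
pose kap : R := ln (1 + (2 * H)%:R^-1).
have kap0 : 0 < kap by rewrite ln_gt0// ltrDl invr_gt0.
pose B := 2 * sigma ^+ 2 * (1 + eps) ^+ 2 * (1 + 2 / p%:R) ^+ 2.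
have B0 : 0 <= B.
  by apply: mulr_ge0 (sqr_ge0 _); apply: mulr_ge0 (sqr_ge0 _); apply: mulr_ge0 (sqr_ge0 _).
(* By [len_exp], classes of length at most N satisfy ln k <= ln(ln N) - ln kap; this gives the first
   summand, the averaged charge the second. From N >= 2 on, kap <= ln N, so that [c] below is
   nonnegative. *)
exists (- ((1 + eps) * B * ln kap) + (1 + eps^-1) * (2 * a)), 2%N => N N2.
have N0 : (0 < N)%N by exact: leq_trans N2.
have NR : 0 < N%:R :> R by rewrite ltr0n.
have kapN : kap <= ln N%:R.
  rewrite /kap ler_ln ?posrE ?addr_gt0 ?invr_gt0//.
  apply: (@le_trans _ _ 2); last by rewrite ler_nat.
  by rewrite -[leRHS]/(1 + 1) lerD2l invf_le1// ler1n muln_gt0.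
have lN0 : 0 < ln (N%:R : R) by exact: lt_le_trans kapN.
pose c := B * (ln (ln N%:R) - ln kap).
have c0 : 0 <= c by rewrite /c mulr_ge0// subr_ge0 ler_ln.
apply: le_trans (@energy_le_charge R nu sigma delta H eps H0 k0 N c eps a w eps0 c0 N0 _ _ (ha N)) _.
- move=> k k0k lN.
  have kR : 0 < k%:R :> R by rewrite ltr0n; apply: leq_trans k0k; exact: leq_trans k02.
  have lk1 : 1 <= ln (k%:R : R).
    apply: le_trans k0ln _; rewrite ler_ln ?posrE ?ler_nat// ltr0n; exact: leq_trans k02.
  apply: le_trans (thr_sum_sq_le p0 eps0 lk1) _.
  rewrite ler_wpM2r// /c -/B ler_wpM2l//.
  rewrite -ln_div ?posrE// ler_ln ?posrE ?divr_gt0// ler_pdivlMr// mulrC.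
  rewrite -[leLHS]expRK ler_ln ?posrE ?expR_gt0//.
  apply: le_trans (len_exp H0 k) _; by rewrite ler_nat.
- move=> k; have es := ltW eps0; have ss := ltW sigma0.
  by apply: addr_ge0; rewrite mulr_ge0 ?sqrtr_ge0// mulr_ge0// addr_ge0.
rewrite ler_wpM2l// /c /upper_factor /B /eps; set q := p%:R^-1; lra.
Qed.

End ae_upper.

(** * Lower tails and the lower bound *)

Lemma expR_le1D_contract (R : realType) (u k : R) : 0 <= u -> u <= k -> k < 1 ->
  expR (u * (1 - k)) <= 1 + u.
Proof.
move=> u0 uk k1; set v := u * (1 - k).
have v0 : 0 <= v by rewrite mulr_ge0// subr_ge0 ltW.
have vu : v <= u by rewrite ler_piMr//; lra.
have x1 : 0 < 1 - v by lra.
have : 1 - v <= expR (- v) by have := expR_ge1Dx (- v); lra.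
rewrite expRN -[X in _ <= X]mul1r ler_pdivlMr ?expR_gt0// mulrC -ler_pdivlMr// mul1r.
move=> /le_trans; apply; rewrite invf_ple ?posrE//; last by lra.
rewrite -[leLHS]mul1r ler_pdivrMr; last by lra.
have : 0 <= u * (k - v) by rewrite mulr_ge0// subr_ge0; exact: le_trans uk.
by rewrite /v; lra.
Qed.

(* Under the law tilted by e^(theta Z), both {Z < y} and {y' < Z} are negligible: they
   are absorbed by a slightly smaller and a slightly larger tilt. *)
Lemma tilt (R : realType) (theta kappa y y' Z : R) : 0 < theta -> 0 < kappa ->
  expR (theta * Z) <= expR (theta * y') * (y <= Z)%R%:R +
    (expR (kappa * theta * y) * expR ((1 - kappa) * theta * Z) +
     expR (- (kappa * theta * y')) * expR ((1 + kappa) * theta * Z)).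
Proof.
move=> t0 k0.
have p1 : 0 <= expR (theta * y') by exact: expR_ge0.
have p2 : 0 <= expR (kappa * theta * y) * expR ((1 - kappa) * theta * Z) by rewrite mulr_ge0 ?expR_ge0.
have p3 : 0 <= expR (- (kappa * theta * y')) * expR ((1 + kappa) * theta * Z) by rewrite mulr_ge0 ?expR_ge0.
have [Zy|Zy] := ltP Z y.
  rewrite mulr0 add0r.
  apply: le_trans (_ : expR (kappa * theta * y) * expR ((1 - kappa) * theta * Z) <= _); last by rewrite lerDl.
  rewrite -expRD ler_expR.
  have : 0 <= kappa * theta * (y - Z) by rewrite !mulr_ge0 ?subr_ge0 ?ltW.
  by clear; lra.
rewrite mulr1; have [Zy'|Zy'] := ltP y' Z.
  apply: le_trans (_ : expR (- (kappa * theta * y')) * expR ((1 + kappa) * theta * Z) <= _); last first.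
    by rewrite addrA lerDr addr_ge0.
  rewrite -expRD ler_expR.
  have : 0 <= kappa * theta * (Z - y') by rewrite !mulr_ge0 ?subr_ge0 ?ltW.
  by clear; lra.
by rewrite ler_wpDr ?addr_ge0// ler_expR ler_pM2l.
Qed.

(* The exponents of the two error terms of [ex_tilt] fall short of the main one by
   about q kappa^2 / 2 when y and y' are (1 -/+ kappa) times the tilted mean. *)
Lemma tilt_gap (R : realType) (kappa q B : R) : 0 < kappa -> kappa <= 8^-1 -> 0 <= q ->
  let k := kappa ^+ 2 / 14 in
  4 * expR (- (q * kappa ^+ 2 / 4)) <= 1 -> B = expR (q / 2 * (1 - 3 * k)) ->
  expR (kappa * ((1 - kappa) * q)) * expR ((1 - kappa) ^+ 2 * q / 2 * (1 + k)) <= 4^-1 * B /\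
  expR (- (kappa * ((1 + kappa) * q))) * expR ((1 + kappa) ^+ 2 * q / 2 * (1 + k)) <= 4^-1 * B.
Proof.
move=> k0 k8 q0 k h4 ->.
have gap (x : R) : x <= q / 2 * (1 - 3 * k) - q * kappa ^+ 2 / 4 ->
    expR x <= 4^-1 * expR (q / 2 * (1 - 3 * k)).
  move=> hx; apply: (@le_trans _ _ (expR (- (q * kappa ^+ 2 / 4)) * expR (q / 2 * (1 - 3 * k)))).
    by rewrite -expRD ler_expR addrC.
  by rewrite ler_wpM2r ?expR_ge0//; move: h4; clear; lra.
have kap2 : 0 <= kappa ^+ 2 by exact: sqr_ge0.
(* Without [k], completing the square gives the exponent q (1 - kappa^2) / 2, so the gap is q
   kappa^2 / 2. The choice k = kappa^2 / 14 loses less than half of it, and the remaining q kappa^2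
   / 4 yields the factor 1/4. *)
have h1 : 0 <= q * (kappa ^+ 2 * (4^-1 - (1 - kappa) ^+ 2 / 28 - 3 / 28)).
  by rewrite mulr_ge0// mulr_ge0//; move: k0 k8; clear; nra.
have h2 : 0 <= q * (kappa ^+ 2 * (4^-1 - (1 + kappa) ^+ 2 / 28 - 3 / 28)).
  by rewrite mulr_ge0// mulr_ge0//; move: k0 k8; clear; nra.
split; rewrite -expRD; apply: gap; rewrite /k; [move: h1|move: h2]; clear; lra.
Qed.

(** * Lower tails of truncated sums *)

Section moderate_deviation.
Context {R : realType}.
Local Notation Om := (seqspace R).
Variable nu : probability Om R.
Hypothesis iid : iid_law nu.
Variables sigma delta K : R.
Hypothesis sigma0 : 0 < sigma.
Hypothesis delta0 : 0 < delta.
Hypothesis X1 : (\int[nu]_w (w 0%N)%:E = 0)%E.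
Hypothesis X2 : (\int[nu]_w (w 0%N ^+ 2)%:E = (sigma ^+ 2)%:E)%E.
Hypothesis Xp : (\int[nu]_w (`|w 0%N| `^ (2 + delta))%:E <= K%:E)%E.

Let ex_expR_cut_sum (s b : R) n : 1 <= b -> exists2 c : R,
  (\int[nu]_w (expR (s * cut nu b (w 0%N)))%:E = c%:E)%E &
  (\int[nu]_w (expR (s * cut_sum nu b n w))%:E = (c ^+ n)%:E)%E.
Proof.
move=> b1.
have me : measurable_fun [set: R] (fun u => expR (s * cut nu b u)).
  by apply: measurableT_comp => //; apply: measurable_funM => //; exact: measurable_cut.
have fin : (\int[nu]_w (expR (s * cut nu b (w 0%N)))%:E)%E \is a fin_num.
  rewrite ge0_fin_numE ?ex_ge0//.
  by apply: le_lt_trans (mgf_cut_le delta0 X1 X2 Xp s b1) (ltry _).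
exists (fine (\int[nu]_w (expR (s * cut nu b (w 0%N)))%:E)%E); first by rewrite fineK.
rewrite -(ex_coord_prod iid n me) ?fineK//.
by apply: eq_integral => w _; rewrite coord_prod_expR.
Qed.

Let mgf_power_le (theta b k s c : R) n : 0 < theta -> (0 < n)%N -> 1 <= b ->
  expR (4 * theta * b) <= 1 + k -> 0 <= s <= 2 ->
  (\int[nu]_w (expR (s * theta * cut nu b (w 0%N)))%:E = c%:E)%E ->
  c ^+ n <= expR (s ^+ 2 * (n%:R * (theta ^+ 2 * sigma ^+ 2)) / 2 * (1 + k)).
Proof.
move=> t0 n0 b1 h1 /andP[s0 s2] hc.
have b0 : 0 < b by exact: lt_le_trans b1.
have := mgf_cut_le delta0 X1 X2 Xp (s * theta) b1; rewrite hc lee_fin => hc'.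
have c0 : 0 <= c by rewrite -lee_fin -hc; apply: ex_ge0 => w; exact: expR_ge0.
apply: (@le_trans _ _ (expR ((s * theta) ^+ 2 * sigma ^+ 2 / 2 * expR (`|s * theta| * (2 * b))) ^+ n)).
  by rewrite lerXn2r ?nnegrE ?expR_ge0.
rewrite -expRM_natl ler_expR.
have -> : s ^+ 2 * (n%:R * (theta ^+ 2 * sigma ^+ 2)) / 2 * (1 + k) =
  n%:R * ((s * theta) ^+ 2 * sigma ^+ 2 / 2 * (1 + k)) by ring.
rewrite ler_pM2l ?ltr0n// ler_wpM2l//.
  by rewrite mulr_ge0// mulr_ge0 ?sqr_ge0.
apply: le_trans h1; rewrite ler_expR ger0_norm; last by rewrite mulr_ge0// ltW.
rewrite (_ : 4 * theta * b = (2 * theta) * (2 * b)); last by ring.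
by rewrite ler_wpM2r ?mulr_ge0 ?(ltW b0)// ler_wpM2r// ltW.
Qed.

(** Three factors 1 - k are lost: to the Taylor remainder, to the variance removed by truncation,
    and to replacing 1 + u by an exponential. Finally (1 - k)^3 >= 1 - 3k. *)
Let mgf_power_ge (theta b k c : R) n : 0 < theta -> 1 <= b -> 0 <= k -> k < 1 ->
  expR (4 * theta * b) <= 1 + k ->
  (K + K ^+ 2) * b `^ (- delta) <= k * sigma ^+ 2 ->
  theta ^+ 2 * sigma ^+ 2 / 2 <= k ->
  (\int[nu]_w (expR (theta * cut nu b (w 0%N)))%:E = c%:E)%E ->
  expR (n%:R * (theta ^+ 2 * sigma ^+ 2) / 2 * (1 - 3 * k)) <= c ^+ n.
Proof.
move=> t0 b1 k0 k1 h1 h2 h3 hc.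
have tb0 : 0 < theta * b by rewrite mulr_gt0// (lt_le_trans _ b1).
have s20 : 0 < sigma ^+ 2 by rewrite exprn_gt0.
have K0 : 0 <= K by rewrite -lee_fin; apply: le_trans Xp; apply: ex_ge0 => w; exact: powR_ge0.
have := mgf_cut_ge delta0 X1 X2 Xp theta b1; rewrite hc lee_fin.
have S2 : 0 <= (K + K ^+ 2) * b `^ (- delta) by rewrite mulr_ge0 ?powR_ge0// addr_ge0 ?sqr_ge0.
move: ((K + K ^+ 2) * _) h2 S2 => r h2 r0.
have E1 : expR (- (`|theta| * (2 * b))) <= 1.
  by rewrite -expR0 ler_expR oppr_le0 mulr_ge0// mulr_ge0// (le_trans _ b1).
have E0 : 1 - k <= expR (- (`|theta| * (2 * b))).
  have hD : expR (`|theta| * (2 * b)) <= 1 + k.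
    by apply: le_trans h1; rewrite ler_expR gtr0_norm//; lra.
  rewrite expRN -[leLHS]mul1r -[X in _ <= X]mul1r ler_pdivlMr ?expR_gt0// mul1r.
  apply: (@le_trans _ _ ((1 - k) * (1 + k))); last by have := sqr_ge0 k; lra.
  by rewrite ler_wpM2l// subr_ge0 ltW.
have Ege0 : 0 <= expR (- (`|theta| * (2 * b))) by exact: expR_ge0.
move: (expR (- (`|theta| * (2 * b)))) E1 E0 Ege0 => e e1 ke e0.
have -> : theta ^+ 2 / 2 * e * (sigma ^+ 2 - r) = theta ^+ 2 / 2 * (e * (sigma ^+ 2 - r)) by ring.
have t20 : 0 <= theta ^+ 2 / 2 by rewrite divr_ge0 ?sqr_ge0.
have -> : n%:R * (theta ^+ 2 * sigma ^+ 2) / 2 * (1 - 3 * k) =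
  n%:R * (theta ^+ 2 / 2 * sigma ^+ 2 * (1 - 3 * k)) by ring.
have {}h3 : theta ^+ 2 / 2 * sigma ^+ 2 <= k by rewrite mulrAC.
have S1 : (1 - k) * sigma ^+ 2 <= sigma ^+ 2 - r by rewrite mulrBl mul1r lerB.
move: (theta ^+ 2 / 2) t20 h3 => t t_ge0 h3; move: (sigma ^+ 2) s20 h3 h2 S1 => v v0 tv rv S1.
have k10 : 0 <= 1 - k by rewrite subr_ge0 ltW.
have S0 : 0 <= v - r by apply: le_trans S1; rewrite mulr_ge0// ltW.
have u0 : 0 <= t * (e * (v - r)) by apply: mulr_ge0 => //; exact: mulr_ge0.
have u1 : t * (e * (v - r)) <= k.
  apply: le_trans tv; rewrite ler_wpM2l// -[leRHS]mul1r; apply: ler_pM => //.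
  by rewrite gerBl.
have u2 : t * ((1 - k) * ((1 - k) * v)) <= t * (e * (v - r)).
  by rewrite ler_wpM2l//; apply: ler_pM => //; rewrite mulr_ge0// ltW.
move: (t * (e * (v - r))) u0 u1 u2 => u u0 u1 u2 hu.
apply: (@le_trans _ _ ((1 + u) ^+ n)); last first.
  by rewrite lerXn2r ?nnegrE ?addr_ge0// (le_trans _ hu)// addr_ge0.
apply: (@le_trans _ _ (expR (u * (1 - k)) ^+ n)); last first.
  by rewrite lerXn2r ?nnegrE ?expR_ge0 ?addr_ge0// expR_le1D_contract.
rewrite -expRM_natl ler_expR ler_wpM2l//.
apply: le_trans (ler_wpM2r k10 u2).
have -> : t * ((1 - k) * ((1 - k) * v)) * (1 - k) = t * v * ((1 - k) ^+ 3) by ring.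
rewrite ler_wpM2l//; first by rewrite mulr_ge0// ltW.
have : 0 <= k ^+ 2 * (3 - k) by rewrite mulr_ge0 ?sqr_ge0//; lra.
by lra.
Qed.

Let ex_tilt (theta kappa b y y' c1 c2 c3 : R) n : 0 < theta -> 0 < kappa ->
  (\int[nu]_w (expR (theta * cut_sum nu b n w))%:E = c1%:E)%E ->
  (\int[nu]_w (expR ((1 - kappa) * theta * cut_sum nu b n w))%:E = c2%:E)%E ->
  (\int[nu]_w (expR ((1 + kappa) * theta * cut_sum nu b n w))%:E = c3%:E)%E ->
  c1 <= expR (theta * y') * fine (nu [set w | y <= cut_sum nu b n w]) +
    (expR (kappa * theta * y) * c2 + expR (- (kappa * theta * y')) * c3).
Proof.
move=> t0 k0 I1 I2 I3; set A := [set w | _].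
have mcs := measurable_cut_sum nu b n.
have mA : measurable A by exact: (@measurable_set_le _ Om R (cst y) (cut_sum nu b n)).
have finA : nu A \is a fin_num by rewrite fin_num_measure.
rewrite -lee_fin EFinD EFinD EFinM (fineK finA) 2!EFinM -I1 -I2 -I3 prob_exE//.
have m1A : measurable_fun [set: Om] (\1_A : Om -> R) by exact: measurable_indic.
rewrite -!exZ ?expR_ge0//; try (by measf); try (by move=> w; exact: expR_ge0).
rewrite -!exD; try (by measf); try (by move=> w; rewrite ?addr_ge0 ?mulr_ge0 ?expR_ge0).
apply: ex_le; [by measf|by measf|by move=> w; exact: expR_ge0|].
move=> w; have -> : \1_A w = (y <= cut_sum nu b n w)%R%:R :> R.
  by rewrite indicE; congr (nat_of_bool _)%:R; apply/idP/idP => [/set_mem//|yZ]; exact/mem_set.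
exact: tilt.
Qed.

(** The threshold is 1 - kappa times the approximate tilted mean. By [tilt_gap] the two error terms
    use at most half of the tilted mass, and dividing the rest by e^((1 + kappa) q) gives the stated
    exponent. *)
Lemma cut_sum_lower_tail (theta kappa b : R) n : 0 < theta -> (0 < n)%N -> 1 <= b ->
  0 < kappa -> kappa <= 8^-1 ->
  let k2 := kappa ^+ 2 / 14 in let q := n%:R * (theta ^+ 2 * sigma ^+ 2) in
  expR (4 * theta * b) <= 1 + k2 ->
  (K + K ^+ 2) * b `^ (- delta) <= k2 * sigma ^+ 2 ->
  theta ^+ 2 * sigma ^+ 2 / 2 <= k2 ->
  4 * expR (- (q * kappa ^+ 2 / 4)) <= 1 ->
  ((2^-1 * expR (- (q / 2 * (1 + 2 * kappa + 3 * k2))))%:E <=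
   nu [set w | ((1 - kappa) * (theta * n%:R * sigma ^+ 2) <= cut_sum nu b n w)%R])%E.
Proof.
move=> t0 n0 b1 k0 k8 k2 q h1 h2 h3 h4.
have kk : kappa ^+ 2 <= 64^-1.
  have : kappa ^+ 2 <= (8^-1) ^+ 2 by rewrite ler_pXn2r ?nnegrE ?(ltW k0).
  by move=> /le_trans; apply; rewrite exprVn -natrX.
have k20 : 0 <= k2 by rewrite divr_ge0 ?sqr_ge0.
have k2s : k2 < 1 by rewrite /k2; move: kk; lra.
have q0 : 0 <= q by rewrite mulr_ge0// mulr_ge0 ?sqr_ge0.
set y := (1 - kappa) * _; pose y' := (1 + kappa) * (theta * n%:R * sigma ^+ 2).
have ty : kappa * theta * y = kappa * ((1 - kappa) * q) by rewrite /y /q; ring.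
have ty' : theta * y' = (1 + kappa) * q by rewrite /y' /q; ring.
have [c1 c1E I1] := @ex_expR_cut_sum theta b n b1.
have [c2 c2E I2] := @ex_expR_cut_sum ((1 - kappa) * theta) b n b1.
have [c3 c3E I3] := @ex_expR_cut_sum ((1 + kappa) * theta) b n b1.
have := @ex_tilt theta kappa b y y' _ _ _ n t0 k0 I1 I2 I3.
have lower := mgf_power_ge n t0 b1 k20 k2s h1 h2 h3 c1E.
have s2 : 0 <= 1 - kappa <= 2 by move: k0 k8; lra.
have s3 : 0 <= 1 + kappa <= 2 by move: k0 k8; lra.
have U2 := mgf_power_le t0 n0 b1 h1 s2 c2E; have U3 := mgf_power_le t0 n0 b1 h1 s3 c3E.
rewrite -/q in lower U2 U3.
have [V2 V3] := tilt_gap k0 k8 q0 h4 erefl.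
rewrite ty -(mulrA kappa theta y') ty'.
have {}U2 := ler_wpM2l (expR_ge0 (kappa * ((1 - kappa) * q))) U2.
have {}U3 := ler_wpM2l (expR_ge0 (- (kappa * ((1 + kappa) * q)))) U3.
set A := [set w | _].
have mA : measurable A.
  by exact: (@measurable_set_le _ Om R (cst y) (cut_sum nu b n) _ (measurable_cut_sum nu b n)).
have finA : nu A \is a fin_num by rewrite fin_num_measure.
rewrite -(fineK finA) lee_fin => main.
have e0 := expR_gt0 ((1 + kappa) * q).
rewrite -(ler_pM2l e0).
apply: (@le_trans _ _ (2^-1 * expR (q / 2 * (1 - 3 * k2)))).
  by rewrite mulrCA ler_wpM2l// -expRD ler_expR; lra.
have := le_trans U2 V2; have := le_trans U3 V3.
by move: (le_trans lower main); lra.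
Qed.

End moderate_deviation.

Lemma tail_parameters (R : realType) (sigma delta K kappa : R) :
  0 < sigma -> 0 < delta -> 0 <= K -> 0 < kappa -> kappa <= 8^-1 ->
  let k2 := kappa ^+ 2 / 14 in
  exists2 m0 : nat, (0 < m0)%N & forall m n, (m0 <= m)%N -> (2 ^ m <= n)%N ->
    let q := 2 * (1 - 4 * kappa) * ln (m%:R : R) in
    let xi := n%:R `^ (- (delta / (2 + delta))) : R in
    1 <= ln (m%:R : R) /\ forall th, 0 < th -> n%:R * (th ^+ 2 * sigma ^+ 2) = q ->
    [/\ expR (4 * th * cut_level delta n) <= 1 + k2,
        (K + K ^+ 2) * xi <= k2 * sigma ^+ 2,
        th ^+ 2 * sigma ^+ 2 / 2 <= k2,
        4 * expR (- (q * kappa ^+ 2 / 4)) <= 1 &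
        8 * (m%:R * ((2 * K + 6 * K ^+ 2) * xi)) <= kappa ^+ 2 * sigma ^+ 2].
Proof.
move=> s0 d0 K0 k0 k8 k2.
pose gam := delta / (2 + delta).
have d20 : 0 < 2 + delta by rewrite addr_gt0.
have gam0 : 0 < gam by rewrite divr_gt0.
have gam1 : gam <= 1 by rewrite ler_pdivrMr// mul1r lerDr.
have ln2 : 0 < ln (2 : R) by rewrite ln_gt0// ltr1n.
pose c := gam * ln 2; have c0 : 0 < c by rewrite mulr_gt0.
have s20 : 0 < sigma ^+ 2 by rewrite exprn_gt0.
have kk0 : 0 < kappa ^+ 2 by rewrite exprn_gt0.
have k20 : 0 < k2 by rewrite divr_gt0.
have l20 : 0 < ln (1 + k2) by rewrite ln_gt0// ltrDl.
pose C1 := K + K ^+ 2; have C10 : 0 <= C1 by rewrite addr_ge0 ?sqr_ge0.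
pose C2 := 2 * K + 6 * K ^+ 2.
have C20 : 0 <= C2 by rewrite addr_ge0 ?mulr_ge0 ?sqr_ge0.
(* As n >= 2^m, the product m xi is at most m^2 e^(-cm), so each smallness condition becomes a level
   for that quantity. [e1] comes from (4 th b)^2 sigma^2 = 16 q xi with q <= 2m. *)
pose e1 := ln (1 + k2) ^+ 2 * sigma ^+ 2 / 32.
pose e2 := k2 * sigma ^+ 2 / (C1 + 1).
pose e4 := kappa ^+ 2 * sigma ^+ 2 / (8 * (C2 + 1)).
have e10 : 0 < e1 by rewrite divr_gt0// mulr_gt0// exprn_gt0.
have C11 : 0 < C1 + 1 by rewrite ltr_wpDl.
have C21 : 0 < C2 + 1 by rewrite ltr_wpDl.
have e20 : 0 < e2 by rewrite divr_gt0// mulr_gt0.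
have e40 : 0 < e4 by rewrite divr_gt0 ?mulr_gt0.
have [m1 _ hm1] := @sq_expRN_small R c e1 c0 e10.
have [m2 _ hm2] := @sq_expRN_small R c e2 c0 e20.
have [m3 _ hm3] := @sq_expRN_small R c k2 c0 k20.
have [m4 _ hm4] := @sq_expRN_small R c e4 c0 e40.
(* This forces kappa^2 ln m >= 16, which gives both ln m >= 1 and, by e^x >= 1 + x, the bound with
   the factor 4. *)
pose m5 := (Num.truncn (expR (16 / kappa ^+ 2))).+1.
exists (maxn m1 (maxn m2 (maxn m3 (maxn m4 m5)))).
  by rewrite !leq_max /m5 !orbT.
move=> m n; rewrite !geq_max => /andP[/hm1 {}hm1 /andP[/hm2 {}hm2 /andP[/hm3 {}hm3 /andP[/hm4 {}hm4 m5m]]]] mn.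
move=> q; rewrite -/gam -/C1 -/C2 => xi.
have n0 : (0 < n)%N by apply: leq_trans mn; rewrite expn_gt0.
have nR : 0 < n%:R :> R by rewrite ltr0n.
have mR : 0 < m%:R :> R by rewrite ltr0n; exact: leq_trans m5m.
have mR1 : 1 <= m%:R :> R by rewrite ler1n; exact: leq_trans m5m.
have lm16 : 16 <= ln (m%:R : R) * kappa ^+ 2.
  rewrite -ler_pdivrMr// -[leLHS]expRK ler_ln ?posrE ?expR_gt0//.
  by apply: le_trans (ltW (truncnS_gt _)) _; rewrite ler_nat.
have kk1 : kappa ^+ 2 <= 1.
  by rewrite exprn_ile1 ?(ltW k0)// (le_trans k8)// invf_le1// ler1n.
have lm1 : 1 <= ln (m%:R : R).
  rewrite -(ler_pM2r kk0) mul1r; apply: le_trans lm16; apply: le_trans kk1 _.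
  by rewrite ler1n.
split => // th th0 thE.
have lmm : ln (m%:R : R) <= m%:R by exact: ltW (ln_sublinear mR).
have xi0 : 0 <= xi by exact: powR_ge0.
have xile : xi <= expR (- (c * m%:R)).
  have -> : expR (- (c * m%:R)) = (2 ^ m)%N%:R `^ (- gam) :> R.
    by rewrite natrX /powR gt_eqF ?exprn_gt0// lnXn// -mulr_natr /c; congr expR; ring.
  rewrite /xi !powRN lef_pV2 ?posrE ?powR_gt0 ?ltr0n ?expn_gt0//.
  by rewrite ge0_ler_powR ?nnegrE ?(ltW gam0)// ler_nat.
have mxi (e : R) : m%:R ^+ 2 * expR (- (c * m%:R)) <= e -> m%:R * xi <= e.
  move=> /(le_trans _); apply; apply: ler_pM => //.
  by rewrite expr2 ler_peMl// ltW.
have xile1 : xi <= m%:R * xi by rewrite ler_peMl.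
have q1 : ln (m%:R : R) <= q.
  by rewrite /q ler_peMl ?(le_trans _ lm1)//; move: k8; clear; lra.
have q0 : 0 <= q by rewrite (le_trans _ q1)// (le_trans _ lm1).
have q2 : q <= 2 * m%:R.
  apply: (@le_trans _ _ (2 * ln m%:R)); last by rewrite ler_pM2l.
  by rewrite /q ler_wpM2r ?(le_trans _ lm1)//; move: k0; clear; lra.
have th2 : th ^+ 2 * sigma ^+ 2 = q * n%:R^-1.
  by apply: (mulfI (lt0r_neq0 nR)); rewrite thE mulrCA divff ?mulr1 ?gt_eqF.
split.
- rewrite -[leRHS]lnK ?posrE ?addr_gt0// ler_expR.
  have b0 : 0 <= cut_level delta n by exact: powR_ge0.
  have bsq : cut_level delta n ^+ 2 = n%:R * xi.
    rewrite /cut_level -powR_mulrn ?powR_ge0// -powRrM /xi.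
    rewrite -{2}[n%:R](powRr1 (ltW nR)) -powRD; last by rewrite (gt_eqF nR) implybT.
    by congr (_ `^ _); rewrite /gam; field; rewrite gt_eqF.
  rewrite -(@ler_pXn2r _ 2) ?nnegrE ?mulr_ge0 ?(ltW l20) ?(ltW th0)//.
  rewrite !exprMn bsq -(ler_pM2r s20).
  have -> : 4 ^+ 2 * th ^+ 2 * (n%:R * xi) * sigma ^+ 2 =
    16 * ((n%:R * (th ^+ 2 * sigma ^+ 2)) * xi) by ring.
  rewrite thE.
  have := mxi _ hm1; rewrite /e1.
  have : q * xi <= 2 * (m%:R * xi) by rewrite mulrA ler_wpM2r.
  by clear; lra.
- have := le_trans xile1 (mxi _ hm2); rewrite /e2 ler_pdivlMr// => /(le_trans _); apply.
  by rewrite mulrC ler_wpM2l// lerDl.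
- apply: le_trans (mxi _ hm3); rewrite th2.
  apply: (@le_trans _ _ (m%:R * n%:R^-1)).
    rewrite mulrAC ler_wpM2r ?invr_ge0 ?(ltW nR)//.
    by rewrite ler_pdivrMr// mulrC.
  rewrite ler_wpM2l ?(ltW mR)// -[leLHS]powR_inv1 ?(ltW nR)// /xi ler_powR ?lerN2//.
  by rewrite ler1n.
- rewrite expRN ler_pdivrMr ?expR_gt0// mul1r.
  have : ln m%:R * kappa ^+ 2 <= q * kappa ^+ 2 by rewrite ler_pM2r.
  by move: lm16 (expR_ge1Dx (q * kappa ^+ 2 / 4)); clear; lra.
have := mxi _ hm4; rewrite /e4 ler_pdivlMr ?mulr_gt0//.
have : 0 <= m%:R * xi by rewrite mulr_ge0.
by clear; lra.
Qed.

Section block_lower_tail.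
Context {R : realType}.
Local Notation Om := (seqspace R).
Variable nu : probability Om R.
Hypothesis iid : iid_law nu.
Variables sigma delta K : R.
Hypothesis sigma0 : 0 < sigma.
Hypothesis delta0 : 0 < delta.
Hypothesis X1 : (\int[nu]_w (w 0%N)%:E = 0)%E.
Hypothesis X2 : (\int[nu]_w (w 0%N ^+ 2)%:E = (sigma ^+ 2)%:E)%E.
Hypothesis Xp : (\int[nu]_w (`|w 0%N| `^ (2 + delta))%:E <= K%:E)%E.

(** 1 - 4 kappa comes from the tilt q = 2 (1 - 4 kappa) ln m, one square (1 - kappa)^2 from the
    threshold for the truncated sum, the other from the remainder. *)
Definition lower_factor (kappa : R) : R := (1 - kappa) ^+ 4 * (1 - 4 * kappa).

Definition large_sum (kappa : R) m n : set Om :=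
  [set w | 2 * sigma ^+ 2 * lower_factor kappa * n%:R * ln m%:R <= (\sum_(i < n) w i) ^+ 2].

Lemma measurable_large_sum kappa m n : measurable (large_sum kappa m n).
Proof.
apply: (@measurable_set_le _ Om R (cst _) (fun w => (\sum_(i < n) w i) ^+ 2)) => //.
by apply: measurable_funX; apply: measurable_sum => i; exact: measurable_coord.
Qed.

Let cut_rem_tail n z : (0 < n)%N -> 0 < z ->
  (nu [set w | z <= cut_rem nu (cut_level delta n) n w]%R <=
   ((z ^+ 2)^-1 * (n%:R * ((2 * K + 6 * K ^+ 2) * n%:R `^ (- (delta / (2 + delta))))))%:E)%E.
Proof.
move=> n0 z0; set b := cut_level delta n.
have mrem := measurable_cut_rem nu b n.
have h := @markov_ge0 _ Om R nu (fun w => cut_rem nu b n w ^+ 2) (z ^+ 2) _ _ _.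
have {}h := h ltac:(by measf) (fun w => sqr_ge0 _) ltac:(by rewrite exprn_gt0).
have h' := @ex_cut_rem_sq R nu iid sigma delta K delta0 X1 X2 Xp n n n0 (leqnn n).
have := le_trans h h'.
rewrite (_ : [set w | _] = [set w | z <= cut_rem nu b n w]); last first.
  by apply/seteqP; split=> w /=; rewrite ler_pXn2r ?nnegrE ?(ltW z0)//; exact: sumr_ge0.
by move=> {}h; rewrite EFinM lee_pdivlMl ?exprn_gt0.
Qed.

Let large_sum_cut kappa m n b y w : 0 < kappa -> kappa <= 8^-1 -> 0 < y ->
  y ^+ 2 = (1 - kappa) ^+ 2 * (2 * (1 - 4 * kappa) * ln m%:R * n%:R * sigma ^+ 2) ->
  y <= cut_sum nu b n w -> cut_rem nu b n w < kappa * y -> large_sum kappa m n w.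
Proof.
move=> k0 k8 y0 ysq hy hB; rewrite /large_sum /=.
have yk0 : 0 <= (1 - kappa) * y by rewrite mulr_ge0 ?(ltW y0)//; lra.
have hS : (1 - kappa) * y <= \sum_(i < n) w i.
  have -> : \sum_(i < n) w i = cut_sum nu b n w + \sum_(i < n) (w i - cut nu b (w i)).
    by rewrite /cut_sum -big_split/=; apply: eq_bigr => i _; rewrite addrC subrK.
  have : - cut_rem nu b n w <= \sum_(i < n) (w i - cut nu b (w i)).
    by rewrite lerNl -sumrN; apply: ler_sum => i _; rewrite -normrN; exact: ler_norm.
  by lra.
apply: (@le_trans _ _ (((1 - kappa) * y) ^+ 2)).
  by rewrite exprMn ysq /lower_factor le_eqVlt; apply/orP; left; apply/eqP; ring.
by rewrite ler_pXn2r ?nnegrE// (le_trans yk0).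
Qed.

(** With P = m^(-(1 - kappa)), the truncated sum passes [y] with probability at least P/2, and the
    remainder reaches [kappa * y] with probability at most 1/(4m) <= P/4. The difference is P/4. *)
Lemma block_lower_tail (kappa : R) : 0 < kappa -> kappa <= 8^-1 ->
  exists2 m0 : nat, (0 < m0)%N & forall m n, (m0 <= m)%N -> (2 ^ m <= n)%N ->
    ((4^-1 * m%:R `^ (- (1 - kappa)))%:E <= nu (large_sum kappa m n))%E.
Proof.
move=> k0 k8.
have K0 : 0 <= K by rewrite -lee_fin; apply: le_trans Xp; apply: ex_ge0 => w; exact: powR_ge0.
have [m0 m00 hm0] := tail_parameters sigma0 delta0 K0 k0 k8.
exists m0 => // m n m0m mn.
have [lm1 params] := hm0 _ _ m0m mn.
have n0 : (0 < n)%N by apply: leq_trans mn; rewrite expn_gt0.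
have nR : 0 < n%:R :> R by rewrite ltr0n.
have mR : 0 < m%:R :> R by rewrite ltr0n; exact: leq_trans m0m.
have mR1 : 1 <= m%:R :> R by rewrite ler1n; exact: leq_trans m0m.
have s20 : 0 < sigma ^+ 2 by rewrite exprn_gt0.
set q := 2 * (1 - 4 * kappa) * ln m%:R in params.
set xi := n%:R `^ _ in params.
set k2 := kappa ^+ 2 / 14 in params.
have kap4 : 0 < 1 - 4 * kappa by lra.
have lmq : ln (m%:R : R) <= q.
  by rewrite /q ler_peMl ?(le_trans _ lm1)//; lra.
have q0 : 0 < q by rewrite mulr_gt0 ?mulr_gt0// (lt_le_trans _ lm1).
pose th := Num.sqrt (q / (n%:R * sigma ^+ 2)).
have thq : 0 < q / (n%:R * sigma ^+ 2) by rewrite divr_gt0// mulr_gt0.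
have th0 : 0 < th by rewrite sqrtr_gt0.
have th2 : th ^+ 2 = q / (n%:R * sigma ^+ 2) by rewrite sqr_sqrtr// ltW.
have thE : n%:R * (th ^+ 2 * sigma ^+ 2) = q.
  by rewrite th2; field; rewrite !gt_eqF.
have [h1 h2 h3 h4 h5] := params _ th0 thE.
pose b := cut_level delta n : R.
have b1 : 1 <= b by exact: cut_level_ge1.
have bd : b `^ (- delta) = xi by exact: cut_level_decay.
rewrite -bd in h2.
have tail := @cut_sum_lower_tail R nu iid sigma delta K sigma0 delta0 X1 X2 Xp th kappa b n th0 n0 b1 k0 k8.
rewrite /= -/k2 thE in tail; have {}tail := tail h1 h2 h3 h4.
set y := (1 - kappa) * _ in tail.
have kap1 : 0 < 1 - kappa by lra.
have y0 : 0 < y by rewrite mulr_gt0// !mulr_gt0.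
have ysq : y ^+ 2 = (1 - kappa) ^+ 2 * (q * n%:R * sigma ^+ 2).
  by rewrite -thE; rewrite /y; ring.
pose P := m%:R `^ (- (1 - kappa)) : R.
have P1 : m%:R^-1 <= P.
  by rewrite -[leLHS]powR_inv1 ?(ltW mR)// /P ler_powR// lerN2 gerBl ltW.
(* The factor 1 - 4 kappa in [q] serves here: (1 - 4 kappa)(1 + 2 kappa + 3 k2) <= 1 - kappa. *)
have tailP : 2^-1 * P <= 2^-1 * expR (- (q / 2 * (1 + 2 * kappa + 3 * k2))).
  rewrite ler_pM2l// /P /powR gt_eqF// ler_expR.
  have : 0 <= ln (m%:R : R) * ((1 - kappa) - (1 - 4 * kappa) * (1 + 2 * kappa + 3 * k2)).
    rewrite mulr_ge0 ?(le_trans _ lm1)// /k2.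
    by have := mulr_ge0 (sqr_ge0 kappa) (ltW kap4); have := mulr_ge0 (ltW k0) (ltW kap4); nra.
  by rewrite /q; lra.
have ky0 : 0 < kappa * y by rewrite mulr_gt0.
have := cut_rem_tail n0 ky0; rewrite -/b -/xi; set B := [set w | _] => PB.
have {}PB : (nu B <= (4^-1 * m%:R^-1)%:E)%E.
  apply: le_trans PB _; rewrite lee_fin ler_pdivrMl ?exprn_gt0// exprMn ysq.
  have hh : 2^-1 <= (1 - kappa) ^+ 2 * q.
    have -> : 2^-1 = 2^-1 * 1 :> R by rewrite mulr1.
    apply: ler_pM => //; first by nra.
    exact: le_trans lm1 lmq.
  rewrite [leRHS]mulrA ler_pdivlMr//.
  have -> : n%:R * ((2 * K + 6 * K ^+ 2) * xi) * m%:R = n%:R * (m%:R * ((2 * K + 6 * K ^+ 2) * xi)) by ring.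
  have -> : kappa ^+ 2 * ((1 - kappa) ^+ 2 * (q * n%:R * sigma ^+ 2)) / 4 =
    n%:R * (kappa ^+ 2 * sigma ^+ 2 * ((1 - kappa) ^+ 2 * q) / 4) by ring.
  rewrite ler_pM2l//.
  have : kappa ^+ 2 * sigma ^+ 2 * 2^-1 <= kappa ^+ 2 * sigma ^+ 2 * ((1 - kappa) ^+ 2 * q).
    by rewrite ler_pM2l// mulr_gt0// exprn_gt0.
  by move: h5; lra.
have mB : measurable B.
  exact: (@measurable_set_le _ Om R (cst _) (cut_rem nu b n) _ (measurable_cut_rem nu b n)).
have mL := measurable_large_sum kappa m n.
have sub : [set w | y <= cut_sum nu b n w] `<=` large_sum kappa m n `|` B.
  move=> w /= hy.
  have [hB|hB] := leP (kappa * y) (cut_rem nu b n w); [by right|left].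
  exact: (large_sum_cut k0 k8 y0 ysq hy hB).
have mA : measurable [set w : Om | y <= cut_sum nu b n w].
  exact: (@measurable_set_le _ Om R (cst _) (cut_sum nu b n) _ (measurable_cut_sum nu b n)).
have := le_measure nu _ _ sub; rewrite !inE => /(_ mA (measurableU _ _ mL mB)) hU.
have finL : nu (large_sum kappa m n) \is a fin_num by rewrite fin_num_measure.
have finB : nu B \is a fin_num by rewrite fin_num_measure.
have : ((2^-1 * expR (- (q / 2 * (1 + 2 * kappa + 3 * k2))))%:E <=
    nu (large_sum kappa m n) + nu B)%E.
  exact: le_trans tail (le_trans hU (measureU2 nu mL mB)).
move: PB; rewrite -(fineK finL) -(fineK finB) -EFinD !lee_fin -/P.
by move: tailP P1; lra.
Qed.

End block_lower_tail.

Section greedy.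
Context {R : realType}.

(* Walking from 0 to N, one step at a time from a bad point and with an interval
   of large energy from the other points. *)
Lemma greedy_energy (x b : nat -> R) (c : R) (L N : nat) : 0 <= c -> (0 < L)%N ->
  (forall i, 0 <= b i) ->
  (forall s, (s + L <= N)%N -> 1 <= b s \/
     exists u v, [/\ (s <= u)%N, (u < v)%N, (v <= s + L)%N &
       c * (v - s)%:R <= `|\sum_(u <= i < v) x i| ^+ 2]) ->
  c * (N%:R - L%:R - \sum_(i < N) b i) <= max_interval_energy x N.
Proof.
move=> c0 L0 b0 step.
pose inv s := c * (s%:R - \sum_(i < s) b i) <= max_interval_energy x s.
have bS s v : (s <= v)%N -> \sum_(i < s) b i <= \sum_(i < v) b i.
  move=> sv; rewrite -!(big_mkord xpredT b) [leRHS](@big_cat_nat _ _ _ s)//= lerDl.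
  exact: sumr_ge0.
have main n s : inv s -> (s <= N)%N -> (N - s <= n)%N ->
    exists s', [/\ inv s', (s' <= N)%N & (N < s' + L)%N].
  elim: n s => [|n IHn] s hs sN Nsn.
    by exists s; split=> //; lia.
  have [sL|] := leqP (s + L) N; last by exists s.
  (* A bad point is paid for by [1 <= b s]. Otherwise the energy of the gap from [s] to [u] is
     discarded, since [hv] already credits the whole step [v - s]. *)
  have [bs|[u [v [su uv vs hv]]]] := step s sL.
    apply: (IHn s.+1); [|lia|lia].
    rewrite /inv big_ord_recr/= -natr1.
    apply: le_trans (max_interval_energy_homo x (leqnSn s)).
    apply: le_trans hs; rewrite ler_wpM2l//; lra.
  apply: (IHn v); [|lia|lia].
  apply: le_trans (max_interval_energy_append x uv).
  have h1 := le_trans hs (max_interval_energy_homo x su).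
  have sv : (s <= v)%N by lia.
  have : c * (v%:R - \sum_(i < v) b i) <= c * (s%:R - \sum_(i < s) b i) + c * (v - s)%:R.
    rewrite -mulrDr ler_wpM2l// natrB//; have := bS _ _ sv; lra.
  lra.
have [|s [hs sN Ns]] := main N 0%N _ (leq0n N) (leq_subr _ _).
  by rewrite /inv big_ord0 subr0 mulr0 max_interval_energy_ge0.
apply: le_trans (max_interval_energy_homo x sN); apply: le_trans hs.
rewrite ler_wpM2l//.
have : N%:R <= s%:R + L%:R :> R by rewrite -natrD ler_nat ltnW.
have := bS _ _ sN; lra.
Qed.

End greedy.

Section borel_cantelli.
Context d (T : measurableType d) (R : realType) (P : probability T R).

(** The exponent is written [1 + 1] to match [sum_powR_le] with e = 1; events before [m0] are each
    bounded by 1. *)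
Lemma borel_cantelli_sq (F : nat -> set T) (C : R) (m0 : nat) : (2 <= m0)%N ->
  (forall m, measurable (F m)) ->
  (forall m, (m0 <= m)%N -> (P (F m) <= (C * m%:R `^ (- (1 + 1)))%:E)%E) ->
  {ae P, forall w, exists m1, forall m, (m1 <= m)%N -> ~ F m w}.
Proof.
move=> m02 mF PF.
have C0 : 0 <= C.
  have := le_trans (measure_ge0 P (F m0)) (PF m0 (leqnn _)).
  by rewrite lee_fin pmulr_lge0// powR_gt0// ltr0n; exact: leq_trans m02.
exists (lim_sup_set F); split.
- by apply: bigcapT_measurable => k; apply: bigcup_measurable => j _.
- apply: lim_sup_set_cvg0 => //.
  apply: (@le_lt_trans _ _ (m0%:R + C)%:E); last exact: ltry.
  apply: lime_le; first exact: is_cvg_nneseries.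
  apply: nearW => n /=.
  apply: (@le_trans _ _ (\sum_(0 <= k < m0 + n) P (F k))%E).
    rewrite [leRHS](@big_cat_nat _ _ _ n)//= ?leq_addl// leeDl//.
    by apply: sume_ge0.
  rewrite (@big_cat_nat _ _ _ m0)//= ?leq_addr// EFinD; apply: leeD.
    apply: (@le_trans _ _ (\sum_(0 <= k < m0) 1%:E)%E).
      by apply: lee_sum => k _; exact: probability_le1.
    by rewrite sumEFin sumr_const_nat subn0.
  apply: (@le_trans _ _ (\sum_(m0 <= k < m0 + n) (C * k%:R `^ (- (1 + 1)))%:E)%E).
    rewrite big_nat_cond [leRHS]big_nat_cond; apply: lee_sum => k /andP[/andP[k0 _] _].
    exact: PF.
  rewrite sumEFin lee_fin -mulr_sumr -[leRHS]mulr1 ler_wpM2l//.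
  have := @sum_powR_le R 1 (m0 + n) ltr01; rewrite invr1; apply: le_trans.
  rewrite [leRHS](@big_cat_nat _ _ _ m0)//= ?leq_addr// lerDr.
  by apply: sumr_ge0 => k _; exact: powR_ge0.
- move=> w /= nF k _ /=; apply: contrapT => hk; apply: nF; exists k => m km Fm.
  by apply: hk; exists m.
Qed.

End borel_cantelli.

(** * Points without a large block *)

Section bad_points.
Context {R : realType}.
Local Notation Om := (seqspace R).
Variable nu : probability Om R.
Hypothesis iid : iid_law nu.
Variables (sigma kappa : R) (A : nat).
Hypothesis A2 : (2 <= A)%N.

Definition block_len k : nat := (A ^ k.+1 - A ^ k)%N.

Definition bad_block m k (w : Om) : R :=
  \1_(~` large_sum sigma kappa m (block_len k)) (shift (A ^ k) w).

(* Indicator that no block [A^k, A^k.+1), m <= k < K, carries a large sum, as a product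
   so that its mean factorizes. *)
Definition bad m K (w : Om) : R := \prod_(m <= k < K) bad_block m k w.

Lemma bad_block_ge0 m k w : 0 <= bad_block m k w.
Proof. by rewrite /bad_block indicE. Qed.

Lemma measurable_bad_block m k : measurable_fun [set: Om] (bad_block m k).
Proof.
apply: measurableT_comp; last exact: measurable_shift.
by apply: measurable_indic; apply: measurableC; exact: measurable_large_sum.
Qed.

Lemma bad_ge0 m K w : 0 <= bad m K w.
Proof. by apply: prodr_ge0 => k _; exact: bad_block_ge0. Qed.

Lemma measurable_bad m K : measurable_fun [set: Om] (bad m K).
Proof. by apply: measurable_prod => k _; exact: measurable_bad_block. Qed.

Lemma block_lenE k : (A ^ k + block_len k = A ^ k.+1)%N.
Proof. by rewrite subnKC// leq_exp2l//; lia. Qed.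

Lemma first_coords_bad m K : first_coords (A ^ K)%N (bad m K).
Proof.
move=> u v uv; apply: eq_big_nat => k /andP[_ kK].
rewrite /bad_block !indicE; congr (_%:R); congr nat_of_bool.
apply/idP/idP; rewrite !inE /large_sum/=; (rewrite (_ : \sum_(i < block_len k) shift (A ^ k) u i =
   \sum_(i < block_len k) shift (A ^ k) v i)//; apply: eq_bigr => i _; rewrite /shift uv//;
   apply: leq_trans (_ : A ^ k.+1 <= _)%N; [by rewrite -block_lenE ltn_add2l|by rewrite leq_exp2l//; lia]).
Qed.

(** Blocks up to A^(m+n) depend only on the coordinates before it, and the next block begins there,
    so each block contributes an independent factor of at most 1 - p. *)
Lemma ex_bad m K (p : R) : (m <= K)%N -> 0 <= p -> p <= 1 ->
  (forall k, (m <= k)%N -> (p%:E <= nu (large_sum sigma kappa m (block_len k)))%E) ->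
  (\int[nu]_w (bad m K w)%:E <= ((1 - p) ^+ (K - m))%:E)%E.
Proof.
move=> mK p0 p1 hp; rewrite -(subnKC mK) addKn; elim: (K - m)%N => [|n IHn].
  under eq_integral do rewrite /bad addn0 big_geq//.
  by rewrite ex_cst expr0.
rewrite addnS; under eq_integral do rewrite /bad big_nat_recr ?leq_addr//=.
have mL := measurable_large_sum sigma kappa m (block_len (m + n)).
have mI : measurable_fun [set: Om] (\1_(~` large_sum sigma kappa m (block_len (m + n))) : Om -> R).
  by apply: measurable_indic; exact: measurableC.
rewrite (ex_glue iid (n := A ^ (m + n)) (F := bad m (m + n))
  (G := \1_(~` large_sum sigma kappa m (block_len (m + n)))))//; last 3 first.
- exact: measurable_bad.
- exact: bad_ge0.
- exact: first_coords_bad.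
rewrite -prob_exE; last exact: measurableC.
rewrite probability_setC// exprSr EFinM; apply: lee_pmul => //.
- by apply: ex_ge0 => w; exact: bad_ge0.
- by rewrite sube_ge0 ?probability_le1// fin_num_measure.
by rewrite EFinB leeB//; apply: hp; exact: leq_addr.
Qed.

Lemma not_bad m K w : bad m K w < 1 ->
  exists2 k, (m <= k < K)%N & large_sum sigma kappa m (block_len k) (shift (A ^ k) w).
Proof.
move=> b1; apply: contrapT => h.
suff : bad m K w = 1 by move=> e; rewrite e ltxx in b1.
rewrite /bad big_nat_cond big1// => k /andP[mk _].
rewrite /bad_block indicE mem_set// => hl; apply: h; exists k => //.
Qed.

End bad_points.

Section ae_lower.
Context {R : realType}.
Local Notation Om := (seqspace R).
Variable nu : probability Om R.
Hypothesis iid : iid_law nu.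
Variables sigma delta K : R.
Hypothesis sigma0 : 0 < sigma.
Hypothesis delta0 : 0 < delta.
Hypothesis X1 : (\int[nu]_w (w 0%N)%:E = 0)%E.
Hypothesis X2 : (\int[nu]_w (w 0%N ^+ 2)%:E = (sigma ^+ 2)%:E)%E.
Hypothesis Xp : (\int[nu]_w (`|w 0%N| `^ (2 + delta))%:E <= K%:E)%E.

Lemma expRN_powR_le (kappa : R) : 0 < kappa ->
  exists2 C : R, 0 <= C & forall m : nat, (0 < m)%N ->
    expR (- (4^-1 * m%:R `^ kappa)) <= C * m%:R `^ (- (1 + 1)).
Proof.
move=> k0; pose j := (Num.truncn (2 / kappa)).+1.
exists (4 ^+ j * j`!%:R); first by rewrite mulr_ge0// exprn_ge0.
move=> m m0; have mR : 1 <= m%:R :> R by rewrite ler1n.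
have mR0 : 0 < m%:R :> R by rewrite ltr0n.
pose x : R := m%:R `^ kappa; have x0 : 0 < x by exact: powR_gt0.
have xj : m%:R `^ (1 + 1) <= x ^+ j.
  rewrite /x -powR_mulrn ?powR_ge0// -powRrM ler_powR//.
  by rewrite mulrC -ler_pdivrMr// ltW// truncnS_gt.
have f0 : 0 < j`!%:R :> R by rewrite ltr0n fact_gt0.
have h : (x / 4) ^+ j / j`!%:R <= expR (x / 4).
  have := @expR_ge1Dxn R (x / 4) (Num.truncn (2 / kappa)); rewrite -/j => h.
  by apply: le_trans (h _); [rewrite lerDr|rewrite divr_ge0// ltW].
rewrite -/x [4^-1 * x]mulrC powRN expRN ler_pdivlMr ?powR_gt0// [(expR _)^-1 * _]mulrC.
rewrite ler_pdivrMr ?expR_gt0//.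
apply: le_trans xj _.
apply: (@le_trans _ _ (4 ^+ j * j`!%:R * ((x / 4) ^+ j / j`!%:R))).
  rewrite exprMn exprVn le_eqVlt; apply/orP; left; apply/eqP; field.
  by rewrite (gt_eqF f0) expf_neq0.
by rewrite ler_wpM2l// mulr_ge0// exprn_ge0.
Qed.

(** [lower_factor] at kappa = 1/(8p), times 1 - 1/A twice with A = 2p: once for the length of a
    block relative to A^(k+1), once as 1 - 2 eta for the bad points and the unfinished end. *)
Definition lower_const (p : nat) : R :=
  lower_factor (8 * p%:R)^-1 * (1 - (2 * p%:R)^-1) * (1 - (2 * p%:R)^-1).

(** Counting up to A^(4m+4) against A^(4m) lets one event per [m] serve all N between these powers.
    The constant ratio A^4 is harmless because the mean of [bad] is O(m^(-2)), which suffices for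
    Markov and Borel-Cantelli. *)
Lemma ae_few_bad_points (kappa eta : R) (A : nat) : 0 < kappa -> kappa <= 8^-1 ->
  0 < eta -> (2 <= A)%N ->
  {ae nu, forall w, exists m1 : nat, forall m, (m1 <= m)%N ->
    \sum_(i < A ^ (4 * m + 4)) bad sigma kappa A m (2 * m) (shift i w) < eta * (A ^ (4 * m))%:R}.
Proof.
move=> k0 k8 e0 A2.
have [m0 m00 hm0] := block_lower_tail iid sigma0 delta0 X1 X2 Xp k0 k8.
have [C C0 hC] := expRN_powR_le k0.
pose cnt m (w : Om) := \sum_(i < A ^ (4 * m + 4)) bad sigma kappa A m (2 * m) (shift i w).
pose F m := [set w : Om | eta * (A ^ (4 * m))%:R <= cnt m w].
have mbad m i : measurable_fun [set: Om] (fun w => bad sigma kappa A m (2 * m) (shift i w)).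
  apply: (measurableT_comp (measurable_bad _ _ _ _ _)); exact: measurable_shift.
have mcnt m : measurable_fun [set: Om] (cnt m) by apply: measurable_sum.
have mF m : measurable (F m) by exact: (@measurable_set_le _ Om R (cst _) (cnt m)).
have A0 k : 0 < (A ^ k)%:R :> R by rewrite ltr0n expn_gt0 (ltnW A2).
suff PF m : (maxn 2 m0 <= m)%N ->
    (nu (F m) <= ((A ^ 4)%:R / eta * C * m%:R `^ (- (1 + 1)))%:E)%E.
  have := borel_cantelli_sq (leq_maxl 2 m0) mF PF.
  apply: filterS => w [m1 hm1]; exists m1 => m /hm1 /= /negP.
  by rewrite -ltNge.
rewrite geq_max => /andP[m2 mm0].
have m1 : (0 < m)%N by exact: ltnW.
have mR : 0 < m%:R :> R by rewrite ltr0n.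
have mR1 : 1 <= m%:R :> R by rewrite ler1n.
pose p : R := 4^-1 * m%:R `^ (- (1 - kappa)).
have p0 : 0 <= p by rewrite mulr_ge0 ?powR_ge0.
have p1 : p <= 1.
  have : m%:R `^ (- (1 - kappa)) <= 1 :> R.
    rewrite -[leRHS](powRr0 m%:R) ler_powR// oppr_le0; lra.
  by rewrite /p; lra.
have hp k : (m <= k)%N -> (p%:E <= nu (large_sum sigma kappa m (block_len A k)))%E.
  move=> mk; apply: hm0 => //.
  have : (2 ^ m <= A ^ k)%N.
    apply: (@leq_trans (A ^ m)%N); last by rewrite leq_exp2l.
    by rewrite leq_exp2r//; apply: leq_trans m2.
  move=> /leq_trans; apply.
  by rewrite /block_len expnS -{3}[(A ^ k)%N]mul1n -mulnBl leq_pmull// subn_gt0.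
have mm : (m <= 2 * m)%N by rewrite leq_pmull.
have Ebad := ex_bad iid A2 mm p0 p1 hp.
rewrite (_ : (2 * m - m = m)%N) in Ebad; last by rewrite mul2n -addnn addnK.
have h1p : (1 - p) ^+ m <= C * m%:R `^ (- (1 + 1)).
  apply: le_trans (hC m _) => //.
  apply: (@le_trans _ _ (expR (- p) ^+ m)).
    by rewrite lerXn2r ?nnegrE ?expR_ge0 ?subr_ge0//; exact: expR_ge1Dx.
  rewrite -expRM_natl ler_expR mulrN lerN2 /p le_eqVlt; apply/orP; left; apply/eqP.
  rewrite mulrCA; congr (_ * _).
  rewrite -{2}[m%:R](powRr1 (ltW mR)) -powRD; last by rewrite (gt_eqF mR) implybT.
  by congr (_ `^ _); lra.
have ea0 : 0 < eta * (A ^ (4 * m))%:R by rewrite mulr_gt0.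
have cnt0 w : 0 <= cnt m w by apply: sumr_ge0 => i _; exact: bad_ge0.
have := markov_ge0 nu (mcnt m) cnt0 ea0; rewrite -/(F m) => hM.
have hE : (\int[nu]_w (cnt m w)%:E <= ((A ^ (4 * m + 4))%:R * (C * m%:R `^ (- (1 + 1))))%:E)%E.
  rewrite ex_sum//; last by move=> i w; exact: bad_ge0.
  apply: (@le_trans _ _ (\sum_(i < A ^ (4 * m + 4)) (C * m%:R `^ (- (1 + 1)))%:E)%E).
    apply: lee_sum => i _.
    rewrite (ex_shift iid i (measurable_bad _ _ _ _ _)); last by move=> w; exact: bad_ge0.
    by apply: le_trans Ebad _; rewrite lee_fin.
  by rewrite sumEFin sumr_const card_ord mulr_natl.
have := le_trans hM hE; rewrite -lee_pdivlMl// => /le_trans; apply.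
rewrite -EFinM lee_fin expnD natrM le_eqVlt; apply/orP; left; apply/eqP.
by field; rewrite !gt_eqF.
Qed.

Lemma ae_lower (p : nat) : (0 < p)%N ->
  {ae nu, forall w, exists (C : R) (N0 : nat), forall N, (N0 <= N)%N ->
    N%:R * (2 * sigma ^+ 2 * lower_const p * (ln (ln N%:R) - C)) <= max_interval_energy w N}.
Proof.
move=> p0; have pR : 1 <= p%:R :> R by rewrite ler1n.
have pR0 : 0 < p%:R :> R by rewrite ltr0n.
pose kappa : R := (8 * p%:R)^-1.
have k0 : 0 < kappa by rewrite invr_gt0 mulr_gt0.
have k8 : kappa <= 8^-1 by rewrite lef_pV2 ?posrE ?mulr_gt0// ler_peMr.
pose eta : R := (4 * p%:R)^-1.
have e0 : 0 < eta by rewrite invr_gt0 mulr_gt0.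
pose A := (2 * p)%N; have A2 : (2 <= A)%N by rewrite /A leq_pmulr.
have AR : A%:R = 2 * p%:R :> R by rewrite natrM.
have A1 := ltnW A2.
have AR0 : 0 < A%:R :> R by rewrite ltr0n.
have A0 k : (0 < A ^ k)%N by rewrite expn_gt0 A1.
have lA0 : 0 < ln (A%:R : R) by rewrite ln_gt0// ltr1n.
have := ae_few_bad_points k0 k8 e0 A2; apply: filterS => w [m1 hm1].
have lf0 : 0 <= lower_factor kappa.
  by rewrite /lower_factor mulr_ge0 ?exprn_ge0//; lra.
exists (ln 8 + ln (ln A%:R)), (A ^ (4 * (maxn m1 (maxn 2 (4 * p)))))%N => N hN.
have N0 : (0 < N)%N by exact: leq_trans hN.
have NR : 0 < N%:R :> R by rewrite ltr0n.
(* N lies between A^(4m) and A^(4m+4), so steps of length at most A^(2m) are about the square root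
   of N. Moreover ln N <= 8 m ln A, which explains the constant [ln 8 + ln (ln A%:R)]. *)
pose l := trunc_log A N; pose m := (l %/ 4)%N.
have lN : (4 * (maxn m1 (maxn 2 (4 * p))) <= l)%N by exact: trunc_log_max.
have : (maxn m1 (maxn 2 (4 * p)) <= m)%N by rewrite /m leq_divRL// mulnC.
rewrite !geq_max => /andP[m1m /andP[m2 mp]].
have lm : (4 * m <= l < 4 * m + 4)%N by rewrite /m; clear; lia.
have Nlo : (A ^ (4 * m) <= N)%N.
  apply: leq_trans (trunc_logP A2 N0); rewrite leq_exp2l//; by case/andP: lm.
have Nhi : (N < A ^ (4 * m + 4))%N.
  apply: leq_trans (trunc_log_ltn N A2) _; rewrite leq_exp2l//; by case/andP: lm.
have m0 : (0 < m)%N by exact: ltnW.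
have mR : 0 < m%:R :> R by rewrite ltr0n.
have lm0 : 0 <= ln (m%:R : R) by rewrite ln_ge0// ler1n.
pose c := 2 * sigma ^+ 2 * lower_factor kappa * (1 - A%:R^-1) * ln m%:R.
have iA1 : A%:R^-1 <= 1 :> R by rewrite invf_le1// ler1n.
have c0 : 0 <= c.
  apply: mulr_ge0 => //; apply: mulr_ge0; last by rewrite subr_ge0.
  by apply: mulr_ge0 => //; rewrite mulr_ge0// sqr_ge0.
have g := @greedy_energy R w (fun i => bad sigma kappa A m (2 * m) (shift i w)) c (A ^ (2 * m)) N c0
  (A0 _) (fun i => bad_ge0 _ _ _ _ _ _).
have {}g := g _; apply: (le_trans _ (g _)); last first.
  move=> s sN; have [h|h] := leP 1 (bad sigma kappa A m (2 * m) (shift s w)); first by left.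
  right; have [k /andP[mk km] hk] := not_bad h.
  exists (s + A ^ k)%N, (s + A ^ k.+1)%N; split.
  - exact: leq_addr.
  - by rewrite ltn_add2l ltn_exp2l.
  - by rewrite leq_add2l leq_exp2l.
  rewrite addKn real_normK ?num_real//.
  have -> : \sum_(s + A ^ k <= i < s + A ^ k.+1) w i =
     \sum_(i < block_len A k) shift (A ^ k) (shift s w) i.
    rewrite -[LHS]addr0 -(big_mkord xpredT (shift (A ^ k) (shift s w))).
    rewrite -{1}[(s + A ^ k)%N]add0n big_addn addr0.
    rewrite (_ : s + A ^ k.+1 - (s + A ^ k) = block_len A k)%N; last by rewrite /block_len subnDl.
    by apply: eq_bigr => i _; rewrite /shift; congr (w _); clear; lia.
  move: hk; rewrite /large_sum/= => /(le_trans _); apply.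
  have bl : (block_len A k)%:R = (1 - A%:R^-1) * (A ^ k.+1)%:R :> R.
    rewrite /block_len natrB ?leq_exp2l// !natrX exprS; field.
    by rewrite gt_eqF.
  rewrite bl /c; lra.
have hB : \sum_(i < N) bad sigma kappa A m (2 * m) (shift i w) <= eta * N%:R.
  apply: (@le_trans _ _ (\sum_(i < A ^ (4 * m + 4)) bad sigma kappa A m (2 * m) (shift i w))).
    rewrite -!(big_mkord xpredT (fun i => bad sigma kappa A m (2 * m) (shift i w))).
    rewrite [leRHS](@big_cat_nat _ _ _ N)//= ?(ltnW Nhi)// lerDl.
    by apply: sumr_ge0 => i _; exact: bad_ge0.
  apply: le_trans (ltW (hm1 m m1m)) _; by rewrite ler_wpM2l ?(ltW e0)// ler_nat.
(* This amounts to A^(2m) >= 4p, guaranteed by the choice m >= 4p. *)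
have hL : (A ^ (2 * m))%:R <= eta * N%:R :> R.
  rewrite /eta mulrC ler_pdivlMr ?mulr_gt0// -natrM -natrM ler_nat.
  apply: leq_trans Nlo.
  have -> : (4 * m = 2 * m + 2 * m)%N by clear; lia.
  rewrite expnD leq_mul2l; apply/orP; right.
  apply: (@leq_trans (2 ^ (2 * m))%N); last by rewrite leq_exp2r// muln_gt0.
  have h4 : (4 * p <= 2 * m)%N by apply: leq_trans mp _; rewrite leq_pmull.
  exact: leq_trans h4 (ltnW (ltn_expl _ (ltnSn 1))).
have lnN : ln (ln N%:R) - (ln 8 + ln (ln A%:R)) <= ln (m%:R : R).
  rewrite lerBlDr addrA -!lnM ?posrE ?mulr_gt0//.
  have h : ln N%:R <= m%:R * 8 * ln (A%:R : R).
    apply: (@le_trans _ _ (ln (A ^ (4 * m + 4))%:R)).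
      by rewrite ler_ln ?posrE ?ltr0n// ler_nat ltnW.
    rewrite natrX lnXn// -[ln A%:R *+ _]mulr_natl ler_wpM2r ?(ltW lA0)// -natrM ler_nat.
    by move: m0; clear; lia.
  have lN0 : 0 < ln (N%:R : R).
    rewrite ln_gt0// ltr1n; apply: leq_trans Nlo.
    by rewrite -{1}(expn0 A) ltn_exp2l// muln_gt0.
  by rewrite ler_ln ?posrE ?mulr_gt0.
apply: (@le_trans _ _ (c * ((1 - 2 * eta) * N%:R))); last first.
  by rewrite ler_wpM2l//; lra.
have -> : c * ((1 - 2 * eta) * N%:R) = N%:R * (2 * sigma ^+ 2 * lower_const p * ln m%:R).
  rewrite /c /lower_const -/kappa -AR (_ : 1 - 2 * eta = 1 - A%:R^-1); first by lra.
  by rewrite AR /eta; field; rewrite gt_eqF.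
have lc0 : 0 <= 2 * sigma ^+ 2 * lower_const p.
  apply: mulr_ge0; first by rewrite mulr_ge0 ?sqr_ge0.
  by rewrite /lower_const -AR mulr_ge0 ?subr_ge0// mulr_ge0 ?subr_ge0.
by rewrite ler_wpM2l// ler_wpM2l.
Qed.

End ae_lower.

(** * The limit *)

Section ratio_limit.
Context {R : realType}.

Lemma upper_factor_le (p : nat) : (0 < p)%N -> upper_factor p <= 1 + 71 * p%:R^-1 :> R.
Proof.
move=> p0; have pR : 1 <= p%:R :> R by rewrite ler1n.
rewrite /upper_factor; set q : R := p%:R^-1.
have q0 : 0 <= q by rewrite invr_ge0.
have q1 : q <= 1 by rewrite invf_le1// (lt_le_trans _ pR).
have h1 : (1 + q) ^+ 3 <= 1 + 7 * q by nra.
have h2 : (1 + 2 * q) ^+ 2 <= 1 + 8 * q by nra.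
(* As q <= 1, the constant is 7 + 8 + 56 = 71. *)
apply: (@le_trans _ _ ((1 + 7 * q) * (1 + 8 * q))); last by nra.
by apply: ler_pM; rewrite ?exprn_ge0 ?addr_ge0 ?mulr_ge0.
Qed.

Lemma lower_const_bounds (p : nat) : (0 < p)%N ->
  1 - 2 * p%:R^-1 <= (lower_const p : R) <= 1.
Proof.
move=> p0; have pR : 1 <= p%:R :> R by rewrite ler1n.
have pR0 : 0 < p%:R :> R by rewrite ltr0n.
rewrite /lower_const /lower_factor.
have -> : (8 * p%:R)^-1 = 8^-1 * p%:R^-1 :> R by rewrite invfM.
have -> : (2 * p%:R)^-1 = 2^-1 * p%:R^-1 :> R by rewrite invfM.
set q : R := p%:R^-1.
have q0 : 0 <= q by rewrite invr_ge0.
have q1 : q <= 1 by rewrite invf_le1.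
set x := 1 - 8^-1 * q; set y := 1 - 2^-1 * q.
have x0 : 0 <= x by rewrite /x; lra.
have x1 : x <= 1 by rewrite /x; lra.
have y0 : 0 <= y by rewrite /y; lra.
have y1 : y <= 1 by rewrite /y; lra.
have -> : 1 - 4 * (8^-1 * q) = y by rewrite /y; lra.
have x4 : 1 - 2^-1 * q <= x ^+ 4.
  have x2 : 1 - 4^-1 * q <= x ^+ 2 by rewrite /x; nra.
  have -> : x ^+ 4 = x ^+ 2 * x ^+ 2 by rewrite -exprD.
  have : (1 - 4^-1 * q) * (1 - 4^-1 * q) <= x ^+ 2 * x ^+ 2 by apply: ler_pM => //; lra.
  have := sqr_ge0 q; nra.
have x40 : 0 <= x ^+ 4 by exact: exprn_ge0.
have x41 : x ^+ 4 <= 1 by exact: exprn_ile1.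
have y3 : 1 - 3 / 2 * q <= y * y * y by rewrite /y; nra.
have yy0 : 0 <= y * y * y by rewrite !mulr_ge0.
have -> : x ^+ 4 * y * y * y = x ^+ 4 * (y * y * y) by lra.
apply/andP; split; last first.
  by rewrite mulr_ile1// mulr_ile1 ?mulr_ge0// mulr_ile1.
(* The losses q/2 and 3q/2 of the two factors therefore add up to at most 2q. *)
have : x ^+ 4 * (y * y * y) >= x ^+ 4 + y * y * y - 1.
  have : 0 <= (1 - x ^+ 4) * (1 - y * y * y).
    by rewrite mulr_ge0 ?subr_ge0// mulr_ile1 ?mulr_ge0// mulr_ile1.
  lra.
lra.
Qed.

Lemma energy_ratio_cvg (V : nat -> R) (sigma : R) : 0 < sigma ->
  (forall p : nat, exists (C : R) (N0 : nat), forall N, (N0 <= N)%N ->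
     V N <= N%:R * (2 * sigma ^+ 2 * upper_factor p.+1 * ln (ln N%:R) + C)) ->
  (forall p : nat, exists (C : R) (N0 : nat), forall N, (N0 <= N)%N ->
     N%:R * (2 * sigma ^+ 2 * lower_const p.+1 * (ln (ln N%:R) - C)) <= V N) ->
  V N / (2 * sigma ^+ 2 * N%:R * ln (ln N%:R)) @[N --> \oo] --> (1 : R).
Proof.
move=> s0 hU hL; apply/cvgrPdist_le => e e0.
have s20 : 0 < 2 * sigma ^+ 2 by rewrite mulr_gt0// exprn_gt0.
(* It gives 71 / (p + 1) <= e/2; the other half of [e] absorbs the additive constants once ln(ln N)
   exceeds [B]. *)
pose p := Num.truncn (142 / e).
have [C1 [N1 h1]] := hU p; have [C2 [N2 h2]] := hL p.
have pe : 71 * p.+1%:R^-1 <= e / 2.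
  rewrite ler_pdivrMr ?ltr0n//.
  have := ltW (truncnS_gt (142 / e)); rewrite -/p ler_pdivrMr//; lra.
have ip0 : 0 <= p.+1%:R^-1 :> R by rewrite invr_ge0.
pose B := (2 / e) * (`|C1| / (2 * sigma ^+ 2) + `|C2|) + 1.
have B0 : 0 < B.
  by rewrite ltr_wpDl// mulr_ge0 ?divr_ge0 ?addr_ge0 ?divr_ge0 ?(ltW e0) ?(ltW s20).
near=> N.
have NB : expR (expR B) <= N%:R.
  apply: (@le_trans _ _ (Num.truncn (expR (expR B))).+1%:R); first exact: ltW (truncnS_gt _).
  by rewrite ler_nat; near: N; exact: nbhs_infty_ge.
have NR : 0 < N%:R :> R by apply: lt_le_trans NB; exact: expR_gt0.
have lN : expR B <= ln (N%:R : R) by rewrite -[leLHS]expRK ler_ln ?posrE ?expR_gt0.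
have lN0 : 0 < ln (N%:R : R) by apply: lt_le_trans lN; exact: expR_gt0.
pose l := ln (ln (N%:R : R)).
have lB : B <= l by rewrite -[leLHS]expRK ler_ln ?posrE ?expR_gt0.
have l0 : 0 < l by exact: lt_le_trans lB.
have D0 : 0 < 2 * sigma ^+ 2 * N%:R * l by rewrite mulr_gt0// mulr_gt0.
have lC : `|C1| / (2 * sigma ^+ 2) + `|C2| <= e / 2 * l.
  have h : (2 / e) * (`|C1| / (2 * sigma ^+ 2) + `|C2|) <= l by apply: le_trans lB; rewrite lerDl.
  have : e / 2 * ((2 / e) * (`|C1| / (2 * sigma ^+ 2) + `|C2|)) <= e / 2 * l by rewrite ler_wpM2l// divr_ge0// ltW.
  by rewrite mulrA (_ : e / 2 * (2 / e) = 1) ?mul1r//; field; rewrite gt_eqF.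
have C1l : C1 <= 2 * sigma ^+ 2 * (e / 2 * l).
  apply: le_trans (ler_norm _) _.
  rewrite -ler_pdivrMl// mulrC; apply: le_trans lC; by rewrite lerDl.
have C2l : `|C2| <= e / 2 * l.
  by apply: le_trans lC; rewrite lerDr divr_ge0// ltW.
have U := upper_factor_le (ltn0Sn p); have /andP[L1 L2] := lower_const_bounds (ltn0Sn p).
have hu : V N <= 2 * sigma ^+ 2 * N%:R * l * (1 + e).
  apply: le_trans (h1 N _) _; first by near: N; exact: nbhs_infty_ge.
  have -> : 2 * sigma ^+ 2 * N%:R * l * (1 + e) = N%:R * (2 * sigma ^+ 2 * (1 + e / 2) * l + 2 * sigma ^+ 2 * (e / 2 * l)) by lra.
  rewrite ler_pM2l// -/l lerD// ler_wpM2r ?(ltW l0)// ler_pM2l//.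
  by apply: le_trans U _; rewrite lerD2l.
have hl : 2 * sigma ^+ 2 * N%:R * l * (1 - e) <= V N.
  apply: le_trans (h2 N _); last by near: N; exact: nbhs_infty_ge.
  have -> : 2 * sigma ^+ 2 * N%:R * l * (1 - e) = N%:R * (2 * sigma ^+ 2 * ((1 - e) * l)) by lra.
  rewrite ler_pM2l// -[leRHS]mulrA ler_pM2l// -/l.
  have c2 : C2 <= `|C2| by exact: ler_norm.
  move: (lower_const p.+1) L1 L2 => L L1 L2.
  have q1 : p.+1%:R^-1 <= 1 :> R by rewrite invf_le1// ler1n.
  move: (p.+1%:R^-1 : R) q1 ip0 pe L1 => q q1 ip0 pe L1.
  have hL1 : (1 - e / 2) * l <= L * l by rewrite ler_pM2r//; lra.
  have : L * C2 <= `|C2|.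
    apply: le_trans (ler_norm _) _; rewrite normrM ler_piMl// ler_norml L2 andbT.
    by lra.
  lra.
rewrite distrC ler_norml; apply/andP; split.
  by rewrite lerBrDr ler_pdivlMr// mulrC addrC.
by rewrite lerBlDr ler_pdivrMr// mulrC addrC.
Unshelve. all: by end_near.
Qed.

End ratio_limit.

(** * Transfer to the given random variables *)

Section sequence_law.
Context (R : realType) (d : measure_display) (T : measurableType d)
  (P : probability T R) (X : nat -> {RV P >-> R}).

Definition coords (t : T) : seqspace R := fun i => X i t.

Lemma measurable_coords : measurable_fun [set: T] coords.
Proof. by apply: measurable_to_seqspace => i. Qed.

Definition coord_mfun : {mfun T >-> seqspace R} :=
  HB.pack coords (isMeasurableFun.Build _ _ _ _ _ measurable_coords).

Lemma iid_coords_law : mutually_independent X -> identically_distributed X ->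
  iid_law (distribution P coord_mfun).
Proof.
move=> ind idd; exists (distribution P (X 0%N)) => // n B mB.
have := ind [fset i in iota 0 n]%fset B (fun i _ => mB i).
rewrite (_ : \bigcap_(i in _) _ = coords @^-1` [set w | forall i, (i < n)%N -> B i (w i)]); last first.
  apply/seteqP; split=> t /= h i; first by move=> hi; apply: h; rewrite /= !inE mem_iota.
  by rewrite /= !inE mem_iota/= => hi; exact: h.
move=> h; rewrite /distribution /pushforward /= [LHS]h.
rewrite (perm_big (iota 0 n)); last first.
  apply: uniq_perm; rewrite ?fset_uniq ?iota_uniq// => i.
  by rewrite !inE.
rewrite -[RHS](big_mkord xpredT (fun i => distribution P (X 0%N) (B i))).
rewrite /index_iota subn0; apply: eq_bigr => i _.
exact: (idd i 0%N (B i) (mB i)).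
Qed.

Lemma ae_coords (Q : seqspace R -> Prop) :
  {ae distribution P coord_mfun, forall w, Q w} -> {ae P, forall t, Q (coords t)}.
Proof.
move=> [A [mA PA QA]]; exists (coords @^-1` A); split => //.
- by rewrite -[X in measurable X]setTI; exact: measurable_coords.
- by move=> t /= Qt; apply: QA.
Qed.

End sequence_law.

Theorem theorem1 (R : realType) (d : measure_display) (T : measurableType d)
    (P : probability T R) (X : nat -> {RV P >-> R}) (sigma delta : R)
    (Xindep : mutually_independent X)
    (Xid : identically_distributed X)
    (Xmean : forall i, ('E_P[X i] = 0)%E)
    (sigma_gt0 : 0 < sigma)
    (Xvar : forall i, ('E_P[(fun w => X i w ^+ 2)%R] = (sigma ^+ 2)%:E)%E)
    (delta_gt0 : 0 < delta)
    (Xmoment : forall i, ('E_P[(fun w => `|X i w| `^ (2 + delta))%R] < +oo)%E) :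
  {ae P, forall w,
    max_interval_energy (fun i => X i w) N / (2 * sigma ^+ 2 * N%:R * ln (ln N%:R))
      @[N --> \oo] --> (1 : R)}.
Proof.
pose nu : probability (seqspace R) R := distribution P (coord_mfun X).
have iid : iid_law nu by exact: iid_coords_law.
have mpow : measurable_fun [set: R] (fun u : R => `|u| `^ (2 + delta)).
  by apply: (measurableT_comp (@measurable_powR R (2 + delta))); exact: normr_measurable.
pose K := fine ('E_P[(fun w => `|X 0%N w| `^ (2 + delta))%R])%E.
have Kfin : (\int[P]_t (`|X 0%N t| `^ (2 + delta))%:E)%E \is a fin_num.
  rewrite ge0_fin_numE; first by have := Xmoment 0%N; rewrite unlock.
  by apply: integral_ge0 => t _; rewrite lee_fin powR_ge0.
have X2' : (\int[P]_t (X 0%N t ^+ 2)%:E = (sigma ^+ 2)%:E)%E by rewrite -(Xvar 0%N) unlock.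
have X2 : (\int[nu]_w (w 0%N ^+ 2)%:E = (sigma ^+ 2)%:E)%E.
  rewrite -X2' (@ge0_integral_distribution _ _ _ _ _ P (coord_mfun X))//.
    by apply/measurable_EFinP; apply: measurable_funX; exact: measurable_coord.
  by move=> w; rewrite lee_fin sqr_ge0.
have Xp : (\int[nu]_w (`|w 0%N| `^ (2 + delta))%:E <= K%:E)%E.
  rewrite (@ge0_integral_distribution _ _ _ _ _ P (coord_mfun X)).
  - by rewrite /K unlock fineK.
  - by apply/measurable_EFinP; exact: measurable_at mpow.
  - by move=> w; rewrite lee_fin powR_ge0.
have X1 : (\int[nu]_w (w 0%N)%:E = 0)%E.
  rewrite (@integral_distribution _ _ _ _ _ P (coord_mfun X)).
  - by rewrite -(Xmean 0%N) unlock.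
  - by apply/measurable_EFinP; exact: measurable_coord.
  (* The signed change of variables needs integrability, which follows from |x| <= 1 + x^2. *)
  apply: (@integrable_EFin_le _ _ _ P _ (fun t => 1 + X 0%N t ^+ 2)) => //.
  - by apply: measurable_funD => //; exact: measurable_funX.
  - by move=> t /=; have := sqr_ge0 (`|X 0%N t| - 1); rewrite -[X 0%N t ^+ 2]real_normK ?num_real//; rewrite /coords; nra.
  - rewrite exD//; [|exact: measurable_funX|by move=> t; exact: sqr_ge0].
    by rewrite ex_cst X2' -EFinD ltry.
(* A countable intersection over [p] makes one null set serve all accuracies before the limit is
   taken. *)
have hU := ae_foralln (fun p => ae_upper iid sigma_gt0 delta_gt0 X1 X2 Xp (ltn0Sn p)).
have hL := ae_foralln (fun p => ae_lower iid sigma_gt0 delta_gt0 X1 X2 Xp (ltn0Sn p)).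
apply: (@ae_coords _ _ _ P X (fun w => max_interval_energy w N /
  (2 * sigma ^+ 2 * N%:R * ln (ln N%:R)) @[N --> \oo] --> (1 : R))).
apply: filterS2 hU hL => w hUw hLw; exact: energy_ratio_cvg.
Qed.
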